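(* Let $T=(T(t))_{t>0}$ be a $\mathcal{C}_b$-semigroup of kernel operators on $\mathcal{B}_b(\mathds{R}^d)$ of type $(M,\omega)$ consisting of strong Feller operators, with full generator $\hat A$, and let $\rho>0$ be such that $T(t)f\in\mathcal{C}_b^\rho(\mathds{R}^d)$ for all $t>0$, $f\in\mathcal{B}_b(\mathds{R}^d)$, and there is $\varphi\in L^1(0,1)$ with $\|T(t)f\|_{\mathcal{C}_b^\rho}\le\varphi(t)\|f\|_\infty$ for $t\in(0,1)$, $f\in\mathcal{B}_b(\mathds{R}^d)$. Fix a Borel function $\chi$ with $\mathds{1}_{B(0,1)}\le\chi\le\mathds{1}_{B(0,2)}$. Let $b:\mathds{R}^d\to\mathds{R}^d$ be bounded and Borel measurable and let $\mu(x,dy)$, $x\in\mathds{R}^d$, be positive measures on $\mathds{R}^d\setminus\{0\}$ such that $x\mapsto\int f(y)\mu(x,dy)$ is Borel for all $f\in\mathcal{C}_c(\mathds{R}^d\setminus\{0\})$, and there is $\beta\in(0,2)$ with $\beta<\rho$ and $\sup_x\int\min\{|y|^\beta,1\}\mu(x,dy)<\infty$; if $\rho\le1$ assume that $b(x)-\int y\chi(y)\mu(x,dy)=0$ for all $x$. Let \[\hat Bf(x)=b(x)\cdot\nabla f(x)+\int_{\mathds{R}^d\setminus\{0\}}\big(f(x+y)-f(x)-y\cdot\nabla f(x)\chi(y)\big)\mu(x,dy)\] (for $\rho\le1$ this reads $\hat Bf(x)=\int(f(x+y)-f(x))\mu(x,dy)$), and $\hat A+\hat B=\{(u,f+\hat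 Bu):(u,f)\in\hat A\}$. Then: (a) $\hat A+\hat B$ is the full generator of a $\mathcal{C}_b$-semigroup $S$ consisting of strong Feller operators. (b) If $T$ consists of sub Markovian operators, then so does $S$. (c) If additionally $\sup_{x\in\mathds{R}^d}\mu(x,\{|y|>R\})\to0$ as $R\to\infty$, $T$ is a positive $\mathcal{C}_\infty$-semigroup and $\mathcal{C}_c^\infty(\mathds{R}^d)$ is a core for the generator $A$ of $T|_{\mathcal{C}_\infty(\mathds{R}^d)}$, then $S$ is a $\mathcal{C}_\infty$-semigroup.
   Context: Kernel operator on $\mathcal{B}_b(\mathds{R}^d)$: $Tf(x)=\int f(y)k(x,dy)$ with a bounded kernel. Semigroup of kernel operators of type $(M,\omega)$: kernel operators $T(t)$, $t>0$, with $T(t+s)=T(t)T(s)$, $\|T(t)\|\le Me^{\omega t}$, $(t,x)\mapsto T(t)f(x)$ measurable. Full generator: $\hat A=\{(f,g):T(t)f-f=\int_0^tT(s)g\,ds\ \forall t>0\}$. $\mathcal{C}_b$-semigroup: $T(t)\mathcal{C}_b\subset\mathcal{C}_b$ and $T(t)f\to f$ boundedly and pointwise as $t\to0$ for $f\in\mathcal{C}_b$. $\mathcal{C}_\infty$-semigroup: $T(t)\mathcal{C}_\infty\subset\mathcal{C}_\infty$ and $\|T(t)f-f\|_\infty\to0$ for $f\in\mathcal{C}_\infty$. Strong Feller: maps $\mathcal{B}_b$ into $\mathcal{C}_b$. Sub Markovian operator: positive with norm $\le1$. $\mathcal{C}_b^\rho$ is the standard Hölder space of order $\rho$ (bounded functions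 with bounded derivatives up to order $\lceil\rho\rceil-1$ whose highest derivatives are $(\rho-\lceil\rho\rceil+1)$-Hölder). Under the hypotheses one has $D(\hat A)\subset\mathcal{C}_b^\rho(\mathds{R}^d)$, so $\hat B$ is defined on $D(\hat A)$. *)

(* Defs.v *)
From HB Require Import structures.
From mathcomp Require Import all_boot all_order all_algebra.
From mathcomp Require Import all_classical all_reals all_analysis measurable_realfun.
Set Implicit Arguments. Unset Strict Implicit. Unset Printing Implicit Defensive.
Import Order.TTheory GRing.Theory Num.Theory.
Import numFieldNormedType.Exports.
Local Open Scope classical_set_scope.
Local Open Scope ring_scope.

Section Defs.
Variables (R : realType) (d : nat).

Definition V := 'rV[R]_d.
Definition Vb := g_sigma_algebraType (@open 'rV[R]_d).

Definition enorm (x : V) : R := Num.sqrt (\sum_i (x 0 i) ^+ 2).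
Definition evec (i : 'I_d) : V := delta_mx 0 i.

Definition borelf (f : V -> R) := measurable_fun (setT : set Vb) f.
Definition bnd (f : V -> R) := exists C : R, forall x, `|f x| <= C.
Definition Bb (f : V -> R) := borelf f /\ bnd f.
Definition Cb (f : V -> R) := continuous f /\ bnd f.
Definition Cinf (f : V -> R) := continuous f /\
  forall e : R, 0 < e -> exists r : R, forall x, r < enorm x -> `|f x| < e.
(* sup norm (used for bounded functions only) *)
Definition supn (f : V -> R) : R := sup [set `|f x| | x in [set: V]].

Definition bkernel (k : V -> {measure set Vb -> \bar R}) :=
  (forall A : set Vb, measurable A -> measurable_fun (setT : set Vb) (fun x => k x A)) /\
  exists C : R, forall x, (k x setT <= C%:E)%E.

(* kernel operator on B_b with a bounded (signed) kernel k = k1 - k2 *)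
Definition kernel_op (P : (V -> R) -> (V -> R)) :=
  exists k1 k2 : V -> {measure set Vb -> \bar R},
    bkernel k1 /\ bkernel k2 /\
    forall f, Bb f -> forall x,
      P f x = fine (\int[k1 x]_y (f y)%:E) - fine (\int[k2 x]_y (f y)%:E).

Definition kernel_sg (T : R -> (V -> R) -> (V -> R)) (M w : R) :=
  (forall t, 0 < t -> kernel_op (T t)) /\
  (forall t s f, 0 < t -> 0 < s -> Bb f -> T (t + s) f = T t (T s f)) /\
  (forall t f, 0 < t -> Bb f -> forall x, `|T t f x| <= M * expR (w * t) * supn f) /\
  (forall f, Bb f ->
     measurable_fun [set p : R * Vb | 0 < p.1] (fun p => T p.1 f p.2)).

Definition fullgen (T : R -> (V -> R) -> (V -> R)) (f g : V -> R) :=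
  Bb f /\ Bb g /\ forall t, 0 < t -> forall x,
    ((T t f x - f x)%:E = \int[@lebesgue_measure R]_(s in [set s : R | (0 < s < t)%R]) (T s g x)%:E)%E.

Definition Cb_cond (T : R -> (V -> R) -> (V -> R)) :=
  (forall t f, 0 < t -> Cb f -> Cb (T t f)) /\
  (forall f, Cb f ->
     (exists delta C : R, 0 < delta /\
        forall t, 0 < t < delta -> forall x, `|T t f x| <= C) /\
     forall x, T t f x @[t --> 0^'+] --> f x).

Definition Cb_sg (T : R -> (V -> R) -> (V -> R)) :=
  exists M w, kernel_sg T M w /\ Cb_cond T.

Definition Cinf_sg (T : R -> (V -> R) -> (V -> R)) :=
  (exists M w, kernel_sg T M w) /\
  (forall t f, 0 < t -> Cinf f -> Cinf (T t f)) /\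
  (forall f, Cinf f -> supn (fun x => T t f x - f x) @[t --> 0^'+] --> 0).

Definition strong_feller (T : R -> (V -> R) -> (V -> R)) :=
  forall t f, 0 < t -> Bb f -> Cb (T t f).

Definition positive_sg (T : R -> (V -> R) -> (V -> R)) :=
  forall t f, 0 < t -> Bb f -> (forall x, 0 <= f x) -> forall x, 0 <= T t f x.

Definition subMarkov_sg (T : R -> (V -> R) -> (V -> R)) :=
  positive_sg T /\ forall t f, 0 < t -> Bb f -> forall x, `|T t f x| <= supn f.

Definition partial (i : 'I_d) (f : V -> R) : V -> R := fun x => 'D_(evec i) f x.
Fixpoint pd (l : seq 'I_d) (f : V -> R) : V -> R :=
  if l is i :: l' then partial i (pd l' f) else f.

Definition hord (rho : R) : nat := `|Num.ceil rho - 1|%N.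
Definition hexp (rho : R) : R := rho - (hord rho)%:R.

Definition Cbrho (rho : R) (f : V -> R) :=
  (forall l : seq 'I_d, (size l < hord rho)%N -> forall i x, derivable (pd l f) x (evec i)) /\
  (forall l : seq 'I_d, (size l <= hord rho)%N -> bnd (pd l f)) /\
  (forall l : seq 'I_d, size l = hord rho -> exists C : R, forall x y,
      `|pd l f x - pd l f y| <= C * (enorm (x - y)) `^ (hexp rho)).

(* ||T(t) f||_{C_b^rho} <= phi(t) ||f||_oo for t in (0,1), phi in L^1(0,1)
   (stated for each term of the C_b^rho norm separately) *)
Definition holder_bound (T : R -> (V -> R) -> (V -> R)) (rho : R) :=
  exists phi : R -> R,
    (@lebesgue_measure R).-integrable [set s : R | (0 < s < 1)%R] (fun t => (phi t)%:E) /\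
    forall t f, 0 < t < 1 -> Bb f ->
      (forall l : seq 'I_d, (size l <= hord rho)%N ->
         forall x, `|pd l (T t f) x| <= phi t * supn f) /\
      (forall l : seq 'I_d, size l = hord rho -> forall x y,
         `|pd l (T t f) x - pd l (T t f) y|
            <= phi t * supn f * (enorm (x - y)) `^ (hexp rho)).

Definition Cc0 (f : V -> R) := continuous f /\
  exists K : set V, compact K /\ K `<=` ~` [set 0] /\ forall x, ~ K x -> f x = 0.

Definition Bhat (rho : R) (b : V -> V) (chi : V -> R)
    (mu : V -> {measure set Vb -> \bar R}) (f : V -> R) (x : V) : R :=
  if rho <= 1 then Rintegral (mu x) (~` [set 0]) (fun y => f (x + y) - f x)
  else \sum_i b x 0 i * partial i f x
       + Rintegral (mu x) (~` [set 0])
           (fun y => f (x + y) - f x - (\sum_i y 0 i * partial i f x) * chi y).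

Definition Ccinf (f : V -> R) :=
  (forall (l : seq 'I_d) i x, derivable (pd l f) x (evec i)) /\
  (forall l : seq 'I_d, continuous (pd l f)) /\
  exists K : set V, compact K /\ forall x, ~ K x -> f x = 0.

Definition genCinf (T : R -> (V -> R) -> (V -> R)) (f g : V -> R) :=
  Cinf f /\ Cinf g /\
  supn (fun x => (T t f x - f x) / t - g x) @[t --> 0^'+] --> 0.

Definition Ccinf_core (T : R -> (V -> R) -> (V -> R)) :=
  (forall f, Ccinf f -> exists g, genCinf T f g) /\
  forall f g, genCinf T f g ->
    exists fn gn : nat -> V -> R,
      (forall n, Ccinf (fn n) /\ genCinf T (fn n) (gn n)) /\
      supn (fun x => fn n x - f x) @[n --> \oo] --> 0 /\
      supn (fun x => gn n x - g x) @[n --> \oo] --> 0.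

End Defs.

(* Main.v *)
(* The semigroup S solves the Duhamel equation
     S(t) = T(t) + int_0^t S(t - s) B T(s) ds.
   Since T(s) smooths by phi(s), an integrable function, and B is bounded from
   C_b^rho to B_b, the integral term is a contraction for the norm weighted by
   exp(-lam t) with lam large, and S is the limit of the Picard iterates.  Kernel
   operators are handled as families of functionals that are continuous along
   bounded pointwise convergent sequences: the iterates stay in this class and
   keep the strong Feller property, and the Jordan decomposition turns such a
   family back into a bounded kernel.  The semigroup law and the inclusion of
   A + B in the generator of S follow from Fubini's theorem and uniqueness for
   the Duhamel equation; the reverse inclusion holds because k - A - B is onto
   for large k (Neumann series), while k - (generator of S) is injective.

   Everything about B beyond its bound comes from an approximation: replace the
   drift by difference quotients and discard the small jumps.  The resulting B_n
   are bounded on B_b and converge to B in the norm from C_b^rho to B_b, and for a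
   suitable constant c_n the operator B_n + c_n is positive of norm at most c_n.
   Rewriting the equation with T(t) exp(-c_n t) and B_n + c_n shows that the perturbed semigroups
   S_n are sub-Markovian when T is, and S_n converges to S.  The B_n preserve
   decay at infinity when the Levy measures are uniformly tight; so do B and T,
   hence also the Picard iterates and their uniform limit S. *)

Require Import Defs.
From HB Require Import structures.
From mathcomp Require Import all_boot all_order all_algebra.
From mathcomp Require Import all_classical all_reals all_analysis measurable_realfun.
From mathcomp Require Import ring lra zify.
Import Order.TTheory GRing.Theory Num.Theory.
Import numFieldNormedType.Exports.
Local Open Scope classical_set_scope.
Local Open Scope ring_scope.
Set Implicit Arguments. Unset Strict Implicit. Unset Printing Implicit Defensive.

(** * Integration of real functions *)

(** The order of the factors in the Duhamel integral is decisive: [B] only ever meets [T s f], whose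
    regularity is a hypothesis, and no smoothing by [S] has to be known while [S] is being built.
    The price is an integrand [S (t - s) (B (T s f))] built from merely Borel functions, for
    semigroups that need not be norm continuous in time. Integrals are therefore pointwise, and the
    obstacle is joint measurability. It is overcome by right continuity in time: the strong Feller
    property puts [T s f] in the class on which the semigroup is continuous at time 0, and one-sided
    continuity is enough for an approximation on a time grid. The semigroup law, stability and the
    sub-Markov property come from one device: a bound on a defect which the integral equation
    improves by a factor below 1, up to a source term. The norms of the [B_n] on bounded Borel
    functions may blow up with [n], but those from the smooth class do not, so one weight and one
    contraction constant serve [B] and all its approximations. *)

Section SequenceLimits.
Context (R : realType).
Implicit Types (u v : nat -> R) (l c : R).

Lemma cvg_le_cst u l c : (forall n, u n <= c) -> u n @[n --> \oo] --> l -> l <= c.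
Proof.
move=> uc ul; rewrite -(cvg_lim _ ul)//; apply: limr_le; last exact: nearW.
by apply/cvg_ex; exists l.
Qed.

Lemma cvg_ge_cst u l c : (forall n, c <= u n) -> u n @[n --> \oo] --> l -> c <= l.
Proof.
move=> uc ul; rewrite -(cvg_lim _ ul)//; apply: limr_ge; last exact: nearW.
by apply/cvg_ex; exists l.
Qed.

Lemma cvgn_unique u l1 l2 : u n @[n --> \oo] --> l1 -> u n @[n --> \oo] --> l2 -> l1 = l2.
Proof. by move=> h1 h2; rewrite -(cvg_lim _ h1)// -(cvg_lim _ h2). Qed.

End SequenceLimits.

Section RealIntegral.
Context d (T : measurableType d) (R : realType) (mu : {measure set T -> \bar R}).
Implicit Types f g a : T -> R.

Definition integ f := mu.-integrable setT (EFin \o f).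

Lemma integ_meas f : integ f -> measurable_fun setT f.
Proof. by move=> /measurable_int /measurable_EFinP. Qed.

Lemma integ_dom f a : measurable_fun setT f -> (forall x, `|f x| <= a x) ->
  integ a -> integ f.
Proof.
move=> mf fa ia; apply: (le_integrable measurableT _ _ ia).
  exact/measurable_EFinP.
by move=> x _ /=; rewrite lee_fin (le_trans (fa x))// ler_norm.
Qed.

Lemma integD f g : integ f -> integ g -> integ (fun x => f x + g x).
Proof. by move=> i1 i2; exact: (integrableD measurableT i1 i2). Qed.

Lemma integZ k f : integ f -> integ (fun x => k * f x).
Proof. by move=> i1; exact: (integrableZl measurableT k i1). Qed.

Lemma integB f g : integ f -> integ g -> integ (fun x => f x - g x).
Proof. by move=> i1 i2; exact: (integrableB measurableT i1 i2). Qed.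

Lemma Rint_linear k f g : integ f -> integ g ->
  \int[mu]_x (k * f x + g x) = k * \int[mu]_x f x + \int[mu]_x g x.
Proof. by move=> i1 i2; rewrite RintegralD// ?RintegralZl//; exact: integZ. Qed.

Lemma RintD f g : integ f -> integ g ->
  \int[mu]_x (f x + g x) = \int[mu]_x f x + \int[mu]_x g x.
Proof. by move=> i1 i2; rewrite RintegralD. Qed.

Lemma RintB f g : integ f -> integ g ->
  \int[mu]_x (f x - g x) = \int[mu]_x f x - \int[mu]_x g x.
Proof. by move=> i1 i2; rewrite RintegralB. Qed.

Lemma RintZ k f : integ f -> \int[mu]_x (k * f x) = k * \int[mu]_x f x.
Proof. by move=> i1; rewrite RintegralZl. Qed.

Lemma Rint_le f g : integ f -> integ g -> (forall x, f x <= g x) ->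
  \int[mu]_x f x <= \int[mu]_x g x.
Proof. by move=> i1 i2 fg; apply: le_Rintegral. Qed.

Lemma Rint0 : \int[mu]_x (0 : R) = 0.
Proof. by rewrite /Rintegral integral0_eq. Qed.

Lemma Rint_le_norm f a : measurable_fun setT f -> (forall x, `|f x| <= a x) ->
  integ a -> `|\int[mu]_x f x| <= \int[mu]_x a x.
Proof.
move=> mf fa ia; have fi := integ_dom mf fa ia.
apply: (le_trans (le_normr_Rintegral _ _)) => //.
by apply: le_Rintegral => //; exact: (integrable_norm fi).
Qed.

Lemma Rint_dct (fn : nat -> T -> R) f a : (forall n, measurable_fun setT (fn n)) ->
  (forall x, fn n x @[n --> \oo] --> f x) -> (forall n x, `|fn n x| <= a x) ->
  integ a -> \int[mu]_x fn n x @[n --> \oo] --> \int[mu]_x f x.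
Proof.
move=> mfn cf fa ia.
have mf : measurable_fun setT f.
  by apply: measurable_fun_cvg mfn _ => x _; exact: cf.
have h1 n : measurable_fun setT (EFin \o fn n) by exact/measurable_EFinP.
have h2 : measurable_fun setT (EFin \o f) by exact/measurable_EFinP.
have h3 : {ae mu, forall x, setT x -> (EFin \o fn n) x @[n --> \oo] --> (EFin \o f) x}.
  by apply: aeW => x _; apply: cvg_EFin; [exact: nearW|exact: cf].
have h4 : {ae mu, forall x, forall n, setT x -> (`|(EFin \o fn n) x| <= (EFin \o a) x)%E}.
  by apply: aeW => x n _; rewrite lee_fin.
have [fi _ c] := dominated_convergence measurableT h1 h2 h3 ia h4.
rewrite /Rintegral; apply: fine_cvg.
by rewrite fineK ?integrable_fin_num//; exact: c.
Qed.

End RealIntegral.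

(** * Fubini's theorem for real-valued iterated integrals *)

Section RealFubini.
Context d1 d2 (X : measurableType d1) (Y : measurableType d2) (R : realType).
Variables (m1 : {sigma_finite_measure set X -> \bar R}).
Variables (m2 : {sigma_finite_measure set Y -> \bar R}).
Variables (F : X -> Y -> R) (a : X -> R) (b : Y -> R).
Hypotheses (mF : measurable_fun setT (fun p => F p.1 p.2)).
Hypotheses (Fab : forall x y, `|F x y| <= a x * b y).
Hypotheses (ia : integ m1 a) (ib : integ m2 b).

Lemma meas_sec1 x : measurable_fun setT (F x).
Proof. exact: (measurable_fun_pair2 x mF). Qed.

Lemma meas_sec2 y : measurable_fun setT (F ^~ y).
Proof. exact: (measurable_fun_pair1 y mF). Qed.

(** The majorant is a product, so every section, and not just almost every one, is integrable. This
    makes the real-valued inner integrals meaningful at each point and keeps exceptional null sets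
    out of the applications of Fubini. *)
Lemma integ_prod : (m1 \x m2)%E.-integrable setT (fun p => (F p.1 p.2)%:E).
Proof.
apply/integrable12ltyP => /=; first exact/measurable_EFinP.
have H : (\int[m1]_x ((`|a x| * \int[m2]_y `|b y|)%:E) < +oo)%E.
  have i2 : integ m1 (fun x => `|a x| * \int[m2]_y `|b y|).
    under eq_fun do rewrite mulrC.
    by apply: integZ; exact: (integrable_norm ia).
  by have := integrable_fin_num measurableT i2; rewrite fin_numE => /andP[_]; rewrite ltey.
apply: le_lt_trans H; apply: ge0_le_integral => //.
- by move=> x _; apply: integral_ge0 => y _.
- have h1 : measurable_fun setT (fun p : X * Y => `|(F p.1 p.2)%:E|%E).
    by apply: measurableT_comp => //; exact/measurable_EFinP.
  exact: (measurable_fun_fubini_tonelli_F (m2 := m2) _ h1).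
- apply/measurable_EFinP; apply: measurable_funM => //.
  by apply: measurableT_comp => //; exact: integ_meas ia.
- move=> x _.
  have ib' : integ m2 (fun y => `|b y|) by exact: (integrable_norm ib).
  have -> : (`|a x| * \int[m2]_y `|b y|)%:E = (\int[m2]_y ((`|a x| * `|b y|)%:E))%E.
    rewrite -RintegralZl// /Rintegral fineK//; apply: integrable_fin_num => //.
    exact: (integZ `|a x| ib').
  apply: ge0_le_integral => //.
  + apply/measurable_EFinP; apply: measurableT_comp => //; exact: meas_sec1.
  + apply/measurable_EFinP; apply: measurable_funM => //.
    exact: integ_meas ib'.
  + by move=> y _; rewrite lee_fin (le_trans (Fab x y))// -normrM ler_norm.
Qed.

Lemma meas_Rint2 : measurable_fun setT (fun x => \int[m2]_y F x y).
Proof.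
by exact: (measurableT_comp (fine_measurable measurableT) (measurable_fubini_F integ_prod)).
Qed.

Lemma meas_Rint1 : measurable_fun setT (fun y => \int[m1]_x F x y).
Proof.
by exact: (measurableT_comp (fine_measurable measurableT) (measurable_fubini_G integ_prod)).
Qed.

Lemma Rint_Fubini :
  \int[m1]_x \int[m2]_y F x y = \int[m2]_y \int[m1]_x F x y.
Proof.
rewrite /Rintegral.
(* All sections being integrable, [fine] can be undone at each point, which restores the
   extended-real form of Fubini. *)
have -> : (\int[m1]_x (fine (\int[m2]_y (F x y)%:E))%:E = \int[m1]_x \int[m2]_y (F x y)%:E)%E.
  apply: eq_integral => x _; rewrite fineK//; apply: integrable_fin_num => //.
  apply: (@integ_dom _ _ _ _ (F x) (fun y => a x * b y)) => //.
    exact: meas_sec1.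
  exact: integZ.
have -> : (\int[m2]_y (fine (\int[m1]_x (F x y)%:E))%:E = \int[m2]_y \int[m1]_x (F x y)%:E)%E.
  apply: eq_integral => y _; rewrite fineK//; apply: integrable_fin_num => //.
  apply: (@integ_dom _ _ _ _ (F ^~ y) (fun x => b y * a x)) => //.
    exact: meas_sec2.
    by move=> x; rewrite mulrC.
  exact: integZ.
by rewrite (Fubini integ_prod).
Qed.

End RealFubini.

(** * Reflection and translation invariance of Lebesgue measure on the line *)

Section LebesgueInvariance.
Context (R : realType).
Notation leb := (@lebesgue_measure R).

Let refl (c : R) : measurableTypeR R -> measurableTypeR R := fun x => c - x.

Let mrefl c : measurable_fun setT (refl c).
Proof. exact: measurable_funB. Qed.

Let leb_refl c (A : set R) : measurable A -> leb A = leb (refl c @^-1` A).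
Proof.
move=> mA.
(* It suffices to compare on half-open intervals, where the reflection only changes which end is
   closed. *)
apply: (@lebesgue_measure_unique _ (pushforward leb (refl c))) => // X [[a b] _ <-].
transitivity (leb (`[c - b, c - a[%classic : set R)); last first.
  congr (leb _); apply/seteqP.
  by split => x /=; rewrite !in_itv /= /refl => /andP[? ?]; apply/andP; split; lra.
rewrite !lebesgue_measure_itv /= !lte_fin.
have -> : (c - b < c - a) = (a < b) by rewrite ltrD2l ltrN2.
by case: ifP => // _; rewrite -!EFinB; congr EFin; ring.
Qed.

Lemma ge0_integral_refl (c : R) (f : R -> \bar R) : measurable_fun setT f ->
  (forall x, 0 <= f x)%E -> (\int[leb]_x f (c - x)%R = \int[leb]_x f x)%E.
Proof.
move=> mf f0.
rewrite [RHS](eq_measure_integral (pushforward leb (refl c))); last first.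
  by move=> A mA _; exact: leb_refl.
by rewrite ge0_integral_pushforward.
Qed.

Lemma integ_refl (c : R) (f : R -> R) : integ leb f -> integ leb (fun x => f (c - x)).
Proof.
move=> fi; have mf := integ_meas fi; apply/integrableP; split.
  by apply/measurable_EFinP; apply: (measurableT_comp mf); exact: mrefl.
rewrite (ge0_integral_refl c (f := fun x => `|(f x)%:E|%E))//.
  by move: fi => /integrableP[].
by apply: measurableT_comp => //; exact/measurable_EFinP.
Qed.

(** Positive and negative parts are reflected separately, so the identity holds for every measurable
    [f], integrable or not. *)
Lemma Rint_refl (c : R) (f : R -> R) : measurable_fun setT f ->
  \int[leb]_x f (c - x) = \int[leb]_x f x.
Proof.
move=> mf; rewrite /Rintegral [in LHS]integralE [in RHS]integralE.
have mE : measurable_fun setT (EFin \o f) by exact/measurable_EFinP.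
have ep := ge0_integral_refl c (measurable_funepos mE) (fun x => funepos_ge0 _ x).
have en := ge0_integral_refl c (measurable_funeneg mE) (fun x => funeneg_ge0 _ x).
rewrite -ep -en; congr (fine (_ - _)%E); apply: eq_integral => x _.
  by rewrite !funeposE.
by rewrite !funenegE.
Qed.

(** A translation is the composition of two reflections, about [c / 2] and about 0. *)
Lemma Rint_shift (c : R) (f : R -> R) : measurable_fun setT f ->
  \int[leb]_x f (x + c) = \int[leb]_x f x.
Proof.
move=> mf; rewrite -[RHS](Rint_refl c)// -[RHS](Rint_refl 0)//.
  by apply: eq_Rintegral => x _; congr f; ring.
by apply: (measurableT_comp mf); exact: mrefl.
Qed.

End LebesgueInvariance.

(** * Sigma-continuous functionals *)

Section BoundedBorel.
Context (R : realType) (d : nat).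
Notation V := (V R d).
Notation Vb := (Vb R d).
Implicit Types f g : V -> R.

Lemma gt_open_borelf f : (forall a, open [set x | a < f x]) -> borelf f.
Proof.
move=> fo; apply: (measurability (@RGenOInfty.G R)).
  exact: RGenOInfty.measurableE.
move=> _ [_ [a ->] <-]; rewrite setTI; apply: sub_sigma_algebra.
rewrite (_ : f @^-1` _ = [set x | a < f x])//.
by apply/seteqP; split => x /=; rewrite in_itv/= andbT.
Qed.

Lemma continuous_borelf f : continuous f -> borelf f.
Proof.
move=> cf; apply: gt_open_borelf => a.
have -> : [set x | a < f x] = f @^-1` [set y | a < y] by [].
by apply: open_comp => //; exact: open_gt.
Qed.

Lemma Cb_Bb f : Cb f -> Bb f.
Proof. by move=> [cf bf]; split => //; exact: continuous_borelf. Qed.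

Lemma Bb_cst (k : R) : Bb (fun _ : V => k).
Proof. by split; [exact: measurable_cst|exists `|k|]. Qed.

Lemma Bb_lin k f g : Bb f -> Bb g -> Bb (fun x => k * f x + g x).
Proof.
move=> [mf [C Cf]] [mg [D Dg]]; split.
  by apply: measurable_funD => //; exact: measurable_funM.
exists (`|k| * C + D) => x; rewrite (le_trans (ler_normD _ _))// lerD//.
by rewrite normrM ler_wpM2l.
Qed.

Lemma BbD f g : Bb f -> Bb g -> Bb (fun x => f x + g x).
Proof.
by move=> h1 h2; have := Bb_lin 1 h1 h2; under eq_fun do rewrite mul1r.
Qed.

Lemma BbB f g : Bb f -> Bb g -> Bb (fun x => f x - g x).
Proof.
move=> h1 h2; have := Bb_lin (-1) h2 h1.
by under eq_fun do rewrite mulN1r addrC.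
Qed.

Lemma BbZ k f : Bb f -> Bb (fun x => k * f x).
Proof.
by move=> h1; have := Bb_lin k h1 (Bb_cst 0); under eq_fun do rewrite addr0.
Qed.

Lemma Bb_sum (I : Type) (s : seq I) (F : I -> V -> R) :
  (forall i, Bb (F i)) -> Bb (fun x => \sum_(i <- s) F i x).
Proof.
move=> h; elim: s => [|i s IH].
  by under eq_fun do rewrite big_nil; exact: Bb_cst.
by under eq_fun do rewrite big_cons; exact: BbD.
Qed.

Lemma Bb_indic (A : set Vb) : measurable A -> Bb (\1_A : V -> R).
Proof.
by move=> mA; split; [exact: measurable_indic|exists 1 => x; rewrite indicE; case: (_ \in _); rewrite ?normr0 ?normr1].
Qed.

Lemma Bb_lim (fn : nat -> V -> R) f c : (forall n, Bb (fn n)) ->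
  (forall n x, `|fn n x| <= c) -> (forall x, fn n x @[n --> \oo] --> f x) -> Bb f.
Proof.
move=> Bn bn cf; split.
  by apply: (@measurable_fun_cvg _ Vb _ _ fn) => [n|x _]; [have [] := Bn n|exact: cf].
exists c => x; have h : `|fn n x| @[n --> \oo] --> `|f x| by apply: cvg_norm; exact: cf.
exact: (cvg_le_cst _ h).
Qed.

Lemma supn_ge f : bnd f -> forall x, `|f x| <= supn f.
Proof.
move=> [C fC] x; apply: ub_le_sup; last by exists x.
by exists C => _ [y _ <-].
Qed.

Lemma supn_ge0 f : bnd f -> 0 <= supn f.
Proof. by move=> bf; rewrite (le_trans _ (supn_ge bf 0)). Qed.

Lemma supn_le f c : (forall x, `|f x| <= c) -> supn f <= c.
Proof. by move=> fc; apply: ge_sup; [exists `|f 0|, 0|move=> _ [x _ <-]]. Qed.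

End BoundedBorel.

Section SigmaFunctional.
Context (R : realType) (d : nat).
Notation V := (V R d).
Notation Vb := (Vb R d).
Implicit Types (f g : V -> R) (L : (V -> R) -> R).

(* By the Jordan decomposition these are the integrals against the bounded
   signed measures of total variation at most [C]. *)
Definition sfun (C : R) L :=
  [/\ forall k f g, Bb f -> Bb g -> L (fun x => k * f x + g x) = k * L f + L g,
      forall f c, Bb f -> (forall x, `|f x| <= c) -> `|L f| <= C * c
    & forall (fn : nat -> V -> R) f c, (forall n, Bb (fn n)) ->
        (forall n x, `|fn n x| <= c) -> (forall x, fn n x @[n --> \oo] --> f x) ->
        L (fn n) @[n --> \oo] --> L f].

Lemma sfun_le C D L : C <= D -> sfun C L -> sfun D L.
Proof.
move=> CD [l b s]; split => // f c Bf fc; apply: (le_trans (b _ _ Bf fc)).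
by rewrite ler_wpM2r// (le_trans _ (fc 0)).
Qed.

Lemma sfun_eq C L1 L2 : (forall f, Bb f -> L1 f = L2 f) -> sfun C L1 -> sfun C L2.
Proof.
move=> e [l b s]; split.
- by move=> k f g Bf Bg; rewrite -!e//; [exact: l|exact: Bb_lin].
- by move=> f c Bf fc; rewrite -e//; exact: b.
- move=> fn f c Bn bn cf; rewrite -e; last exact: Bb_lim Bn bn cf.
  by under eq_fun do rewrite -e//; exact: s cf.
Qed.

Section Lemmas.
Variables (C : R) (L : (V -> R) -> R) (sL : sfun C L).

Lemma sfun_lin k f g : Bb f -> Bb g -> L (fun x => k * f x + g x) = k * L f + L g.
Proof. by case: sL => h _ _; exact: h. Qed.

Lemma sfun_bnd f c : Bb f -> (forall x, `|f x| <= c) -> `|L f| <= C * c.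
Proof. by case: sL => _ h _; exact: h. Qed.

Lemma sfun_cvg (fn : nat -> V -> R) f c : (forall n, Bb (fn n)) ->
  (forall n x, `|fn n x| <= c) -> (forall x, fn n x @[n --> \oo] --> f x) ->
  L (fn n) @[n --> \oo] --> L f.
Proof. by case: sL => _ _ h; exact: h. Qed.

Lemma sfun0 : L (fun=> 0) = 0.
Proof.
apply/eqP; rewrite -normr_le0 -[X in _ <= X](mulr0 C); apply: sfun_bnd; first exact: Bb_cst.
by move=> x; rewrite normr0.
Qed.

Lemma sfunD f g : Bb f -> Bb g -> L (fun x => f x + g x) = L f + L g.
Proof.
move=> Bf Bg; rewrite -[in RHS](mul1r (L f)) -sfun_lin//.
by congr L; apply/funext => x; rewrite mul1r.
Qed.

Lemma sfunZ k f : Bb f -> L (fun x => k * f x) = k * L f.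
Proof.
move=> Bf; rewrite -[RHS]addr0 -sfun0 -sfun_lin//; last exact: Bb_cst.
by congr L; apply/funext => x; rewrite addr0.
Qed.

Lemma sfunB f g : Bb f -> Bb g -> L (fun x => f x - g x) = L f - L g.
Proof.
move=> Bf Bg; rewrite addrC -mulN1r -sfun_lin//.
by congr L; apply/funext => x; rewrite mulN1r addrC.
Qed.

Lemma sfun_sum (I : Type) (s : seq I) (F : I -> V -> R) :
  (forall i, Bb (F i)) -> L (fun x => \sum_(i <- s) F i x) = \sum_(i <- s) L (F i).
Proof.
move=> h; elim: s => [|i s IH].
  by under eq_fun do rewrite big_nil; rewrite big_nil sfun0.
under eq_fun do rewrite big_cons.
by rewrite big_cons sfunD// ?IH//; exact: Bb_sum.
Qed.

Lemma sfun_C0 : 0 <= C.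
Proof.
rewrite -[C]mulr1; apply: (le_trans (normr_ge0 _)).
by apply: (@sfun_bnd (fun=> 1)) => [|x] /=; [exact: Bb_cst|rewrite normr1].
Qed.

End Lemmas.

Lemma sfun_comb C1 C2 k1 k2 L1 L2 : sfun C1 L1 -> sfun C2 L2 ->
  sfun (`|k1| * C1 + `|k2| * C2) (fun f => k1 * L1 f + k2 * L2 f).
Proof.
move=> s1 s2; split.
- by move=> k f g Bf Bg; rewrite (sfun_lin s1)// (sfun_lin s2)//; ring.
- move=> f c Bf fc; rewrite (le_trans (ler_normD _ _))// mulrDl lerD//;
    rewrite normrM -mulrA ler_wpM2l//.
  + exact: (sfun_bnd s1).
  + exact: (sfun_bnd s2).
- move=> fn f c Bn bn cf; apply: cvgD; apply: cvgMr.
  + exact: (sfun_cvg s1 Bn bn cf).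
  + exact: (sfun_cvg s2 Bn bn cf).
Qed.

Lemma sfun_eval (x : V) : sfun 1 (fun f => f x).
Proof. by split => // f c Bf fc; rewrite mul1r. Qed.

Lemma sfun_comp_Bb C (phi : V -> V) L :
  (forall f, Bb f -> Bb (f \o phi)) -> sfun C L -> sfun C (fun f => L (f \o phi)).
Proof.
move=> mp s; split.
- by move=> k f g Bf Bg; rewrite -(sfun_lin s)//; exact: mp.
- by move=> f c Bf fc; apply: (sfun_bnd s); [exact: mp|move=> x; exact: fc].
- move=> fn f c Bn bn cf; apply: (sfun_cvg s (c := c)) => [n|n x|x].
  + exact: mp.
  + exact: bn.
  + exact: cf.
Qed.

Section FiniteMeasure.
Variables (C : R) (k : {measure set Vb -> \bar R}) (kC : (k setT <= C%:E)%E).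

Lemma integ_cst (c : R) : integ k (fun=> c).
Proof.
apply/integrableP; split; first exact: measurable_cst.
rewrite /= integral_cst// lte_mul_pinfty//.
by rewrite (le_lt_trans kC)// ltry.
Qed.

Lemma integ_Bb f : Bb f -> integ k f.
Proof. by move=> [mf [c fc]]; exact: integ_dom mf fc (integ_cst c). Qed.

Lemma sfun_meas : sfun C (fun f => \int[k]_x f x).
Proof.
split.
- by move=> a f g Bf Bg; rewrite Rint_linear//; exact: integ_Bb.
- move=> f c Bf fc; have c0 : 0 <= c by rewrite (le_trans _ (fc 0)).
  rewrite (le_trans (Rint_le_norm (proj1 Bf) fc (integ_cst c)))//.
  rewrite Rintegral_cst// mulrC ler_wpM2r// -lee_fin fineK//.
  by rewrite ge0_fin_numE// (le_lt_trans kC)// ltry.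
- move=> fn f c Bn bn cf.
  have mfn n : measurable_fun (setT : set Vb) (fn n) by have [] := Bn n.
  exact: (Rint_dct mfn cf bn (integ_cst c)).
Qed.

End FiniteMeasure.

Import HBSimple HBNNSimple.

(** Agreement on indicators passes to simple functions by linearity, and to bounded Borel functions
    by continuity along bounded pointwise limits. *)
Lemma sfun_ext C1 C2 L1 L2 : sfun C1 L1 -> sfun C2 L2 ->
  (forall A : set Vb, measurable A -> L1 \1_A = L2 \1_A) ->
  forall f, Bb f -> L1 f = L2 f.
Proof.
move=> s1 s2 eA f Bf; have [mf [c fc]] := Bf.
(* The simple approximations are for nonnegative functions, hence the shift by the bound [c]. It is
   removed at the end by evaluating both functionals at a constant, a multiple of the indicator of
   the whole space. *)
have mg : measurable_fun (setT : set Vb) (EFin \o (fun x : V => f x + c)).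
  by apply/measurable_EFinP; apply: measurable_funD => //.
have g0 x : (setT : set Vb) x -> (0 <= (EFin \o (fun x : V => (f x + c)%R)) x)%E.
  by move=> _; rewrite lee_fin; have := fc x; rewrite ler_norml => /andP[]; lra.
pose gn := nnsfun_approx measurableT mg.
pose gf n : V -> R := (gn n : Vb -> R).
have gE n : gf n =
    (fun x => \sum_(y <- finmap.enum_fset (fset_set (range (gn n)))) y * \1_(gn n @^-1` [set y]) x).
  by apply/funext => x; rewrite /gf {1}(fimfunE (gn n) x) fsbig_finite.
have mI n y : measurable (gn n @^-1` [set y] : set Vb) by exact: measurable_sfunP.
have Bgn n : Bb (gf n).
  by rewrite gE; apply: Bb_sum => y; apply: BbZ; exact: Bb_indic.
have eL n : L1 (gf n) = L2 (gf n).
  rewrite gE (sfun_sum s1) ?(sfun_sum s2); [|by move=> y; apply: BbZ; exact: Bb_indic..].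
  apply: eq_bigr => y _; rewrite (sfunZ s1) ?(sfunZ s2) ?eA//; exact: Bb_indic.
have cg x : gf n x @[n --> \oo] --> f x + c.
  by have /fine_cvgP[] := cvg_nnsfun_approx measurableT mg g0 (x := x) Logic.I.
have bg n x : `|gf n x| <= c + c.
  rewrite ger0_norm; last exact: fun_ge0.
  apply: (@le_trans _ _ (f x + c)).
    rewrite -(cvg_lim _ (cg x))//; apply: nondecreasing_cvgn_le.
      by move=> i j ij; have /lefP := nd_nnsfun_approx measurableT mg ij; exact.
    by apply/cvg_ex; eexists; exact: cg.
  by have := fc x; rewrite ler_norml => /andP[]; lra.
have c1 := sfun_cvg s1 Bgn bg cg; have c2 := sfun_cvg s2 Bgn bg cg.
have : L1 (fun x => f x + c) = L2 (fun x => f x + c).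
  by rewrite -(cvg_lim _ c1)// -(cvg_lim _ c2)//; congr (lim _); under eq_fun do rewrite eL.
have Bc := @Bb_cst R d c.
rewrite (sfunD s1)// (sfunD s2)//.
suff -> : L1 (fun=> c) = L2 (fun=> c) by lra.
have -> : (fun=> c) = (fun x : V => c * (\1_(setT : set Vb) x)).
  by apply/funext => x; rewrite indicT mulr1.
by rewrite (sfunZ s1) ?(sfunZ s2) ?eA//; exact: Bb_indic.
Qed.

End SigmaFunctional.

Section IndicatorSums.
Context (R : realType) (T : Type) (F : nat -> set T).
Hypothesis tF : trivIset setT F.

Lemma indic_bigcup_cvg (x : T) :
  \sum_(0 <= i < n) (\1_(F i) x : R) @[n --> \oo] --> (\1_(\bigcup_n F n) x : R).
Proof.
have := @indic_bigcup _ R F x tF.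
set u := (u in _ = u) => eu; have : cvgn (fun n => \sum_(0 <= i < n) (\1_(F i) x : R)%:E)%E.
  by apply: is_cvg_nneseries => n _ _; rewrite lee_fin indicE ler0n.
move=> /cvg_ex[l cl]; move: eu; rewrite /u (cvg_lim _ cl)// => el.
move: cl; rewrite -el => cl.
move: cl; under eq_fun do rewrite sumEFin.
by move=> /fine_cvgP[].
Qed.

Lemma indic_sum_le1 n (x : T) : `|\sum_(0 <= i < n) (\1_(F i) x : R)| <= 1.
Proof.
have s0 m : 0 <= \sum_(0 <= i < m) (\1_(F i) x : R).
  by apply: sumr_ge0 => i _; rewrite indicE ler0n.
rewrite ger0_norm//.
have c1 : (\1_(\bigcup_n F n) x : R) <= 1 by rewrite indicE; case: (_ \in _).
apply: le_trans c1.
have cF : \sum_(0 <= i < n) (\1_(F i) x : R) @[n --> \oo] --> (\1_(\bigcup_n F n) x : R).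
  exact: indic_bigcup_cvg.
rewrite -(cvg_lim _ cF)//; apply: nondecreasing_cvgn_le; last first.
  by apply/cvg_ex; eexists; exact: cF.
by apply/nondecreasing_seqP => m; rewrite big_nat_recr//= lerDl indicE ler0n.
Qed.

End IndicatorSums.

(** * The signed measure behind a sigma-continuous functional *)

Section JordanRepresentation.
Context (R : realType) (d : nat).
Notation V := (V R d).
Notation Vb := (Vb R d).
Variables (C : R) (L : (V -> R) -> R).

Definition charge_of_sfun & sfun C L := fun A : set Vb => (L \1_A)%:E.

Variable (sL : sfun C L).

Let nu := charge_of_sfun sL.

Let nu0 : nu set0 = 0%E.
Proof.
rewrite /nu /charge_of_sfun (_ : \1_set0 = fun=> 0) ?(sfun0 sL)//.
by apply/funext => x; rewrite indic0.
Qed.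

Let nu_fin (A : set Vb) : measurable A -> nu A \is a fin_num.
Proof. by []. Qed.

(** The partial sums of indicators of disjoint sets are bounded by 1 and converge pointwise, so
    countable additivity is an instance of sigma-continuity. *)
Let nu_sigma : semi_sigma_additive nu.
Proof.
move=> F mF tF mUF.
have -> : (fun n => (\sum_(0 <= i < n) nu (F i))%E) =
    EFin \o (fun n => L (fun x => \sum_(0 <= i < n) \1_(F i) x)).
  apply/funext => n /=; rewrite (sfun_sum sL) ?sumEFin// => i; exact: Bb_indic.
have cF x : \sum_(0 <= i < n) (\1_(F i) x : R) @[n --> \oo] --> (\1_(\bigcup_n F n) x : R).
  exact: indic_bigcup_cvg.
apply: cvg_EFin; first exact: nearW.
apply: (sfun_cvg sL (c := 1) _ _ cF) => [n|n x].
  by apply: Bb_sum => i; exact: Bb_indic.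
exact: indic_sum_le1.
Qed.

HB.instance Definition _ := isCharge.Build _ _ _ nu nu0 nu_fin nu_sigma.

(** Intersecting with the two sets of a Hahn decomposition gives the two parts. The last clause
    describes [k1 A] as the largest value of [L] on measurable subsets of [A], without reference to
    the Hahn sets; these would vary uncontrollably with the base point once [L] is the functional at
    [x] of an operator. *)
Lemma jordan_sfun : exists k1 k2 : {finite_measure set Vb -> \bar R},
  [/\ forall f, Bb f -> L f = \int[k1]_x f x - \int[k2]_x f x,
      (k1 setT <= C%:E)%E, (k2 setT <= C%:E)%E &
      forall A : set Vb, measurable A ->
        (forall E : set Vb, measurable E -> E `<=` A -> L \1_E <= fine (k1 A)) /\
        exists E : set Vb, [/\ measurable E, E `<=` A & fine (k1 A) = L \1_E]].
Proof.
have [P [N PN]] := Hahn_decomposition nu.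
pose k1 : {finite_measure set Vb -> \bar R} := jordan_pos PN.
pose k2 : {finite_measure set Vb -> \bar R} := jordan_neg PN.
have [[mP Ppos] [mN Nneg] PUN PIN] := PN.
have k1E A : measurable A -> k1 A = nu (A `&` P).
  by move=> mA; rewrite -[k1 A]/(jordan_pos PN A) jordan_posE cjordan_posE /crestr0/= mem_set.
have k2E A : measurable A -> k2 A = (- nu (A `&` N))%E.
  by move=> mA; rewrite -[k2 A]/(jordan_neg PN A) jordan_negE cjordan_negE /crestr0/= mem_set.
have Lb (A : set Vb) : measurable A -> `|L \1_A| <= C.
  move=> mA; rewrite -[C]mulr1; apply: (sfun_bnd sL); first exact: Bb_indic.
  by move=> x; rewrite indicE; case: (_ \in _); rewrite ?normr0 ?normr1.
have k1C : (k1 setT <= C%:E)%E.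
  rewrite k1E// lee_fin (le_trans (ler_norm _))// Lb//; exact: measurableI.
have k2C : (k2 setT <= C%:E)%E.
  rewrite k2E// -EFinN lee_fin (le_trans (ler_norm _))// normrN Lb//; exact: measurableI.
have LE (A : set Vb) : measurable A -> L \1_A = fine (k1 A) - fine (k2 A).
  move=> mA; have := jordan_decomp PN mA.
  rewrite /cadd/= cscaleN1 -/k1 -/k2 => /(congr1 fine) /= ->.
  by rewrite fineB//; exact: fin_num_measure.
exists k1, k2; split => //.
- move=> f Bf.
  have s12 := sfun_comb 1 (-1) (sfun_meas k1C) (sfun_meas k2C).
  rewrite (@sfun_ext _ _ _ _ _ _ sL s12)//; first by rewrite mul1r mulN1r.
  by move=> A mA; rewrite /Rintegral !integral_indic// !setIT mul1r mulN1r; exact: LE.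
- move=> A mA; split; last first.
    by exists (A `&` P); split => //; [exact: measurableI|rewrite k1E].
  move=> E mE EA; rewrite LE// (@le_trans _ _ (fine (k1 E)))//.
    by rewrite gerBl fine_ge0.
  by rewrite fine_le// ?fin_num_measure// le_measure ?inE.
Qed.

End JordanRepresentation.

(** * Kernels, and interchange of functionals with parameter integrals *)

Section KernelOperators.
Context (R : realType) (d : nat).
Notation V := (V R d).
Notation Vb := (Vb R d).

Section Interchange.
Context dX (X : measurableType dX) (m : {sigma_finite_measure set X -> \bar R}).
Variables (h : X -> V -> R) (a : X -> R).
Hypotheses (mh : measurable_fun setT (fun p : X * Vb => h p.1 p.2)).
Hypotheses (ha : forall s x, `|h s x| <= a s) (ia : integ m a).

Lemma Bb_section s : Bb (h s).
Proof. by split; [exact: (measurable_fun_pair2 s mh)|exists (a s) => x; exact: ha]. Qed.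

Lemma meas_section x : measurable_fun setT (h ^~ x).
Proof. exact: (measurable_fun_pair1 (x : Vb) mh). Qed.

Let finprod (k : {finite_measure set Vb -> \bar R}) :
  [/\ measurable_fun (setT : set Vb) (fun x => \int[m]_s h s x),
      measurable_fun setT (fun s => \int[k]_x h s x) &
      \int[k]_x \int[m]_s h s x = \int[m]_s \int[k]_x h s x].
Proof.
have ib : integ k (fun=> 1 : R).
  apply: (@integ_cst _ _ (fine (k setT))); rewrite fineK//; exact: fin_num_measure.
have hab s (x : Vb) : `|h s x| <= a s * 1 by rewrite mulr1.
split; first exact: (meas_Rint1 mh hab ia ib).
- exact: (meas_Rint2 mh hab ia ib).
- by rewrite (Rint_Fubini mh hab ia ib).
Qed.

Lemma Bb_Rint : Bb (fun x => \int[m]_s h s x).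
Proof.
split; last by exists (\int[m]_s a s) => x; apply: Rint_le_norm => //; exact: meas_section.
(* Borel measurability in [x] does not involve the finite measure on the space; a Dirac mass
   provides one. *)
by have [] := finprod (dirac (0 : Vb)).
Qed.

(** Through the two finite measures that represent [L], this is Fubini's theorem. It is what allows
    operators to be moved under the time integrals. *)
Lemma sfun_Rint C (L : (V -> R) -> R) : sfun C L ->
  measurable_fun setT (fun s => L (h s)) /\
  L (fun x => \int[m]_s h s x) = \int[m]_s L (h s).
Proof.
move=> sL; have [k1 [k2 [LE k1C k2C _]]] := jordan_sfun sL.
have [_ m1 e1] := finprod k1; have [_ m2 e2] := finprod k2.
have LhE : (fun s => L (h s)) = (fun s => \int[k1]_x h s x - \int[k2]_x h s x).
  by apply/funext => s; rewrite LE//; exact: Bb_section.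
have bnd_k (k : {finite_measure set Vb -> \bar R}) : (k setT <= C%:E)%E ->
    measurable_fun setT (fun s => \int[k]_x h s x) -> integ m (fun s => \int[k]_x h s x).
  move=> kC mk; apply: (integ_dom mk _ (integZ C ia)) => s.
  exact: (sfun_bnd (sfun_meas kC) (Bb_section s) (ha s)).
rewrite LhE LE; last exact: Bb_Rint.
split; first exact: measurable_funB.
by rewrite e1 e2 RintegralB//; exact: bnd_k.
Qed.

End Interchange.

Lemma kernel_op_sfun (P : (V -> R) -> V -> R) : kernel_op P ->
  exists C, forall x, sfun C (fun f => P f x).
Proof.
move=> [k1 [k2 [[_ [C1 h1]] [[_ [C2 h2]] PE]]]].
exists (`|1| * C1 + `|-1| * C2) => x.
apply: sfun_eq (sfun_comb 1 (-1) (sfun_meas (h1 x)) (sfun_meas (h2 x))) => f Bf.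
by rewrite PE// mul1r mulN1r.
Qed.

(** A representation [k1 - k2] may be far from minimal, and then the constant read off from it
    exceeds the operator norm. The constant can be replaced by any bound known from elsewhere. *)
Lemma sfun_sharp C D (L : (V -> R) -> R) : sfun C L ->
  (forall f c, Bb f -> (forall x, `|f x| <= c) -> `|L f| <= D * c) -> sfun D L.
Proof. by move=> [l _ s] b; split. Qed.

(* Continuity of [P \1_E] makes the positive part [sup_{E `<=` A} P \1_E x] of
   the kernel lower semicontinuous in [x], hence Borel. *)
Lemma sfun_kernel_op C (P : (V -> R) -> V -> R) :
  (forall x, sfun C (fun f => P f x)) -> (forall f, Bb f -> continuous (P f)) ->
  kernel_op P.
Proof.
move=> sP cP; have /choice[k1 /choice[k2 H]] := fun x => jordan_sfun (sP x).
have mk1 (A : set Vb) : measurable A -> borelf (fun x => fine (k1 x A)).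
  move=> mA; apply: gt_open_borelf => r.
  have -> : [set x | r < fine (k1 x A)] = \bigcup_(E in [set E : set Vb | measurable E /\ E `<=` A])
      [set x | r < P \1_E x].
    apply/seteqP; split => [x /= rx|x [E [mE EA] /= rE]].
      have [_ _ _ /(_ _ mA)[_ [E [mE EA eE]]]] := H x.
      by exists E => //=; rewrite -eE.
    by have [_ _ _ /(_ _ mA)[/(_ _ mE EA) + _]] := H x; exact: lt_le_trans.
  apply: bigcup_open => E [mE _].
  have -> : [set x | r < P \1_E x] = P \1_E @^-1` [set y | r < y] by [].
  by apply: open_comp => [x _|]; [apply: cP; exact: Bb_indic|exact: open_gt].
have mk1e (A : set Vb) : measurable A -> measurable_fun (setT : set Vb) (fun x => k1 x A).
  move=> mA; have -> : (fun x => k1 x A) = EFin \o (fun x => fine (k1 x A)).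
    by apply/funext => x /=; rewrite fineK//; exact: fin_num_measure.
  by apply/measurable_EFinP; exact: mk1.
have mk2e (A : set Vb) : measurable A -> measurable_fun (setT : set Vb) (fun x => k2 x A).
  move=> mA; have -> : (fun x => k2 x A) = EFin \o (fun x => fine (k1 x A) - P \1_A x).
    apply/funext => x /=; have [PE _ _ _] := H x.
    rewrite PE /Rintegral ?integral_indic ?setIT//; last exact: Bb_indic.
    by rewrite opprB addrCA subrr addr0 fineK//; exact: fin_num_measure.
  apply/measurable_EFinP; apply: measurable_funB; first exact: mk1.
  by apply: continuous_borelf; apply: cP; exact: Bb_indic.
exists (fun x => k1 x), (fun x => k2 x); split; [|split].
- by split => //; exists C => x; have [] := H x.
- by split => //; exists C => x; have [] := H x.
- by move=> f Bf x; have [PE _ _ _] := H x; rewrite PE.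
Qed.

End KernelOperators.

(** * Sequences, contractions, measurable selections *)

Section LimitTools.
Context (R : realType).

Lemma cvg_seq0_le (u v : nat -> R) l : (forall n, `|u n - l| <= v n) ->
  v n @[n --> \oo] --> 0 -> u n @[n --> \oo] --> l.
Proof.
move=> uv v0; apply/cvgrPdist_le => e e0.
have /cvgrPdist_le/(_ _ e0) := v0; apply: filterS => n.
rewrite sub0r normrN => vn; rewrite distrC (le_trans (uv n))//.
by rewrite (le_trans _ vn)// ler_norm.
Qed.

(** Interchange of two limits, one of them uniform. The filter is arbitrary, so that sequences and
    continuity at a point are covered together. *)
Lemma cvg_uniform_approx (T : Type) (F : set_system T) {FF : Filter F}
    (u : T -> R) (un : nat -> T -> R) (l : R) (ln e : nat -> R) :
  (forall n x, `|un n x - u x| <= e n) -> (forall n, `|ln n - l| <= e n) ->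
  e n @[n --> \oo] --> 0 -> (forall n, un n x @[x --> F] --> ln n) ->
  u x @[x --> F] --> l.
Proof.
move=> ue le e0 cu; apply/cvgrPdist_le => eps eps0.
have e3 : 0 < eps / 3 by rewrite divr_gt0.
have /cvgrPdist_le/(_ _ e3)[n _ /(_ n (leqnn n))] := e0.
rewrite /= sub0r normrN => en.
have /cvgrPdist_le/(_ _ e3) := cu n; apply: filterS => x ux.
have h1 := ue n x; have h2 := le n.
have -> : l - u x = - (ln n - l) + (ln n - un n x) + (un n x - u x) by ring.
have -> : eps = eps / 3 + eps / 3 + eps / 3 by field.
rewrite (le_trans (ler_normD _ _))// lerD//.
  rewrite (le_trans (ler_normD _ _))// lerD// normrN.
  by rewrite (le_trans h2)// (le_trans _ en)// ler_norm.
by rewrite (le_trans h1)// (le_trans _ en)// ler_norm.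
Qed.

(** Points violating continuity are picked in balls of radius [1 / (n + 1)]. The sequential form
    makes dominated convergence available for continuity in space. *)
Lemma cvg_seqP (U : pseudoMetricType R) (f : U -> R) (x : U) :
  (forall u : nat -> U, u n @[n --> \oo] --> x -> f (u n) @[n --> \oo] --> f x) ->
  {for x, continuous f}.
Proof.
move=> H; apply/cvgrPdist_le => e e0; apply: contrapT => N.
have : forall n, exists y, ball x (n.+1%:R^-1) y /\ ~ (`|f x - f y| <= e).
  move=> n; apply: contrapT => Q; apply: N.
  have n0 : (0 : R) < n.+1%:R^-1 by rewrite invr_gt0.
  have := nbhsx_ballx x _ n0; apply: filterS => y xy.
  by apply: contrapT => Q'; apply: Q; exists y.
move=> /choice[u uP].
have cu : u n @[n --> \oo] --> x.
  apply/cvg_ballP => eps eps0.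
  have : (n.+1%:R^-1 : R) @[n --> \oo] --> (0 : R) by exact: cvg_harmonic.
  move=> /cvgrPdist_lt/(_ _ eps0); apply: filterS => n.
  rewrite /= sub0r normrN ger0_norm ?invr_ge0// => ne.
  by have [+ _] := uP n; apply: le_ball; exact: ltW.
have /cvgrPdist_le/(_ _ e0)[n _ /(_ n (leqnn n))] := H u cu.
by have [_] := uP n.
Qed.

Lemma cvg_geo (q : R) : 0 <= q < 1 -> forall A, A * q ^+ n @[n --> \oo] --> (0 : R).
Proof.
move=> /andP[q0 q1] A; rewrite -[X in _ --> X](mulr0 A); apply: cvgMr.
by apply: cvg_expr; rewrite ger0_norm.
Qed.

Lemma contraction_limit (q z A B : R) : 0 <= q < 1 ->
  (forall n, z <= A * q ^+ n + B) -> z <= B.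
Proof.
move=> q01 H; have h : A * q ^+ n + B @[n --> \oo] --> 0 + B.
  by apply: cvgD; [exact: cvg_geo|exact: cvg_cst].
by rewrite -[B]add0r; exact: cvg_ge_cst H h.
Qed.

(** [P D] is to be read as: [D] bounds some defect, starting from a crude [D0]. Reinserting the
    bound in an integral equation improves it to [q * D + eta], so it sinks to the fixed point
    [eta / (1 - q)]. *)
Lemma contraction_principle (P : R -> Prop) (q eta D0 : R) : 0 <= q < 1 ->
  0 <= D0 -> 0 <= eta -> P D0 -> (forall D, 0 <= D -> P D -> P (q * D + eta)) ->
  forall n, exists2 D, P D & D <= D0 * q ^+ n + eta / (1 - q).
Proof.
move=> /andP[q0 q1] D00 eta0 PD Pi n.
have q1' : 0 < 1 - q by lra.
suff [D [D_0 PDn Dn]] : exists D, [/\ 0 <= D, P D & D <= D0 * q ^+ n + eta / (1 - q)].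
  by exists D.
elim: n => [|n [D [D_0 PDn Dn]]].
  by exists D0; split => //; rewrite expr0 mulr1 lerDl divr_ge0// ltW.
exists (q * D + eta); split; [by rewrite addr_ge0// mulr_ge0|exact: Pi|].
have h : q * D <= q * (D0 * q ^+ n + eta / (1 - q)) by rewrite ler_wpM2l.
have e : q * (eta / (1 - q)) + eta = eta / (1 - q) by field; rewrite gt_eqF.
by rewrite exprS; move: h; rewrite mulrDr; move: e; set z := eta / _ => e h; nra.
Qed.

Lemma geometric_cauchy (u : nat -> R) (A q : R) : 0 <= q < 1 ->
  (forall n, `|u n.+1 - u n| <= A * q ^+ n) ->
  forall n, `|u n - limn u| <= A / (1 - q) * q ^+ n.
Proof.
move=> q01 H; move: (q01) => /andP[q0 q1].
have q1' : 0 < 1 - q by lra.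
(* [r n] is the sum of all steps from [n] on; hence [u - r] increases, [u + r] decreases, and the
   two squeeze the limit. *)
pose r n := A / (1 - q) * q ^+ n.
have rE n : r n - r n.+1 = A * q ^+ n.
  by rewrite /r exprS; field; rewrite gt_eqF.
have r0 : r n @[n --> \oo] --> 0 by exact: cvg_geo.
have A0 : 0 <= A.
  have := H 0%N; rewrite expr0 mulr1; exact: le_trans.
have r_ge0 n : 0 <= r n by rewrite mulr_ge0 ?exprn_ge0// divr_ge0// ltW.
have nd : {homo (fun n => u n - r n) : n m / (n <= m)%N >-> n <= m}.
  apply/nondecreasing_seqP => n; have := H n; rewrite -rE ler_norml => /andP[? ?]; lra.
have ni : {homo (fun n => u n + r n) : n m / (n <= m)%N >-> m <= n}.
  apply/nonincreasing_seqP => n; have := H n; rewrite -rE ler_norml => /andP[? ?]; lra.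
have ub : has_ubound (range (fun n => u n - r n)).
  exists (u 0%N + r 0%N) => _ [n _ <-].
  by have := ni 0%N n (leq0n _); have := r_ge0 n; lra.
have cv := nondecreasing_is_cvgn nd ub.
set l := limn _ in cv; have cu : u n @[n --> \oo] --> l.
  rewrite -[l]addr0 (_ : u = (fun n => u n - r n) \+ r); first exact: cvgD cv r0.
  by apply/funext => n /=; ring.
rewrite (cvg_lim _ cu)// => n; rewrite -/(r n) ler_norml; apply/andP; split.
  suff : l <= u n + r n by lra.
  apply: (cvg_le_cst _ cv) => m /=.
  have [mn|nm] := leqP m n; first by have := nd m n mn; have := r_ge0 n; lra.
  by have := ni n m (ltnW nm); have := r_ge0 m; lra.
suff : u n - r n <= l by lra.
by apply: nondecreasing_cvgn_le => //; apply/cvg_ex; exists l.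
Qed.

End LimitTools.

Section MeasurabilityTools.
Context (R : realType).

Lemma meas_nat_select dX dY (X : measurableType dX) (Y : measurableType dY)
    (nu : X -> nat) (g : nat -> X -> Y) :
  (forall j, measurable [set x | (nu x <= j)%N]) ->
  (forall j, measurable_fun setT (g j)) -> measurable_fun setT (fun x => g (nu x) x).
Proof.
move=> mnu mg _ A mA; rewrite setTI.
have mnuE j : measurable [set x | nu x = j].
  case: j => [|j].
    by rewrite (_ : [set x | nu x = 0%N] = [set x | (nu x <= 0)%N])//; apply/seteqP; split => x /=; rewrite leqn0 => /eqP.
  rewrite (_ : [set x | nu x = j.+1] = [set x | (nu x <= j.+1)%N] `\` [set x | (nu x <= j)%N]).
    exact: measurableD.
  apply/seteqP; split => x /=; first by move=> ->; rewrite ltnn leqnn.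
  by move=> [h /negP]; rewrite -ltnNge => h2; apply/eqP; rewrite eqn_leq h.
have -> : (fun x => g (nu x) x) @^-1` A =
    \bigcup_j ([set x | nu x = j] `&` g j @^-1` A).
  apply/seteqP; split => [x /= ?|x [j _ [/= <-]]//]; first by exists (nu x).
apply: bigcup_measurable => j _; apply: measurableI => //.
by rewrite -[X in measurable X]setTI; exact: mg.
Qed.

(** The grid is uniform of mesh [1 / (n + 1)]. For [s >= 0] the point [(dyad n s + 1) / (n + 1)]
    lies strictly to the right of [s], the side on which the families in time will be continuous. *)
Definition dyad (n : nat) (s : R) : nat := Num.truncn (s * n.+1%:R).

Lemma meas_dyad n j : measurable [set s : R | (dyad n s <= j)%N].
Proof.
have -> : [set s : R | (dyad n s <= j)%N] = `]-oo, j.+1%:R / n.+1%:R[%classic.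
  by apply/seteqP; split => s /=; rewrite in_itv/= /dyad truncn_le_nat ltr_pdivlMr// ltr0n.
exact: measurable_itv.
Qed.

Lemma dyad_bounds n s : 0 <= s -> s <= (dyad n s).+1%:R / n.+1%:R <= s + n.+1%:R^-1.
Proof.
move=> s0; have n0 : (0 : R) < n.+1%:R by rewrite ltr0n.
have sn : 0 <= s * n.+1%:R by rewrite mulr_ge0// ltW.
have := truncn_itv sn; rewrite -/(dyad n s) => /andP[h1 h2]; apply/andP; split.
  by rewrite ler_pdivlMr// ltW.
rewrite ler_pdivrMr// mulrDl mulVf ?gt_eqF//.
by rewrite -natr1 lerD2r.
Qed.

(** Fubini asks for a measure on the parameter space. A Dirac mass makes every measurable [a]
    integrable, so the bound may be unbounded in the parameter. *)
Lemma meas_Rint_param dX dY (X : measurableType dX) (Y : measurableType dY)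
    (m : {sigma_finite_measure set Y -> \bar R}) (F : X -> Y -> R) (a : X -> R) (b : Y -> R) :
  measurable_fun setT (fun p => F p.1 p.2) ->
  measurable_fun setT a -> (forall x y, `|F x y| <= a x * b y) -> integ m b ->
  measurable_fun setT (fun x => \int[m]_y F x y).
Proof.
move=> mF ma Fab ib.
apply: (meas_Rint2 (m1 := dirac (point : X)) mF Fab _ ib).
apply/integrableP; split; first exact/measurable_EFinP.
rewrite integral_dirac//; last by apply: measurableT_comp => //; exact/measurable_EFinP.
by rewrite /= diracT mul1e ltry.
Qed.

End MeasurabilityTools.

(** * Families of operators and convolution *)

Section OperatorFamilies.
Context (R : realType) (d : nat).
Notation V := (V R d).
Notation Vb := (Vb R d).
Notation leb := (@lebesgue_measure R).
Notation TR := (measurableTypeR R).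
Notation fam := (R -> (V -> R) -> V -> R).

(* Time ranges over all of [R]: families are extended by [0] to [t <= 0], so that
   convolutions in time are integrals over the whole line. *)
Definition opfam (C lam : R) (U : fam) :=
  [/\ forall t x, sfun (C * expR (lam * t)) (fun f => U t f x),
      forall t f x, t <= 0 -> U t f x = 0,
      forall t f, Bb f -> continuous (U t f)
    & forall f, Bb f -> measurable_fun setT (fun p : TR * Vb => U p.1 f p.2)].

Definition expweight (lam : R) (psi : R -> R) := fun s => expR (- (lam * s)) * psi s.

(** The values are only Borel in space, and [psi] may be unbounded near 0. The last two clauses,
    boundedness and right continuity on [[s, s + 1]] for each [s > 0], are there for joint
    measurability: measurability in each variable separately would not give it for
    [U (t - s) (K s f) x]. *)
Definition inputfam (psi : R -> R) (K : fam) :=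
  [/\ forall s x, sfun (psi s) (fun f => K s f x),
      forall s f x, s <= 0 -> K s f x = 0,
      forall s f, Bb f -> borelf (K s f),
      forall s f, 0 < s -> Bb f ->
        exists c, forall r x, s <= r <= s + 1 -> `|K r f x| <= c
    & forall s f x (sn : nat -> R), 0 < s -> Bb f -> (forall n, s <= sn n <= s + 1) ->
        sn n @[n --> \oo] --> s -> K (sn n) f x @[n --> \oo] --> K s f x].

Definition conv (U K : fam) : fam :=
  fun t f x => \int[leb]_s U (t - s) (K s f) x.

Lemma sfun_unif (e Cn : nat -> R) C (Ln : nat -> (V -> R) -> R) (L : (V -> R) -> R) :
  (forall n, sfun (Cn n) (Ln n)) ->
  (forall f c, Bb f -> (forall x, `|f x| <= c) -> `|L f| <= C * c) ->
  (forall n f c, Bb f -> (forall x, `|f x| <= c) -> `|Ln n f - L f| <= e n * c) ->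
  e n @[n --> \oo] --> 0 -> sfun C L.
Proof.
move=> sn bL eL e0.
have cL f : Bb f -> Ln n f @[n --> \oo] --> L f.
  move=> Bf; have [_ [c fc]] := Bf.
  apply: (cvg_seq0_le (v := fun n => e n * c)) => [n|]; first exact: eL.
  by rewrite -[X in _ --> X](mul0r c); apply: cvgMl.
split => //.
- move=> k f g Bf Bg; apply: (cvgn_unique (cL _ (Bb_lin k Bf Bg))).
  under eq_fun do rewrite (sfun_lin (sn _))//.
  by apply: cvgD; [apply: cvgMr; exact: cL|exact: cL].
- move=> fn f c Bn bn cf; have Bf := Bb_lim Bn bn cf.
  have fc x : `|f x| <= c.
    by apply: (@cvg_le_cst _ (fun n => `|fn n x|)) => //; apply: cvg_norm; exact: cf.
  apply: (cvg_uniform_approx (un := fun n m => Ln n (fn m)) (ln := fun n => Ln n f)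
           (e := fun n => e n * c)).
  + by move=> n m; apply: eL.
  + by move=> n; apply: eL.
  + by rewrite -[X in _ --> X](mul0r c); apply: cvgMl.
  + by move=> n; exact: (sfun_cvg (sn n) Bn bn cf).
Qed.

Section OpfamLemmas.
Variables (C lam : R) (U : fam) (oU : opfam C lam U).

Lemma opfam_sfun t x : sfun (C * expR (lam * t)) (fun f => U t f x).
Proof. by case: oU. Qed.

Lemma opfam_bnd t f x c : Bb f -> (forall x, `|f x| <= c) ->
  `|U t f x| <= C * expR (lam * t) * c.
Proof. by move=> Bf fc; exact: (sfun_bnd (opfam_sfun t x)). Qed.

Lemma opfam_le0 t f x : t <= 0 -> U t f x = 0.
Proof. by case: oU => _ h _ _; exact: h. Qed.

Lemma opfam_Cb t f : Bb f -> Cb (U t f).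
Proof.
move=> Bf; split; first by case: oU => _ _ h _; exact: h.
have [_ [c fc]] := Bf; exists (C * expR (lam * t) * c) => x; exact: opfam_bnd.
Qed.

Lemma opfam_Bb t f : Bb f -> Bb (U t f).
Proof. by move=> Bf; apply: Cb_Bb; exact: opfam_Cb. Qed.

Lemma opfam_meas f : Bb f -> measurable_fun setT (fun p : TR * Vb => U p.1 f p.2).
Proof. by case: oU => _ _ _; exact. Qed.

Lemma opfam_meas_t f x : Bb f -> measurable_fun setT (fun t : TR => U t f x).
Proof. by move=> Bf; exact: (measurable_fun_pair1 (x : Vb) (opfam_meas Bf)). Qed.

Lemma opfam_C0 : 0 <= C.
Proof.
by have := sfun_C0 (opfam_sfun 0 0); rewrite pmulr_lge0// expR_gt0.
Qed.

Lemma opfam_le D : C <= D -> opfam D lam U.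
Proof.
move=> CD; have [h1 h2 h3 h4] := oU; split => // t x.
by apply: sfun_le (h1 t x); rewrite ler_wpM2r// expR_ge0.
Qed.

End OpfamLemmas.

(** * Convolution in time of an operator family with an input family *)

Section Convolution.
Variables (C lam : R) (U : fam) (oU : opfam C lam U).
Variables (psi : R -> R) (K : fam) (iK : inputfam psi K).
Hypothesis ipsi : integ leb (expweight lam psi).

Lemma input_sfun s x : sfun (psi s) (fun f => K s f x).
Proof. by case: iK. Qed.

Lemma input_le0 s f x : s <= 0 -> K s f x = 0.
Proof. by case: iK => _ h _ _ _; exact: h. Qed.

Lemma input_bnd s f x c : Bb f -> (forall x, `|f x| <= c) -> `|K s f x| <= psi s * c.
Proof. by move=> Bf fc; exact: (sfun_bnd (input_sfun s x)). Qed.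

Lemma input_Bb s f : Bb f -> Bb (K s f).
Proof.
move=> Bf; split; first by case: iK => _ _ h _ _; exact: h.
have [_ [c fc]] := Bf; exists (psi s * c) => x; exact: input_bnd.
Qed.

Let Kn f n (s : R) : V -> R := K ((dyad n s).+1%:R / n.+1%:R) f.

Let Kn_cvg f s x : 0 < s -> Bb f -> Kn f n s x @[n --> \oo] --> K s f x.
Proof.
move=> s0 Bf; case: iK => _ _ _ _ h; apply: h => //.
  move=> n; have /andP[-> h2]/= := dyad_bounds n (ltW s0).
  by rewrite (le_trans h2)// lerD2l invf_le1 ?ltr0n// ler1n.
apply: (@cvg_seq0_le _ _ (fun n => n.+1%:R^-1)); last exact: cvg_harmonic.
move=> n; have /andP[h1 h2] := dyad_bounds n (ltW s0).
by rewrite ger0_norm ?subr_ge0// lerBlDl.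
Qed.

(** With [K] frozen at a grid time the composite is measurable, because [U] is so at a fixed bounded
    Borel function. The grid times converge to [s] from the right, and sigma-continuity of
    [U (t - s)] carries the convergence of [K] through [U]. *)
Lemma comp_meas f : Bb f ->
  measurable_fun setT (fun p : (TR * Vb) * TR => U (p.1.1 - p.2) (K p.2 f) p.1.2).
Proof.
move=> Bf.
(* For [s <= 0] the grid time is positive and [K] need not vanish there; the indicator suppresses
   these times. *)
have -> : (fun p : (TR * Vb) * TR => U (p.1.1 - p.2) (K p.2 f) p.1.2) =
  (fun p => (\1_(`]0, +oo[ : set R) p.2 : R) * U (p.1.1 - p.2) (K p.2 f) p.1.2).
  apply/funext => p; rewrite indicE; case: (boolP (p.2 \in _)) => [_|]; first by rewrite mul1r.
  rewrite mul0r notin_setE /= in_itv/= andbT => /negP; rewrite -leNgt => p0.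
  have -> : K p.2 f = (fun=> 0) by apply/funext => x; exact: input_le0.
  exact: (sfun0 (opfam_sfun oU _ _)).
apply: (@measurable_fun_cvg _ _ _ _
   (fun n (p : (TR * Vb) * TR) => (\1_(`]0, +oo[ : set R) p.2 : R) * U (p.1.1 - p.2) (Kn f n p.2) p.1.2)).
  move=> n; apply: measurable_funM.
    by apply: (measurableT_comp (measurable_indic _)) => //; exact: measurable_itv.
  apply: (meas_nat_select (nu := fun p => dyad n p.2)
    (g := fun j (p : (TR * Vb) * TR) => U (p.1.1 - p.2) (K (j.+1%:R / n.+1%:R) f) p.1.2)).
    move=> j; rewrite -[X in measurable X]setTI.
    have ms : measurable_fun setT (@snd (TR * Vb) TR) by exact: measurable_snd.
    exact: (ms measurableT _ (@meas_dyad R n j)).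
  move=> j; have mU := opfam_meas oU (input_Bb (j.+1%:R / n.+1%:R) Bf).
  have m1 : measurable_fun setT (fun p : (TR * Vb) * TR => p.1.1 : TR).
    exact: measurableT_comp measurable_fst measurable_fst.
  have m2 : measurable_fun setT (fun p : (TR * Vb) * TR => p.1.1 - p.2 : TR).
    by apply: (@measurable_funB _ _ R); [exact: m1|exact: (@measurable_snd _ _ (TR * Vb)%type TR)].
  have mp : measurable_fun setT (fun p : (TR * Vb) * TR => ((p.1.1 - p.2, p.1.2) : TR * Vb)).
    apply: measurable_fun_pair => //; exact: measurableT_comp measurable_snd measurable_fst.
  exact: (measurableT_comp mU mp).
move=> p _; rewrite indicE; case: (boolP (p.2 \in _)); last first.
  by move=> _; under eq_fun do rewrite mul0r; rewrite mul0r; exact: cvg_cst.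
rewrite inE /= in_itv/= andbT => p0; apply: cvgMr.
have [c Kc] : exists c, forall r x, p.2 <= r <= p.2 + 1 -> `|K r f x| <= c.
  by case: iK => _ _ _ h _; exact: h.
apply: (sfun_cvg (opfam_sfun oU _ _) (c := c)).
- by move=> n; exact: input_Bb.
- move=> n x; apply: Kc; have /andP[-> h2]/= := dyad_bounds n (ltW p0).
  by rewrite (le_trans h2)// lerD2l invf_le1 ?ltr0n// ler1n.
- by move=> x; exact: Kn_cvg.
Qed.

Lemma input_meas f : Bb f -> measurable_fun setT (fun p : TR * Vb => K p.1 f p.2).
Proof.
move=> Bf.
have -> : (fun p : TR * Vb => K p.1 f p.2) =
  (fun p => (\1_(`]0, +oo[ : set R) p.1 : R) * K p.1 f p.2).
  apply/funext => p; rewrite indicE; case: (boolP (p.1 \in _)) => [_|]; first by rewrite mul1r.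
  rewrite mul0r notin_setE /= in_itv/= andbT => /negP; rewrite -leNgt => p0.
  exact: input_le0.
apply: (@measurable_fun_cvg _ _ _ _
   (fun n (p : TR * Vb) => (\1_(`]0, +oo[ : set R) p.1 : R) * Kn f n p.1 p.2)).
  move=> n; apply: measurable_funM.
    by apply: (measurableT_comp (measurable_indic _)) => //; exact: measurable_itv.
  apply: (meas_nat_select (nu := fun p : TR * Vb => dyad n p.1)
    (g := fun j (p : TR * Vb) => K (j.+1%:R / n.+1%:R) f p.2)).
    move=> j; rewrite -[X in measurable X]setTI.
    have ms : measurable_fun setT (@fst TR Vb) by exact: measurable_fst.
    exact: (ms measurableT _ (@meas_dyad R n j)).
  move=> j; have [mK _] := input_Bb (j.+1%:R / n.+1%:R) Bf.
  exact: measurableT_comp mK measurable_snd.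
move=> p _; rewrite indicE; case: (boolP (p.1 \in _)); last first.
  by move=> _; under eq_fun do rewrite mul0r; rewrite mul0r; exact: cvg_cst.
rewrite inE /= in_itv/= andbT => p0; apply: cvgMr; exact: Kn_cvg.
Qed.

Lemma comp_meas_s f (t : R) x : Bb f -> measurable_fun setT (fun s : TR => U (t - s) (K s f) x).
Proof. by move=> Bf; exact: (measurable_fun_pair2 ((t, x) : TR * Vb) (comp_meas Bf)). Qed.

Lemma comp_bnd f c t x s : Bb f -> (forall x, `|f x| <= c) ->
  `|U (t - s) (K s f) x| <= C * expR (lam * t) * c * expweight lam psi s.
Proof.
move=> Bf fc; apply: (le_trans (opfam_bnd oU _ _ (input_Bb s Bf) (fun x => input_bnd _ x Bf fc))).
by rewrite mulrBr expRD /expweight le_eqVlt; apply/orP; left; apply/eqP; ring.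
Qed.

Lemma comp_integ f t x : Bb f -> integ leb (fun s => U (t - s) (K s f) x).
Proof.
move=> Bf; have [_ [c fc]] := Bf.
exact: (integ_dom (comp_meas_s t x Bf) (fun s => comp_bnd t x s Bf fc) (integZ _ ipsi)).
Qed.

Let q := \int[leb]_s expweight lam psi s.

Lemma conv_bnd f c t x : Bb f -> (forall x, `|f x| <= c) ->
  `|conv U K t f x| <= C * q * expR (lam * t) * c.
Proof.
move=> Bf fc.
apply: (le_trans (Rint_le_norm (comp_meas_s t x Bf) (fun s => comp_bnd t x s Bf fc) (integZ _ ipsi))).
by rewrite RintegralZl// -/q le_eqVlt; apply/orP; left; apply/eqP; ring.
Qed.

(** The outer factor [U (t - s)] already maps bounded Borel functions to continuous ones, so
    dominated convergence preserves the strong Feller property although [K s f] is merely Borel. *)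
Lemma opfam_conv : opfam (C * q) lam (conv U K).
Proof.
split.
- move=> t x; split.
  + move=> k f g Bf Bg; rewrite -Rint_linear; [|exact: comp_integ..].
    apply: eq_Rintegral => s _; rewrite -(sfun_lin (opfam_sfun oU _ _)); [|exact: input_Bb..].
    by congr (U _ _ x); apply/funext => y; rewrite (sfun_lin (input_sfun _ _)).
  + by move=> f c Bf fc; exact: conv_bnd.
  + move=> fn f c Bn bn cf.
    have cs (s : TR) : U (t - s) (K s (fn n)) x @[n --> \oo] --> U (t - s) (K s f) x.
      apply: (sfun_cvg (opfam_sfun oU _ _) (c := psi s * c)).
      - by move=> n; exact: input_Bb.
      - by move=> n y; exact: input_bnd.
      - by move=> y; exact: (sfun_cvg (input_sfun _ _) Bn bn cf).
    exact: (Rint_dct (fun n => comp_meas_s t x (Bn n)) cs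
      (fun n s => comp_bnd t x s (Bn n) (bn n)) (integZ _ ipsi)).
- move=> t f x t0; rewrite /conv; under eq_Rintegral => s _.
    rewrite (_ : U _ _ _ = 0); first by over.
    have [s0|s0] := leP s 0.
      have -> : K s f = (fun=> 0) by apply/funext => y; exact: input_le0.
      exact: (sfun0 (opfam_sfun oU _ _)).
    by apply: (opfam_le0 oU); lra.
  by rewrite Rintegral_cst// mul0r.
- move=> t f Bf x; apply: cvg_seqP => u cu; have [_ [c fc]] := Bf.
  have cs (s : TR) : U (t - s) (K s f) (u n) @[n --> \oo] --> U (t - s) (K s f) x.
    have [cU _] := opfam_Cb oU (t - s) (input_Bb s Bf).
    exact: (cvg_comp _ _ cu (cU x)).
  exact: (Rint_dct (fun n => comp_meas_s t (u n) Bf) cs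
    (fun n s => comp_bnd t (u n) s Bf fc) (integZ _ ipsi)).
- move=> f Bf; have [_ [c fc]] := Bf.
  apply: (meas_Rint_param (a := fun p : TR * Vb => C * expR (lam * p.1) * c) (comp_meas Bf) _ _ ipsi).
    do 2 apply: measurable_funM => //.
    apply: measurableT_comp => //; apply: measurable_funM => //.
  by move=> p s; exact: comp_bnd.
Qed.

End Convolution.

Lemma opfamD C1 C2 lam U1 U2 : opfam C1 lam U1 -> opfam C2 lam U2 ->
  opfam (C1 + C2) lam (fun t f x => U1 t f x + U2 t f x).
Proof.
move=> o1 o2; split.
- move=> t x; have := sfun_comb 1 1 (opfam_sfun o1 t x) (opfam_sfun o2 t x).
  rewrite normr1 !mul1r -mulrDl; apply: sfun_eq => f Bf; by rewrite !mul1r.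
- by move=> t f x t0; rewrite (opfam_le0 o1)// (opfam_le0 o2)// addr0.
- move=> t f Bf x; have [h1 _] := opfam_Cb o1 t Bf; have [h2 _] := opfam_Cb o2 t Bf.
  exact: (cvgD (h1 x) (h2 x)).
- by move=> f Bf; apply: measurable_funD; [exact: opfam_meas o1 _ Bf|exact: opfam_meas o2 _ Bf].
Qed.

Lemma opfam_lim C lam (Un : nat -> fam) (U : fam) (e : nat -> R) :
  (forall n, opfam C lam (Un n)) -> e n @[n --> \oo] --> 0 ->
  (forall n t f c x, Bb f -> (forall x, `|f x| <= c) ->
     `|Un n t f x - U t f x| <= e n * expR (lam * t) * c) ->
  (forall t f x, t <= 0 -> U t f x = 0) ->
  opfam C lam U.
Proof.
move=> on e0 eU U0.
have e0' (k : R) : e n * k @[n --> \oo] --> 0 by rewrite -[X in _ --> X](mul0r k); apply: cvgMl.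
have cU t f x : Bb f -> Un n t f x @[n --> \oo] --> U t f x.
  move=> Bf; have [_ [c fc]] := Bf.
  apply: (cvg_seq0_le _ (e0' (expR (lam * t) * c))) => n.
  by rewrite mulrA; exact: eU.
split => //.
- move=> t x; apply: (sfun_unif (e := fun n => e n * expR (lam * t)) (fun n => opfam_sfun (on n) t x)).
  + move=> f c Bf fc; apply: (@cvg_le_cst _ (fun n => `|Un n t f x|)).
      by move=> n; apply: (opfam_bnd (on n) t x Bf fc).
    by apply: cvg_norm; exact: cU.
  + by move=> n f c Bf fc; exact: eU.
  + exact: e0'.
- move=> t f Bf x; have [_ [c fc]] := Bf.
  apply: (@cvg_uniform_approx _ _ (nbhs x) (nbhs_filter x) _ (fun n => Un n t f) _
    (fun n => Un n t f x) (fun n => e n * (expR (lam * t) * c))).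
  + by move=> n y; rewrite mulrA; exact: eU.
  + by move=> n; rewrite mulrA; exact: eU.
  + exact: e0'.
  + by move=> n; have [h _] := opfam_Cb (on n) t Bf; exact: (h x).
- move=> f Bf; apply: (@measurable_fun_cvg _ _ _ _ (fun n (p : TR * Vb) => Un n p.1 f p.2)).
    by move=> n; exact: opfam_meas (on n) _ Bf.
  by move=> p _; exact: cU.
Qed.

End OperatorFamilies.

(** * Perturbing operators *)

Section PerturbationOperators.
Context (R : realType) (d : nat).
Notation V := (V R d).
Notation Vb := (Vb R d).
Notation leb := (@lebesgue_measure R).
Notation TR := (measurableTypeR R).
Notation fam := (R -> (V -> R) -> V -> R).

(* [H c f] plays the role of [||f||_{C_b^rho} <= c]. *)
Definition regspace (H : R -> (V -> R) -> Prop) :=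
  [/\ forall c f, H c f -> continuous f /\ (forall x, `|f x| <= c),
      H 0 (fun=> 0),
      forall c c' f, c <= c' -> H c f -> H c' f,
      forall k c c' f g, H c f -> H c' g -> H (`|k| * c + c') (fun x => k * f x + g x)
    & forall (h : TR -> V -> R) (a : TR -> R),
        measurable_fun setT (fun p : TR * Vb => h p.1 p.2) ->
        (forall s, H (a s) (h s)) -> integ leb a ->
        H (\int[leb]_s a s) (fun x => \int[leb]_s h s x)].

(** [B] itself acts only on the smooth class. Its linearity, its continuity along bounded sequences,
    the Borel measurability of its values and its interchange with integrals are all inherited from
    the [Bn], which act on all bounded Borel functions. *)
Definition pertop (H : R -> (V -> R) -> Prop) (CB : R) (B : (V -> R) -> V -> R) :=
  (forall c f x, H c f -> `|B f x| <= CB * c) /\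
  exists (Bn : nat -> (V -> R) -> V -> R) (e Cn : nat -> R),
    [/\ forall n x, sfun (Cn n) (fun f => Bn n f x),
        forall n f, Cb f -> borelf (Bn n f),
        forall n c f x, H c f -> `|Bn n f x - B f x| <= e n * c
      & e n @[n --> \oo] --> 0].

Section Lemmas.
Variables (H : R -> (V -> R) -> Prop) (rH : regspace H).
Variables (CB : R) (B : (V -> R) -> V -> R) (pB : pertop H CB B).

Lemma reg_bnd c f : H c f -> forall x, `|f x| <= c.
Proof. by case: rH => h _ _ _ _ /h[]. Qed.

Lemma reg_Cb c f : H c f -> Cb f.
Proof. by move=> Hf; split; [case: rH => h _ _ _ _; case: (h _ _ Hf)|exists c; exact: reg_bnd]. Qed.

Lemma reg_Bb c f : H c f -> Bb f.
Proof. by move=> Hf; apply: Cb_Bb; exact: reg_Cb Hf. Qed.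

Lemma reg0 : H 0 (fun=> 0).
Proof. by case: rH. Qed.

Lemma reg_le c c' f : c <= c' -> H c f -> H c' f.
Proof. by case: rH => _ _ h _ _; exact: h. Qed.

Lemma reg_lin k c c' f g : H c f -> H c' g -> H (`|k| * c + c') (fun x => k * f x + g x).
Proof. by case: rH => _ _ _ h _; exact: h. Qed.

Lemma regZ k c f : H c f -> H (`|k| * c) (fun x => k * f x).
Proof.
move=> Hf; have := reg_lin k Hf reg0; rewrite addr0.
by under eq_fun do rewrite addr0.
Qed.

Lemma pert_bnd c f x : H c f -> `|B f x| <= CB * c.
Proof. by case: pB => h _; exact: h. Qed.

Lemma pert0 x : B (fun=> 0) x = 0.
Proof. by apply/eqP; rewrite -normr_le0 -[X in _ <= X](mulr0 CB); apply: pert_bnd; exact: reg0. Qed.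

Lemma pert_lin k c c' f g x : H c f -> H c' g ->
  B (fun x => k * f x + g x) x = k * B f x + B g x.
Proof.
move=> Hf Hg; have [_ [Bn [e [Cn [sB _ eB e0]]]]] := pB.
have cB c1 f1 : H c1 f1 -> Bn n f1 x @[n --> \oo] --> B f1 x.
  move=> Hf1; apply: (cvg_seq0_le (v := fun n => e n * c1)) => [n|]; first exact: eB.
  by rewrite -[X in _ --> X](mul0r c1); apply: cvgMl.
apply: (cvgn_unique (cB _ _ (reg_lin k Hf Hg))).
have Bf := reg_Bb Hf; have Bg := reg_Bb Hg.
under eq_fun do rewrite (sfun_lin (sB _ _))//.
by apply: cvgD; [apply: cvgMr; exact: cB Hf|exact: cB Hg].
Qed.

Lemma pertZ k c f x : H c f -> B (fun x => k * f x) x = k * B f x.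
Proof.
move=> Hf; have := pert_lin k x Hf reg0; rewrite pert0 addr0 => <-.
by congr (B _ x); apply/funext => y; rewrite addr0.
Qed.

Lemma pert_cvg c (fn : nat -> V -> R) f x : (forall n, H c (fn n)) -> H c f ->
  (forall x, fn n x @[n --> \oo] --> f x) -> B (fn n) x @[n --> \oo] --> B f x.
Proof.
move=> Hn Hf cf; have [_ [Bn [e [Cn [sB _ eB e0]]]]] := pB.
apply: (cvg_uniform_approx (un := fun n m => Bn n (fn m) x) (ln := fun n => Bn n f x)
           (e := fun n => e n * c)).
- by move=> n m; exact: eB.
- by move=> n; exact: eB.
- by rewrite -[X in _ --> X](mul0r c); apply: cvgMl.
- move=> n; apply: (sfun_cvg (sB n x) (c := c)) => //.
  + by move=> m; exact: reg_Bb (Hn m).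
  + by move=> m; exact: reg_bnd.
Qed.

Lemma pert_Bb c f : H c f -> Bb (B f).
Proof.
move=> Hf; have [_ [Bn [e [Cn [sB mB eB e0]]]]] := pB.
split; last by exists (CB * c) => x; exact: pert_bnd.
apply: (@measurable_fun_cvg _ Vb _ _ (fun n => Bn n f)) => [n|x _].
  by apply: mB; exact: reg_Cb Hf.
apply: (cvg_seq0_le (v := fun n => e n * c)) => [n|]; first exact: eB.
by rewrite -[X in _ --> X](mul0r c); apply: cvgMl.
Qed.

Section Integral.
Variables (h : TR -> V -> R) (a : TR -> R).
Hypotheses (mh : measurable_fun setT (fun p : TR * Vb => h p.1 p.2)).
Hypotheses (Hh : forall s, H (a s) (h s)) (ia : integ leb a).

Lemma reg_int : H (\int[leb]_s a s) (fun x => \int[leb]_s h s x).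
Proof. by case: rH => _ _ _ _ h'; exact: h'. Qed.

(** The interchange is known for each sigma-continuous [Bn], and replacing [B] by [Bn] costs at most
    [e n] times the integral of [a] on either side. *)
Lemma pert_int x : measurable_fun setT (fun s : TR => B (h s) x) /\
  B (fun x => \int[leb]_s h s x) x = \int[leb]_s B (h s) x.
Proof.
have [_ [Bn [e [Cn [sB mB eB e0]]]]] := pB.
have ha s y : `|h s y| <= a s by exact: (reg_bnd (Hh s)).
have mBn n := (sfun_Rint mh ha ia (sB n x)).1.
have cB s : Bn n (h s) x @[n --> \oo] --> B (h s) x.
  apply: (cvg_seq0_le (v := fun n => e n * a s)) => [n|]; first exact: eB.
  by rewrite -[X in _ --> X](mul0r (a s)); apply: cvgMl.
have mB' : measurable_fun setT (fun s : TR => B (h s) x).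
  by apply: (measurable_fun_cvg mBn) => s _; exact: cB.
split => //.
apply: (@cvgn_unique _ (fun n => Bn n (fun x => \int[leb]_s h s x) x)).
  apply: (cvg_seq0_le (v := fun n => e n * \int[leb]_s a s)) => [n|].
    by apply: eB; exact: reg_int.
  by rewrite -[X in _ --> X](mul0r (\int[leb]_s a s)); apply: cvgMl.
under eq_fun do rewrite (sfun_Rint mh ha ia (sB _ x)).2.
have iB : integ leb (fun s => B (h s) x).
  by apply: (integ_dom mB' _ (integZ CB ia)) => s; exact: pert_bnd.
have iBn n : integ leb (fun s => Bn n (h s) x).
  apply: (integ_dom (mBn n) _ (integZ (Cn n) ia)) => s.
  exact: (sfun_bnd (sB n x) (reg_Bb (Hh s)) (ha s)).
apply: (cvg_seq0_le (v := fun n => e n * \int[leb]_s a s)) => [n|]; last first.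
  by rewrite -[X in _ --> X](mul0r (\int[leb]_s a s)); apply: cvgMl.
rewrite -RintB// -RintZ//; apply: Rint_le_norm.
- exact: measurable_funB.
- by move=> s; exact: eB.
- exact: integZ.
Qed.

End Integral.
End Lemmas.

(** * The family [B T(s)] as an input of the Volterra equation *)

Section InputFamily.
Variables (H : R -> (V -> R) -> Prop) (rH : regspace H).
Variables (CB : R) (B : (V -> R) -> V -> R) (pB : pertop H CB B).
Variables (M lam : R) (T : fam) (oT : opfam M lam T) (psi : R -> R).
Hypothesis T_sg : forall (t s : R) (f : V -> R), 0 < t -> 0 < s -> Bb f -> T (t + s) f = T t (T s f).
Hypothesis T_0 : forall (f : V -> R) (x : V) (r : nat -> R), Cb f -> (forall n, 0 < r n) ->
  r n @[n --> \oo] --> 0 -> T (r n) f x @[n --> \oo] --> f x.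
Hypothesis T_H : forall (s : R) (f : V -> R) (c : R),
  Bb f -> (forall x, `|f x| <= c) -> H (psi s * c) (T s f).

Definition Kfam : fam := fun s f x => if 0 < s then B (T s f) x else 0.

Lemma KfamE s f x : Kfam s f x = B (T s f) x.
Proof.
rewrite /Kfam; case: ltP => // s0.
rewrite (_ : T s f = fun=> 0) ?(pert0 rH pB)//.
by apply/funext => y; exact: (opfam_le0 oT).
Qed.

(** [T (sn n) f] is [T (sn n - s)] applied to [T s f], which is continuous by the strong Feller
    property, so continuity at time 0 applies to it. *)
Lemma T_right_cvg s f x (sn : nat -> R) : 0 < s -> Bb f -> (forall n, s <= sn n) ->
  sn n @[n --> \oo] --> s -> T (sn n) f x @[n --> \oo] --> T s f x.
Proof.
move=> s0 Bf ssn cs; have CT := opfam_Cb oT s Bf.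
apply/cvgrPdist_le => e e0.
suff [n0 Hn] : exists n0, forall n, (n0 <= n)%N -> `|T s f x - T (sn n) f x| <= e.
  by exists n0.
apply: contrapT => N.
(* [T_0] concerns strictly positive times, while [sn n = s] is allowed. A subsequence that violates
   the limit never takes the value [s]. *)
have /choice[phi phiP] : forall n0, exists n, (n0 <= n)%N /\ ~ (`|T s f x - T (sn n) f x| <= e).
  move=> n0; apply: contrapT => Q; apply: N; exists n0 => n nn.
  by apply: contrapT => Q'; apply: Q; exists n.
have gt n : s < sn (phi n).
  rewrite lt_neqAle ssn andbT; apply/eqP => E; have [_ +] := phiP n; apply.
  by rewrite -E subrr normr0 ltW.
have cphi : sn (phi n) - s @[n --> \oo] --> 0.
  apply/cvgrPdist_le => eps eps0.
  have /cvgrPdist_le/(_ _ eps0)[n0 _ Hn0] := cs; exists n0 => // n /= nn.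
  rewrite sub0r opprB; apply: Hn0 => /=.
  by have [h _] := phiP n; exact: leq_trans nn h.
have pos n : 0 < sn (phi n) - s by rewrite subr_gt0.
have := @T_0 _ x _ CT pos cphi; move=> /cvgrPdist_le/(_ _ e0)[n0 _ /(_ n0 (leqnn n0))] /=.
by rewrite -T_sg// subrK; have [_] := phiP n0.
Qed.

Lemma Kfam_input : inputfam (fun s => CB * psi s) Kfam.
Proof.
(* [psi] need not be locally bounded. Writing [T r] as [T (s / 2)] after [T (r - s / 2)] puts all
   [r] in [[s, s + 1]] into one ball of [H], with the single factor [psi (s / 2)]. *)
have HT (s r : R) f c : 0 < s -> Bb f -> (forall x, `|f x| <= c) -> s <= r <= s + 1 ->
    H (psi (s / 2) * (M * expR (`|lam| * (s + 1)) * c)) (T r f).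
  move=> s_gt0 Bf fc /andP[sr rs1].
  have -> : T r f = T (s / 2) (T (r - s / 2) f).
    rewrite -T_sg//; [by congr (T _ f); ring|lra|lra].
  apply: T_H; first exact: (opfam_Bb oT).
  move=> x; apply: (le_trans (opfam_bnd oT (r - s / 2) x Bf fc)).
  rewrite ler_wpM2r//; first by rewrite (le_trans _ (fc 0)).
  rewrite ler_wpM2l ?(opfam_C0 oT)// ler_expR.
  apply: (le_trans (ler_norm _)); rewrite normrM ler_wpM2l// ger0_norm; lra.
have HK (s : R) f c : Bb f -> (forall x, `|f x| <= c) -> forall x, `|B (T s f) x| <= CB * psi s * c.
  by move=> Bf fc x; rewrite -mulrA; apply: (pert_bnd pB); exact: T_H.
split.
- move=> s x; apply: (sfun_eq (L1 := fun f => B (T s f) x)) => [f Bf|]; first by rewrite KfamE.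
  split.
  + move=> k f g Bf Bg; have [_ [c fc]] := Bf; have [_ [c' gc]] := Bg.
    rewrite -(pert_lin rH pB k x (T_H s Bf fc) (T_H s Bg gc)).
    by congr (B _ x); apply/funext => y; rewrite (sfun_lin (opfam_sfun oT _ _)).
  + by move=> f c Bf fc; exact: HK.
  + move=> fn f c Bn bn cf; have Bf := Bb_lim Bn bn cf.
    have fc y : `|f y| <= c.
      by apply: (@cvg_le_cst _ (fun n => `|fn n y|)) => //; apply: cvg_norm; exact: cf.
    have cT y : T s (fn n) y @[n --> \oo] --> T s f y.
      exact: (sfun_cvg (opfam_sfun oT _ _) Bn bn cf).
    exact: (pert_cvg rH pB (fun n => T_H s (Bn n) (bn n)) (T_H s Bf fc) cT).
- by move=> s f x s0; rewrite /Kfam ltNge s0.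
- move=> s f Bf; have [_ [c fc]] := Bf.
  rewrite (_ : Kfam s f = B (T s f)); last by apply/funext => y; exact: KfamE.
  by have [] := pert_Bb rH pB (T_H s Bf fc).
- move=> s f s0 Bf; have [_ [c fc]] := Bf.
  exists (CB * (psi (s / 2) * (M * expR (`|lam| * (s + 1)) * c))) => r x rs.
  by rewrite KfamE; apply: (pert_bnd pB); exact: HT.
- move=> s f x sn s0 Bf hsn cs; have [_ [c fc]] := Bf.
  under eq_fun do rewrite KfamE; rewrite KfamE.
  have ss : s <= s <= s + 1 by lra.
  have cT y : T (sn n) f y @[n --> \oo] --> T s f y.
    by apply: T_right_cvg => // n; have /andP[] := hsn n.
  exact: (pert_cvg rH pB (fun n => HT s (sn n) f c s0 Bf fc (hsn n)) (HT s s f c s0 Bf fc ss) cT).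
Qed.

Lemma Kfam_T s r f : 0 < s -> 0 < r -> Bb f -> Kfam (r + s) f = Kfam r (T s f).
Proof. by move=> s0 r0 Bf; apply/funext => x; rewrite !KfamE T_sg. Qed.

End InputFamily.
End PerturbationOperators.

(** * The Volterra equation *)

Section Volterra.
Context (R : realType) (d : nat).
Notation V := (V R d).
Notation Vb := (Vb R d).
Notation leb := (@lebesgue_measure R).
Notation TR := (measurableTypeR R).
Notation fam := (R -> (V -> R) -> V -> R).

Fixpoint viter (T K : fam) (n : nat) : fam :=
  if n is n'.+1 then fun t f x => T t f x + conv (viter T K n') K t f x else T.

(* The solution of [S = T + conv S K], i.e. of the Duhamel formula
   [S(t) = T(t) + int_0^t S(t - s) B T(s) ds] when [K s = B T(s)]. *)
Definition vsol (T K : fam) : fam := fun t f x => limn (fun n => viter T K n t f x).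

(** As a factor of the integrand this turns integrals over [(0, t)] into integrals over the line
    that are visibly measurable in [t] as well. *)
Definition heav (r : R) : R := (0 < r)%R%:R.

Lemma heav1 r : 0 < r -> heav r = 1. Proof. by rewrite /heav => ->. Qed.

Lemma heav0 r : r <= 0 -> heav r = 0. Proof. by rewrite /heav ltNge => ->. Qed.

Lemma heav_ge0 r : 0 <= heav r. Proof. exact: ler0n. Qed.

Lemma heav_le1 r : heav r <= 1. Proof. by rewrite /heav; case: ltP. Qed.

Lemma heav_norm r : `|heav r| <= 1. Proof. by rewrite ger0_norm ?heav_ge0 ?heav_le1. Qed.

Lemma meas_heav : measurable_fun setT (heav : TR -> R).
Proof.
rewrite (_ : heav = \1_(`]0, +oo[ : set R)).
  by apply: measurable_indic; exact: measurable_itv.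
by apply/funext => r; rewrite indicE /heav mem_setE in_itv/= andbT.
Qed.

Lemma meas_heav_comp dX (X : measurableType dX) (f : X -> R) :
  measurable_fun setT f -> measurable_fun setT (fun x => heav (f x)).
Proof. by move=> mf; exact: (measurableT_comp meas_heav (mf : measurable_fun setT (f : X -> TR))). Qed.

(** Cutting an integral at time [a] by means of [heav] loses the point [a] itself, since
    [heav 0 = 0]. *)
Lemma Rint_point (a : R) (F G : TR -> R) : measurable_fun setT F -> measurable_fun setT G ->
  (forall s, s != a -> F s = G s) -> \int[leb]_s F s = \int[leb]_s G s.
Proof.
move=> mF mG FG; rewrite /Rintegral; congr fine; apply: ae_eq_integral => //.
- exact/measurable_EFinP.
- exact/measurable_EFinP.
exists [set a]; split; [exact: measurable_set1|exact: lebesgue_measure_set1|].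
move=> s /= N; apply: contrapT => sa; apply: N => _; congr EFin; apply: FG.
exact/eqP.
Qed.

Section Solution.
Variables (M lam : R) (T : fam) (oT : opfam M lam T).
Variables (psi : R -> R) (K : fam) (iK : inputfam psi K).
Hypothesis ipsi : integ leb (expweight lam psi).
Notation q := (\int[leb]_s expweight lam psi s).
Hypothesis q1 : q < 1.

Lemma expweight_ge0 s : 0 <= expweight lam psi s.
Proof. by rewrite mulr_ge0 ?expR_ge0// (sfun_C0 (input_sfun iK s 0)). Qed.

Lemma contraction_const : 0 <= q < 1.
Proof. by rewrite q1 andbT Rintegral_ge0// => s _; exact: expweight_ge0. Qed.

Let q01 := contraction_const.
Notation A := (M / (1 - q)).

(** [M / (1 - q)] is the fixed point of [A = M + A * q], so one constant serves all iterates. *)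
Lemma viter_opfam n : opfam A lam (viter T K n).
Proof.
move: q01 => /andP[q_0 q_1]; have M0 := opfam_C0 oT; have q1' : 0 < 1 - q by rewrite subr_gt0.
elim: n => [|n IH] /=.
  apply: (opfam_le oT); rewrite ler_pdivlMr// mulrBr mulr1 gerBl mulr_ge0//.
apply: (opfam_le (opfamD oT (opfam_conv IH iK ipsi))).
by rewrite le_eqVlt; apply/orP; left; apply/eqP; field; rewrite gt_eqF.
Qed.

Lemma viter_diff n t f c x : Bb f -> (forall x, `|f x| <= c) ->
  `|viter T K n.+1 t f x - viter T K n t f x| <= M * q * expR (lam * t) * c * q ^+ n.
Proof.
elim: n t f c x => [|n IH] t f c x Bf fc.
  rewrite expr0 mulr1 /= addrAC subrr add0r; exact: (conv_bnd oT iK ipsi).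
have -> : viter T K n.+2 t f x - viter T K n.+1 t f x =
    conv (viter T K n.+1) K t f x - conv (viter T K n) K t f x by rewrite /=; ring.
have i1 := comp_integ (viter_opfam n.+1) iK ipsi t x Bf.
have i2 := comp_integ (viter_opfam n) iK ipsi t x Bf.
rewrite /conv -RintB//.
have bnd (s : TR) : `|viter T K n.+1 (t - s) (K s f) x - viter T K n (t - s) (K s f) x| <=
    (M * q * expR (lam * t) * c * q ^+ n) * expweight lam psi s.
  apply: (le_trans (IH (t - s) (K s f) (psi s * c) x (input_Bb iK s Bf) _)).
    by move=> y; exact: (input_bnd iK).
  rewrite mulrBr expRD /expweight le_eqVlt; apply/orP; left; apply/eqP.
  by set z := q; ring.
apply: (le_trans (Rint_le_norm _ bnd (integZ _ ipsi))).
  by apply: integ_meas; exact: (integB i1 i2).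
rewrite RintZ// exprS le_eqVlt; apply/orP; left; apply/eqP.
by set z := q; ring.
Qed.

Lemma vsol_approx n t f c x : Bb f -> (forall x, `|f x| <= c) ->
  `|viter T K n t f x - vsol T K t f x| <= M * q / (1 - q) * q ^+ n * expR (lam * t) * c.
Proof.
move=> Bf fc.
have := geometric_cauchy q01 (fun n => viter_diff n t x Bf fc) n.
move=> h; apply: (le_trans h); rewrite le_eqVlt; apply/orP; left; apply/eqP.
by set z := q; ring.
Qed.

Lemma vsol_opfam : opfam A lam (vsol T K).
Proof.
apply: (opfam_lim (e := fun n => M * q / (1 - q) * q ^+ n) viter_opfam).
- exact: cvg_geo.
- by move=> n t f c x Bf fc; exact: vsol_approx.
- move=> t f x t0; rewrite /vsol; under eq_fun do rewrite (opfam_le0 (viter_opfam _))//.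
  exact: lim_cst.
Qed.

Lemma vsol_cvg t f x : Bb f -> viter T K n t f x @[n --> \oo] --> vsol T K t f x.
Proof.
move=> Bf; have [_ [c fc]] := Bf.
apply: (cvg_seq0_le (fun n => vsol_approx n t x Bf fc)).
have -> : (fun n => M * q / (1 - q) * q ^+ n * expR (lam * t) * c) =
   (fun n => M * q / (1 - q) * expR (lam * t) * c * q ^+ n).
  by apply/funext => n; set z := q; ring.
exact: cvg_geo.
Qed.

Lemma vsol_eq t f x : Bb f -> vsol T K t f x = T t f x + conv (vsol T K) K t f x.
Proof.
move=> Bf; have [_ [c fc]] := Bf.
have h1 : viter T K n.+1 t f x @[n --> \oo] --> vsol T K t f x.
  by rewrite (cvg_shiftS (fun n => viter T K n t f x)); exact: vsol_cvg.
apply: (cvgn_unique h1); apply: cvgD; first exact: cvg_cst.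
have cs (s : TR) : viter T K n (t - s) (K s f) x @[n --> \oo] --> vsol T K (t - s) (K s f) x.
  by apply: vsol_cvg; exact: (input_Bb iK).
have bs n (s : TR) := comp_bnd (viter_opfam n) iK t x s Bf fc.
exact: (Rint_dct (fun n => comp_meas_s (viter_opfam n) iK t x Bf) cs bs (integZ _ ipsi)).
Qed.

(** [S - T] is the Duhamel integral, to which only times below [t] contribute. The last factor tends
    to 0 with [t] and does not depend on [x]; continuity of [S] at time 0 is inherited from [T] in
    this way. *)
Lemma vsol_T_bnd t f c x : Bb f -> (forall x, `|f x| <= c) ->
  `|vsol T K t f x - T t f x| <= A * expR (lam * t) * c * \int[leb]_s (heav (t - s) * expweight lam psi s).
Proof.
move=> Bf fc; rewrite vsol_eq// addrC addKr.
have ih : integ leb (fun s => heav (t - s) * expweight lam psi s).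
  apply: (integ_dom _ _ ipsi) => [|s].
    apply: measurable_funM; last exact: integ_meas ipsi.
    by apply: (@meas_heav_comp _ TR (fun s => t - s)); apply: measurable_funB.
  by rewrite normrM (ger0_norm (expweight_ge0 s)) ler_piMl ?expweight_ge0// heav_norm.
rewrite -RintZ//; apply: Rint_le_norm; last exact: integZ.
  exact: (comp_meas_s vsol_opfam iK).
move=> s; have [ts|ts] := ltP 0 (t - s).
  by rewrite heav1// mul1r; exact: (comp_bnd vsol_opfam iK).
by rewrite heav0// (opfam_le0 vsol_opfam)// normr0 mul0r mulr0.
Qed.

Hypothesis T_sg : forall (t s : R) (f : V -> R), 0 < t -> 0 < s -> Bb f -> T (t + s) f = T t (T s f).
Hypothesis K_T : forall (s r : R) (f : V -> R), 0 < s -> 0 < r -> Bb f -> K (r + s) f = K r (T s f).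

Notation S := (vsol T K).
Let oS := vsol_opfam.

(** The Duhamel integral is cut at [s]. Past [s] one has [K r = K (r - s) T(s)], and a translation
    turns that part into the integral belonging to time [t] and to the function [T s f]. *)
Lemma conv_split t s f x : 0 < t -> 0 < s -> Bb f ->
  S (t + s) f x = T (t + s) f x + \int[leb]_r (heav (s - r) * S (t + s - r) (K r f) x)
     + \int[leb]_r S (t - r) (K r (T s f)) x.
Proof.
move=> t0 s0 Bf; rewrite vsol_eq// -addrA; congr (_ + _).
have iF := comp_integ oS iK ipsi (t + s) x Bf.
have mF := integ_meas iF.
have mh (a : R) : measurable_fun setT (fun r : TR => heav (a - r)).
  by apply: (@meas_heav_comp _ TR (fun s => a - s)); apply: measurable_funB.
have mh' (a : R) : measurable_fun setT (fun r : TR => heav (r - a)).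
  by apply: (@meas_heav_comp _ TR (fun s => s - a)); apply: measurable_funB.
have hb (z w : R) : `|z| <= 1 -> `|z * w| <= `|w|.
  by move=> z1; rewrite normrM ler_piMl.
have i1 : integ leb (fun r => heav (s - r) * S (t + s - r) (K r f) x).
  apply: (integ_dom _ _ (integrable_norm iF)); first exact: measurable_funM.
  by move=> r; apply: hb; exact: heav_norm.
have i2 : integ leb (fun r => heav (r - s) * S (t + s - r) (K r f) x).
  apply: (integ_dom _ _ (integrable_norm iF)); first exact: measurable_funM.
  by move=> r; apply: hb; exact: heav_norm.
transitivity (\int[leb]_r (heav (s - r) * S (t + s - r) (K r f) x + heav (r - s) * S (t + s - r) (K r f) x)).
  apply: (@Rint_point s) => //.
    exact: integ_meas (integD i1 i2).
  move=> r rs; have [h|h] := ltP r s.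
    by rewrite heav1 ?subr_gt0// heav0 ?subr_le0 1?ltW// mul1r mul0r addr0.
  have sr : s < r by rewrite lt_neqAle eq_sym rs.
  by rewrite heav0 ?subr_le0// heav1 ?subr_gt0// mul1r mul0r add0r.
rewrite RintD//; congr (_ + _).
rewrite -(Rint_shift s); last exact: integ_meas i2.
apply: eq_Rintegral => r _; rewrite addrK.
have -> : t + s - (r + s) = t - r by ring.
have [r0|r0] := ltP 0 r; first by rewrite heav1// mul1r K_T.
rewrite heav0// mul0r (_ : K r (T s f) = fun=> 0) ?(sfun0 (opfam_sfun oS _ _))//.
by apply/funext => y; rewrite (input_le0 iK).
Qed.

(** The inner [S s f] is expanded by its equation, then [S t] of the resulting [T s f] is expanded
    once more. Two of the three terms now coincide with terms of [conv_split]. *)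
Lemma S_comp t s f x : 0 < t -> 0 < s -> Bb f ->
  S t (S s f) x = T t (T s f) x + \int[leb]_r S (t - r) (K r (T s f)) x
     + \int[leb]_r S t (S (s - r) (K r f)) x /\
  measurable_fun setT (fun r : TR => S t (S (s - r) (K r f)) x).
Proof.
move=> t0 s0 Bf; have [_ [c fc]] := Bf.
have mh : measurable_fun setT (fun p : TR * Vb => S (s - p.1) (K p.1 f) p.2).
  have m1 : measurable_fun setT (fun p : TR * Vb => (((s, p.2), p.1) : (TR * Vb) * TR)).
    by do 2 apply: measurable_fun_pair => //; exact: measurable_fst.
  exact: (measurableT_comp (comp_meas oS iK Bf) m1).
have bh (r : TR) y := comp_bnd oS iK s y r Bf fc.
have [m2 e2] := sfun_Rint mh bh (integZ _ ipsi) (opfam_sfun oS t x).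
split => //; rewrite -e2 -[X in X + _]vsol_eq//; last exact: (opfam_Bb oT).
rewrite -(sfunD (opfam_sfun oS t x)).
- by congr (S t _ x); apply/funext => y; rewrite [LHS]vsol_eq.
- exact: (opfam_Bb oT).
- exact: (Bb_Rint mh bh (integZ _ ipsi)).
Qed.

Lemma vsol_sg (t s : R) (f : V -> R) : 0 < t -> 0 < s -> Bb f -> S (t + s) f = S t (S s f).
Proof.
move=> t0 s0 Bf; apply/funext => x; have [_ [c fc]] := Bf.
(* With [t] fixed, the defect of the semigroup law solves a homogeneous Volterra equation in [s], so
   its a priori bound contracts to zero. *)
pose P D := forall s f c x, 0 < s -> Bb f -> (forall x, `|f x| <= c) ->
  `|S (t + s) f x - S t (S s f) x| <= D * expR (lam * s) * c.
have A0 : 0 <= A := opfam_C0 oS.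
have eP : 0 <= expR (lam * t) by exact: expR_ge0.
pose D0 := A * expR (lam * t) + A * expR (lam * t) * A.
have PD0 : P D0.
  move=> s' f' c' x' s'0 Bf' fc'.
  apply: (le_trans (ler_normB _ _)); rewrite /D0 !mulrDl; apply: lerD.
    apply: (le_trans (opfam_bnd oS (t + s') x' Bf' fc')).
    by rewrite mulrDr expRD !mulrA.
  apply: (le_trans (opfam_bnd oS t x' (opfam_Bb oS s' Bf') (fun y => opfam_bnd oS s' y Bf' fc'))).
  by rewrite !mulrA.
have Pi D : 0 <= D -> P D -> P (q * D + 0).
  move=> D_0 PD s' f' c' x' s'0 Bf' fc'.
  have [e2 m2] := S_comp x' t0 s'0 Bf'.
  rewrite (conv_split x' t0 s'0 Bf') e2 T_sg//.
  have [mF iF] : measurable_fun setT (fun r : TR => heav (s' - r) * S (t + s' - r) (K r f') x') /\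
       integ leb (fun r : TR => heav (s' - r) * S (t + s' - r) (K r f') x').
    have iF := comp_integ oS iK ipsi (t + s') x' Bf'.
    have m : measurable_fun setT (fun r : TR => heav (s' - r) * S (t + s' - r) (K r f') x').
      apply: measurable_funM; last exact: integ_meas iF.
      by apply: (@meas_heav_comp _ TR (fun s => s' - s)); apply: measurable_funB.
    split => //; apply: (integ_dom m _ (integrable_norm iF)) => r.
    by rewrite /= normrM ler_piMl// heav_norm.
  have iG : integ leb (fun r : TR => S t (S (s' - r) (K r f')) x').
    apply: (integ_dom m2 _ (integZ (A * expR (lam * t) * (A * expR (lam * s') * c')) ipsi)) => r.
    apply: (le_trans (opfam_bnd oS t x' (opfam_Bb oS _ (input_Bb iK r Bf')) (fun y => comp_bnd oS iK s' y r Bf' fc'))).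
    by rewrite !mulrA.
  set X := \int[leb]_r S (t - r) _ _.
  have -> : forall a b e : R, a + b + X - (a + X + e) = b - e by move=> *; ring.
  rewrite -RintB//.
  have bnd (r : TR) : `|heav (s' - r) * S (t + s' - r) (K r f') x' - S t (S (s' - r) (K r f')) x'|
      <= D * expR (lam * s') * c' * expweight lam psi r.
    have [sr|sr] := ltP 0 (s' - r).
      rewrite heav1// mul1r -addrA.
      apply: (le_trans (PD _ _ _ _ sr (input_Bb iK r Bf') (fun y => input_bnd iK r y Bf' fc'))).
      rewrite mulrBr expRD /expweight le_eqVlt; apply/orP; left; apply/eqP; ring.
    rewrite heav0// mul0r (_ : S (s' - r) _ = fun=> 0); last first.
      by apply/funext => y; rewrite (opfam_le0 oS).
    rewrite (sfun0 (opfam_sfun oS _ _)) subrr normr0 !mulr_ge0 ?expR_ge0//.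
      by rewrite (le_trans _ (fc' 0)).
    by rewrite (sfun_C0 (input_sfun iK r 0)).
  apply: (le_trans (Rint_le_norm _ bnd (integZ _ ipsi))).
    exact: integ_meas (integB iF iG).
  rewrite RintZ// addr0 le_eqVlt; apply/orP; left; apply/eqP.
  by set z := q; ring.
have AE : 0 <= A * expR (lam * t) by exact: mulr_ge0.
have D00 : 0 <= D0 by apply: addr_ge0 => //; exact: mulr_ge0.
have H := contraction_principle q01 D00 (lexx 0) PD0 Pi.
apply/eqP; rewrite -subr_eq0 -normr_le0.
have ec : 0 <= expR (lam * s) * c by rewrite mulr_ge0 ?expR_ge0// (le_trans _ (fc 0)).
apply: (contraction_limit (A := D0 * (expR (lam * s) * c)) q01) => n.
have [D PD Dn] := H n; apply: (le_trans (PD s f c x s0 Bf fc)).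
rewrite -mulrA addr0; apply: (@le_trans _ _ ((D0 * q ^+ n) * (expR (lam * s) * c))).
  by rewrite ler_wpM2r//; move: Dn; rewrite mul0r addr0.
by rewrite le_eqVlt; apply/orP; left; apply/eqP; set z := q; ring.
Qed.

End Solution.
End Volterra.

(** * Exponential integrals *)

Section ExponentialIntegrals.
Context (R : realType).
Notation leb := (@lebesgue_measure R).
Notation TR := (measurableTypeR R).

Lemma is_derive_expZ (k x : R) : is_derive x 1 (fun y => expR (k * y)) (k * expR (k * x)).
Proof.
have h : is_derive x 1 (fun y => k * y) k.
  have := @is_deriveM _ _ (cst k) id x 1 0 1 _ _; rewrite /= scaler0 addr0.
  by move=> /(_ _ _); rewrite /GRing.scale/= mulr1; apply; exact: is_derive_cst.
by have := is_derive1_comp (is_derive_expR (k * x)) h; rewrite mulrC.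
Qed.

Lemma continuous_expZ (k : R) : continuous (fun y : R => expR (k * y)).
Proof.
by move=> x; apply: continuous_comp; [exact: mulrl_continuous|exact: continuous_expR].
Qed.

Lemma meas_expZ (k : R) : measurable_fun setT (fun y : TR => expR (k * y)).
Proof. exact: (continuous_measurable_fun (@continuous_expZ k)). Qed.

(** The sign of [k] is free: the growing exponential occurs in the resolvent identity, the decaying
    one in the shifted Duhamel formula. *)
Lemma Rint_exp_itv (k m : R) : k != 0 -> 0 <= m ->
  k * \int[leb]_s (heav (m - s) * (heav s * expR (k * s))) = expR (k * m) - 1.
Proof.
move=> k0; rewrite le_eqVlt => /predU1P[<-|m0].
  rewrite mulr0 expR0 subrr (_ : \int[leb]_s _ = 0) ?mulr0//.
  rewrite -[RHS](@Rint0 _ _ _ leb); apply: eq_Rintegral => s _.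
  have [s0|s0] := leP s 0; first by rewrite (heav0 s0) mul0r mulr0.
  by rewrite heav0 ?mul0r// sub0r oppr_le0 ltW.
have -> : \int[leb]_s (heav (m - s) * (heav s * expR (k * s))) =
    \int[leb]_(s in `]0, m[) expR (k * s).
  rewrite [RHS]Rintegral_mkcond; apply: eq_Rintegral => s _.
  rewrite patchE mem_setE in_itv/=.
  have [s0|s0] := leP s 0; first by rewrite (heav0 s0) mul0r mulr0.
  have [sm|sm] := ltP s m; first by rewrite !heav1 ?subr_gt0// !mul1r.
  by rewrite heav0 ?subr_le0// mul0r.
have -> : \int[leb]_(s in `]0, m[) expR (k * s) = \int[leb]_(s in `[0, m]) expR (k * s).
  have mE : measurable_fun (`]0, m[ : set R) (fun z : R => (expR (k * z))%:E).
    by apply/measurable_EFinP; apply: measurable_funTS; exact: (continuous_measurable_fun (@continuous_expZ k)).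
  by rewrite /Rintegral (integral_itv_bndoo true false mE).
rewrite /Rintegral (@continuous_FTC2 _ _ (fun s => k^-1 * expR (k * s)))//=.
- rewrite mulr0 expR0; field; exact: k0.
- by apply: continuous_subspaceT; exact: continuous_expZ.
- split.
  + move=> x _; apply: derivableM; first exact: derivable_cst.
    by have [] := is_derive_expZ k x.
  + apply: cvgM; first exact: cvg_cst.
    by apply: cvg_at_right_filter; exact: continuous_expZ.
  + apply: cvgM; first exact: cvg_cst.
    by apply: cvg_at_left_filter; exact: continuous_expZ.
- move=> x _; rewrite derive1E deriveM//.
  rewrite derive_cst scaler0 addr0; have [_ ->] := is_derive_expZ k x.
  by rewrite /GRing.scale/= mulKf.
Qed.

Lemma exp_halfline (k : R) : 0 < k ->
  integ leb (fun s => heav s * expR (- (k * s))) /\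
  \int[leb]_s (heav s * expR (- (k * s))) = k^-1.
Proof.
move=> k0.
have e : (\int[leb]_(s in `[0%R, +oo[) (expR (- (k * s)))%:E = k^-1%:E)%E.
  rewrite (@ge0_continuous_FTC2y _ _ (fun s => - k^-1 * expR (- k * s)) 0 0)//=.
  - by rewrite mulr0 expR0 mulr1 -EFinB sub0r opprK.
  - apply: continuous_subspaceT => x; under eq_fun do rewrite -mulNr; exact: continuous_expZ.
  - rewrite -[X in _ --> X](mulr0 (- k^-1)); apply: cvgMr.
    under eq_fun do rewrite mulNr.
    apply: (@cvg_comp _ _ _ (fun s => k * s) (fun y => expR (- y)) _ (pinfty_nbhs R)); last exact: cvgr_expR.
    by apply: gt0_cvgMry => //; exact: cvg_id.
  - apply: cvgM; first exact: cvg_cst.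
    by apply: cvg_at_right_filter; exact: continuous_expZ.
  - move=> x _; rewrite derive1E deriveM//.
    rewrite derive_cst scaler0 addr0; have [_ ->] := is_derive_expZ (- k) x.
    rewrite /GRing.scale/= mulrA mulrNN mulVf ?gt_eqF// mul1r mulNr//.
have e' : (\int[leb]_s (heav s * expR (- (k * s)))%:E = k^-1%:E)%E.
  have mE : measurable_fun (`]0, +oo[ : set R) (fun z : R => (expR (- (k * z)))%:E).
    apply/measurable_EFinP; apply: measurable_funTS.
    by under eq_fun do rewrite -mulNr; exact: (continuous_measurable_fun (@continuous_expZ (- k))).
  rewrite -e -(integral_itv_obnd_cbnd mE).
  rewrite [RHS]integral_mkcond; apply: eq_integral => s _.
  rewrite patchE mem_setE in_itv/= andbT.
  by have [s0|s0] := leP s 0; [rewrite heav0 ?mul0r|rewrite heav1 ?mul1r].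
split; last by rewrite /Rintegral e'.
apply/integrableP; split.
  apply/measurable_EFinP; apply: measurable_funM; first exact: meas_heav.
  by under eq_fun do rewrite -mulNr; exact: meas_expZ.
under eq_integral => s _ do rewrite gee0_abs ?lee_fin ?mulr_ge0 ?heav_ge0 ?expR_ge0//.
by rewrite e' ltry.
Qed.

End ExponentialIntegrals.

(** * Generators and resolvents *)

Section Generator.
Context (R : realType) (d : nat).
Notation V := (V R d).
Notation Vb := (Vb R d).
Notation leb := (@lebesgue_measure R).
Notation TR := (measurableTypeR R).
Notation fam := (R -> (V -> R) -> V -> R).

(** This is [fullgen] in real-valued form over the whole line, for families extended by 0 to
    nonpositive times. *)
Definition gen (U : fam) (u g : V -> R) :=
  [/\ Bb u, Bb g & forall t x, 0 < t -> U t u x - u x = \int[leb]_s (heav (t - s) * U s g x)].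

Definition resolvent (U : fam) (k : R) (f : V -> R) : V -> R :=
  fun x => \int[leb]_s (expR (- (k * s)) * U s f x).

Lemma meas_heav_l (t : R) : measurable_fun setT (fun s : TR => heav (t - s)).
Proof. by apply: (@meas_heav_comp _ _ TR (fun s => t - s)); apply: measurable_funB. Qed.

Lemma meas_heav_r (t : R) : measurable_fun setT (fun s : TR => heav (s - t)).
Proof. by apply: (@meas_heav_comp _ _ TR (fun s => s - t)); apply: measurable_funB. Qed.

Lemma meas_TRfst : measurable_fun setT (fun p : TR * TR => p.1 : R).
Proof. exact: (@measurable_fst _ _ TR TR). Qed.

Lemma meas_TRsnd : measurable_fun setT (fun p : TR * TR => p.2 : R).
Proof. exact: (@measurable_snd _ _ TR TR). Qed.

Lemma meas_expN (k : R) : measurable_fun setT (fun s : TR => expR (- (k * s))).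
Proof. by under eq_fun do rewrite -mulNr; exact: meas_expZ. Qed.

Lemma expR_ge1 (x : R) : 0 <= x -> 1 <= expR x.
Proof. by move=> x0; rewrite -[leLHS]expR0 ler_expR. Qed.

Notation wexp k := (fun s : TR => heav s * expR (- (k * s))).

Lemma wexp_ge0 (k s : R) : 0 <= heav s * expR (- (k * s)).
Proof. by rewrite mulr_ge0 ?heav_ge0 ?expR_ge0. Qed.

(** Dominating the indicator of [(0, t)] by an exponential on the half-line lets [exp_halfline]
    provide integrability for finite and infinite time intervals alike. *)
Lemma heav2_le (t s : R) : heav (t - s) * heav s <= expR t * (heav s * expR (- (1 * s))).
Proof.
have [st|st] := ltP 0 (t - s); last by rewrite heav0// mul0r mulr_ge0 ?expR_ge0 ?wexp_ge0.
rewrite heav1// mul1r mulrCA ler_peMr ?heav_ge0// -expRD expR_ge1; lra.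
Qed.

Section Resolvent.
Variables (A lam : R) (U : fam) (oU : opfam A lam U) (lam0 : 0 <= lam).

Lemma opfam_heav s f x c : Bb f -> (forall x, `|f x| <= c) ->
  `|U s f x| <= A * expR (lam * s) * c * heav s.
Proof.
move=> Bf fc; have [s0|s0] := ltP 0 s.
  by rewrite heav1// mulr1; exact: (opfam_bnd oU _ _ Bf fc).
by rewrite (opfam_le0 oU)// normr0 heav0// mulr0.
Qed.

Lemma exp_bnd k s f x c : Bb f -> (forall x, `|f x| <= c) ->
  `|expR (- (k * s)) * U s f x| <= A * c * (heav s * expR (- ((k - lam) * s))).
Proof.
move=> Bf fc; rewrite normrM ger0_norm ?expR_ge0//.
apply: (@le_trans _ _ (expR (- (k * s)) * (A * expR (lam * s) * c * heav s))).
  by rewrite ler_wpM2l ?expR_ge0// opfam_heav.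
have -> : - ((k - lam) * s) = - (k * s) + lam * s by ring.
by rewrite expRD le_eqVlt; apply/orP; left; apply/eqP; ring.
Qed.

Lemma exp_meas k f : Bb f ->
  measurable_fun setT (fun p : TR * Vb => expR (- (k * p.1)) * U p.1 f p.2).
Proof.
move=> Bf; apply: measurable_funM; last exact: (opfam_meas oU Bf).
exact: (measurableT_comp (meas_expN k) (@measurable_fst _ _ TR Vb)).
Qed.

Lemma exp_meas_s k f x : Bb f -> measurable_fun setT (fun s : TR => expR (- (k * s)) * U s f x).
Proof. by move=> Bf; apply: measurable_funM; [exact: meas_expN|exact: (opfam_meas_t oU)]. Qed.

Lemma exp_integ k f x : lam < k -> Bb f -> integ leb (fun s => expR (- (k * s)) * U s f x).
Proof.
move=> lk Bf; have [_ [c fc]] := Bf.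
have k0 : 0 < k - lam by rewrite subr_gt0.
exact: (integ_dom (exp_meas_s k x Bf) (fun s => exp_bnd k s x Bf fc) (integZ _ (exp_halfline k0).1)).
Qed.

Lemma fin_bnd t s f x c : Bb f -> (forall x, `|f x| <= c) ->
  `|heav (t - s) * U s f x| <= A * expR (lam * t) * c * expR t * (heav s * expR (- (1 * s))).
Proof.
move=> Bf fc.
have c0 : 0 <= c by rewrite (le_trans _ (fc 0)).
have A0 := opfam_C0 oU.
have [ts|ts] := ltP 0 (t - s); last first.
  by rewrite heav0// mul0r normr0 !mulr_ge0 ?expR_ge0 ?heav_ge0.
rewrite normrM ger0_norm ?heav_ge0//.
apply: (@le_trans _ _ (heav (t - s) * (A * expR (lam * t) * c * heav s))).
  rewrite ler_wpM2l ?heav_ge0//; apply: (le_trans (opfam_heav _ _ Bf fc)).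
  rewrite ler_wpM2r ?heav_ge0// ler_wpM2r// ler_wpM2l ?(opfam_C0 oU)// ler_expR ler_wpM2l//.
  by rewrite ltW// -subr_gt0.
by rewrite mulrCA -[leRHS]mulrA ler_wpM2l ?heav2_le// !mulr_ge0 ?expR_ge0.
Qed.

Lemma fin_meas t f x : Bb f -> measurable_fun setT (fun s : TR => heav (t - s) * U s f x).
Proof. by move=> Bf; apply: measurable_funM; [exact: meas_heav_l|exact: (opfam_meas_t oU)]. Qed.

Lemma fin_integ t f x : Bb f -> integ leb (fun s => heav (t - s) * U s f x).
Proof.
move=> Bf; have [_ [c fc]] := Bf.
exact: (integ_dom (fin_meas t x Bf) (fun s => fin_bnd t s x Bf fc) (integZ _ (exp_halfline ltr01).1)).
Qed.

Lemma res_Bb k f : lam < k -> Bb f -> Bb (resolvent U k f).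
Proof.
move=> lk Bf; have [_ [c fc]] := Bf.
have k0 : 0 < k - lam by rewrite subr_gt0.
exact: (Bb_Rint (exp_meas k Bf) (fun s x => exp_bnd k s x Bf fc) (integZ _ (exp_halfline k0).1)).
Qed.

(** Formally [U t w = expR (k * t) w], which outgrows the bound [expR (lam * t)]. The proof takes
    the Laplace transform at [k] of the equation saying that [p] is [w] plus [k] times the primitive
    of [p]: the transform [P] of [p] is finite and satisfies [P = w / k + P]. *)
Lemma gen_eigen0 k w : lam < k -> gen U w (fun x => k * w x) -> forall x, w x = 0.
Proof.
move=> lk [Bw _ gw] x; have [_ [c wc]] := Bw.
have k0 : 0 < k by exact: le_lt_trans lam0 lk.
have A0 := opfam_C0 oU.
have c0 : 0 <= c by rewrite (le_trans _ (wc 0)).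
pose p t := U t w x.
have pE t : heav t * p t = heav t * w x + k * (heav t * \int[leb]_s (heav (t - s) * p s)).
  have [t0|t0] := leP t 0; first by rewrite !heav0// !mul0r mulr0 addr0.
  rewrite heav1// !mul1r -RintZ; last exact: fin_integ.
  rewrite -[p t](subrK (w x)) gw// addrC; congr (_ + _); apply: eq_Rintegral => s _.
  by rewrite (sfunZ (opfam_sfun oU _ _))// mulrCA.
have [i1 e1] := exp_halfline k0.
(* A rate strictly between [lam] and [k]. On [s < t] it splits the decay of [expR (lam * s - k * t)]
   into a product of integrable functions of [t] and of [s], as Fubini requires. *)
pose l1 := (k + lam) / 2.
have l1k : 0 < k - l1 by rewrite /l1; lra.
have l1l : 0 < l1 - lam by rewrite /l1; lra.
have l10 : 0 <= l1 by rewrite divr_ge0// addr_ge0// ltW.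
pose F (t s : TR) : R := heav t * expR (- (k * t)) * (heav (t - s) * p s).
have mF : measurable_fun setT (fun z => F z.1 z.2).
  apply: measurable_funM; first apply: measurable_funM.
  - exact: (meas_heav_comp meas_TRfst).
  - exact: (measurableT_comp (meas_expN k) (@measurable_fst _ _ TR TR)).
  apply: measurable_funM.
    by apply: meas_heav_comp; apply: measurable_funB; [exact: meas_TRfst|exact: meas_TRsnd].
  exact: (measurableT_comp (opfam_meas_t oU x Bw) (@measurable_snd _ _ TR TR)).
have bF t s : `|F t s| <= (heav t * expR (- ((k - l1) * t))) * (A * c * (heav s * expR (- ((l1 - lam) * s)))).
  rewrite /F; have [ts|ts] := ltP 0 (t - s); last first.
    by rewrite [heav (t - s)]heav0// mul0r mulr0 normr0 !mulr_ge0 ?expR_ge0 ?heav_ge0.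
  rewrite [heav (t - s)]heav1// mul1r normrM ger0_norm ?wexp_ge0//.
  apply: (le_trans (ler_wpM2l (wexp_ge0 k t) (opfam_heav s x Bw wc))).
  have -> : heav t * expR (- (k * t)) * (A * expR (lam * s) * c * heav s) =
     heav t * (A * c * heav s) * expR (- (k * t) + lam * s) by rewrite expRD; ring.
  have -> : heav t * expR (- ((k - l1) * t)) * (A * c * (heav s * expR (- ((l1 - lam) * s)))) =
     heav t * (A * c * heav s) * expR (- ((k - l1) * t) + - ((l1 - lam) * s)) by rewrite expRD; ring.
  rewrite ler_wpM2l ?mulr_ge0 ?heav_ge0// ler_expR; nra.
have ia := (exp_halfline l1k).1.
have ib := integZ (A * c) (exp_halfline l1l).1.
have inner (s : TR) : \int[leb]_t F t s = k^-1 * (expR (- (k * s)) * p s).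
  have [s0|s0] := leP s 0.
    rewrite (_ : p s = 0) ?mulr0; last exact: (opfam_le0 oU).
    rewrite -[RHS](@Rint0 _ _ _ leb); apply: eq_Rintegral => t _.
    by rewrite /F /p (opfam_le0 oU)// !mulr0.
  have mt : measurable_fun setT (fun t : TR => heav (t - s) * expR (- (k * t))).
    by apply: measurable_funM; [exact: meas_heav_r|exact: meas_expN].
  have it : integ leb (fun t => heav (t - s) * expR (- (k * t))).
    apply: (integ_dom mt _ i1) => t; rewrite ger0_norm ?mulr_ge0 ?heav_ge0 ?expR_ge0//.
    rewrite ler_wpM2r ?expR_ge0//; have [ts|ts] := ltP 0 (t - s); last by rewrite heav0 ?heav_ge0.
    by rewrite !heav1//; lra.
  transitivity (p s * \int[leb]_t (heav (t - s) * expR (- (k * t)))).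
    rewrite -RintZ//; apply: eq_Rintegral => t _; rewrite /F.
    have [ts|ts] := ltP 0 (t - s); last by rewrite [heav (t - s)]heav0// !(mul0r, mulr0).
    by rewrite [heav t]heav1; [ring|lra].
  rewrite -(Rint_shift s mt).
  suff -> : \int[leb]_t (heav (t + s - s) * expR (- (k * (t + s)))) = expR (- (k * s)) * k^-1 by ring.
  rewrite -e1 -RintZ//; apply: eq_Rintegral => t _.
  by rewrite addrK mulrDr opprD expRD; ring.
have Fub := Rint_Fubini mF bF ia ib.
have ip := exp_integ x lk Bw.
have E1 : \int[leb]_s (expR (- (k * s)) * p s) =
   w x * k^-1 + k * \int[leb]_t \int[leb]_s F t s.
  have iI : integ leb (fun t => \int[leb]_s F t s).
    apply: (integ_dom (meas_Rint2 mF bF ia ib) _ (integZ (\int[leb]_s (A * c * (heav s * expR (- ((l1 - lam) * s))))) ia)) => t.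
    rewrite mulrC -RintZ//; apply: (Rint_le_norm _ (bF t) (integZ _ ib)).
    exact: (measurable_fun_pair2 t mF).
  rewrite -e1 -RintZ// -RintZ// -RintD; [|exact: integZ..].
  apply: eq_Rintegral => t _.
  have -> : expR (- (k * t)) * p t = expR (- (k * t)) * (heav t * p t).
    have [t0|t0] := leP t 0; first by rewrite /p (opfam_le0 oU)// !mulr0.
    by rewrite heav1// mul1r.
  rewrite pE mulrDr; congr (_ + _); first ring.
  rewrite /F RintZ; last exact: fin_integ.
  ring.
have Fub' : \int[leb]_t \int[leb]_s F t s = \int[leb]_s (k^-1 * (expR (- (k * s)) * p s)).
  by rewrite Fub; apply: eq_Rintegral => s _; exact: inner.
move: E1; rewrite Fub' RintZ// mulrA mulfV ?gt_eqF// mul1r => /eqP.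
rewrite eq_sym -subr_eq0 addrK mulf_eq0 invr_eq0 [k == 0]gt_eqF// orbF => /eqP.
exact.
Qed.

Hypothesis U_sg : forall (t s : R) (f : V -> R), 0 < t -> 0 < s -> Bb f -> U (t + s) f = U t (U s f).

Lemma U_res k t f x : lam < k -> 0 < t -> Bb f ->
  U t (resolvent U k f) x = \int[leb]_r (heav (r - t) * (expR (- (k * (r - t))) * U r f x)).
Proof.
move=> lk t0 Bf; have [_ [c fc]] := Bf.
have k0 : 0 < k - lam by rewrite subr_gt0.
have [m1 ->] := sfun_Rint (exp_meas k Bf) (fun s x => exp_bnd k s x Bf fc)
   (integZ _ (exp_halfline k0).1) (opfam_sfun oU t x).
rewrite -[RHS](Rint_shift t); last first.
  apply: measurable_funM; first exact: meas_heav_r.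
  apply: measurable_funM; last exact: (opfam_meas_t oU).
  apply: (measurableT_comp (meas_expN k) (_ : measurable_fun setT (fun s : TR => s - t : TR))).
  exact: (@measurable_funB _ TR R).
apply: eq_Rintegral => s _; rewrite addrK.
have [s0|s0] := leP s 0.
  rewrite heav0// mul0r (_ : (fun _ => _) = fun=> 0) ?(sfun0 (opfam_sfun oU _ _))//.
  by apply/funext => y; rewrite (opfam_le0 oU)// mulr0.
rewrite heav1// mul1r (sfunZ (opfam_sfun oU _ _)); last exact: (opfam_Bb oU).
by rewrite addrC U_sg.
Qed.

(** By [U_res] the integral of [U s (resolvent U k f)] over [(0, t)] is a double integral.
    Integrating [k * expR (k * s)] first, over [s] below [min t r], gives [expR (k * min t r) - 1];
    the cases [r < t] and [t < r] then produce the three terms of [e2]. *)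
Lemma res_gen k f : lam < k -> Bb f ->
  gen U (resolvent U k f) (fun x => k * resolvent U k f x - f x).
Proof.
move=> lk Bf; have [_ [c fc]] := Bf.
have BR := res_Bb lk Bf.
have k0 : 0 < k by exact: le_lt_trans lam0 lk.
have kl0 : 0 < k - lam by rewrite subr_gt0.
have A0 := opfam_C0 oU.
have c0 : 0 <= c by rewrite (le_trans _ (fc 0)).
split => //; first by apply: BbB => //; exact: BbZ.
move=> t x t0; pose a s := U s (resolvent U k f) x.
pose F (s r : TR) : R := heav (t - s) * (heav s * expR (k * s)) * (heav (r - s) * (expR (- (k * r)) * U r f x)).
have mF : measurable_fun setT (fun z => F z.1 z.2).
  apply: measurable_funM; first apply: measurable_funM.
  - exact: (measurableT_comp (meas_heav_l t) (@measurable_fst _ _ TR TR)).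
  - apply: measurable_funM; first exact: (meas_heav_comp meas_TRfst).
    exact: (measurableT_comp (meas_expZ k) (@measurable_fst _ _ TR TR)).
  apply: measurable_funM.
    by apply: meas_heav_comp; apply: measurable_funB; [exact: meas_TRsnd|exact: meas_TRfst].
  exact: (measurableT_comp (exp_meas_s k x Bf) (@measurable_snd _ _ TR TR)).
have bF s r : `|F s r| <= (expR (k * t) * (expR t * (heav s * expR (- (1 * s))))) *
     (A * c * (heav r * expR (- ((k - lam) * r)))).
  rewrite /F normrM; apply: ler_pM => //.
    rewrite ger0_norm; last by rewrite !mulr_ge0 ?heav_ge0 ?expR_ge0.
    have [ts|ts] := ltP 0 (t - s); last by rewrite heav0// mul0r !mulr_ge0 ?expR_ge0 ?heav_ge0.
    apply: (@le_trans _ _ (expR (k * t) * (heav (t - s) * heav s))).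
      rewrite mulrA mulrC ler_wpM2r ?mulr_ge0 ?heav_ge0// ler_expR ler_wpM2l ?ltW//.
      by rewrite -subr_gt0.
    by rewrite ler_wpM2l ?expR_ge0// heav2_le.
  rewrite normrM; apply: (le_trans _ (exp_bnd k r x Bf fc)).
  by rewrite ler_piMl// heav_norm.
have ia := integZ (expR (k * t)) (integZ (expR t) (exp_halfline ltr01).1).
have ib := integZ (A * c) (exp_halfline kl0).1.
have ip := exp_integ x lk Bf.
have ir : integ leb (fun r => heav (r - t) * (expR (- (k * (r - t))) * U r f x)).
  have m : measurable_fun setT (fun r : TR => heav (r - t) * (expR (- (k * (r - t))) * U r f x)).
    apply: measurable_funM; first exact: meas_heav_r.
    under eq_fun do rewrite mulrBr opprB addrC expRD [_ * expR _]mulrC -mulrA.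
    by apply: measurable_funM => //; exact: exp_meas_s.
  apply: (integ_dom m _ (integZ (expR (k * t)) (integrable_norm ip))) => r.
  rewrite normrM; apply: (@le_trans _ _ `|expR (- (k * (r - t))) * U r f x|).
    by rewrite ler_piMl// heav_norm.
  rewrite mulrBr opprB expRD -mulrA normrM ger0_norm ?expR_ge0//.
have iFt := fin_integ t x Bf.
have e1 : \int[leb]_s (heav (t - s) * a s) = \int[leb]_s \int[leb]_r F s r.
  apply: eq_Rintegral => s _; rewrite /a; have [s0|s0] := leP s 0.
    rewrite (opfam_le0 oU)// mulr0 -[LHS](@Rint0 _ _ _ leb); apply: eq_Rintegral => r _.
    by rewrite /F [heav s]heav0// !mul0r mulr0 mul0r.
  rewrite U_res// -RintZ; last first.
    have m : measurable_fun setT (fun r : TR => heav (r - s) * (expR (- (k * (r - s))) * U r f x)).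
      apply: measurable_funM; first exact: meas_heav_r.
      under eq_fun do rewrite mulrBr opprB addrC expRD [_ * expR _]mulrC -mulrA.
      by apply: measurable_funM => //; exact: exp_meas_s.
    apply: (integ_dom m _ (integZ (expR (k * s)) (integrable_norm ip))) => r.
    rewrite normrM; apply: (@le_trans _ _ `|expR (- (k * (r - s))) * U r f x|).
      by rewrite ler_piMl// heav_norm.
    by rewrite mulrBr opprB expRD -mulrA normrM ger0_norm ?expR_ge0.
  apply: eq_Rintegral => r _; rewrite /F [heav s]heav1// mul1r mulrBr opprB expRD; ring.
have inner (r : TR) : k * \int[leb]_s F s r =
    expR (- (k * r)) * U r f x * (expR (k * Num.min t r) - 1).
  have [r0|r0] := leP r 0.
    rewrite (opfam_le0 oU)// mulr0 mul0r (_ : \int[leb]_s _ = 0) ?mulr0//.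
    rewrite -[RHS](@Rint0 _ _ _ leb); apply: eq_Rintegral => s _.
    by rewrite /F (opfam_le0 oU)// !mulr0.
  have m0 : 0 <= Num.min t r by rewrite le_min !ltW.
  rewrite -(Rint_exp_itv (lt0r_neq0 k0) m0) mulrCA; congr (_ * _).
  rewrite -RintZ; last first.
    have me : measurable_fun setT (fun s : TR => heav (Num.min t r - s) * (heav s * expR (k * s))).
      apply: measurable_funM; first exact: meas_heav_l.
      by apply: measurable_funM; [exact: meas_heav|exact: meas_expZ].
    apply: (integ_dom me _ ia) => s; rewrite ger0_norm ?mulr_ge0 ?heav_ge0 ?expR_ge0//.
    have [ts|ts] := ltP 0 (Num.min t r - s); last by rewrite heav0// mul0r !mulr_ge0 ?expR_ge0 ?heav_ge0.
    have tm : Num.min t r <= t by rewrite ge_min lexx.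
    have ts' : s < t by apply: lt_le_trans tm; rewrite -subr_gt0.
    rewrite heav1// mul1r; have [s0|s0] := leP s 0; first by rewrite heav0// !mul0r !mulr0.
    rewrite heav1// !mul1r; apply: (@le_trans _ _ (expR (k * t))).
      by rewrite ler_expR ler_wpM2l// ltW.
    rewrite ler_peMr ?expR_ge0// -expRD expR_ge1; lra.
  apply: eq_Rintegral => s _; rewrite /F.
  have -> : heav (Num.min t r - s) = heav (t - s) * heav (r - s).
    rewrite /heav !subr_gt0 lt_min; case: (s < t); case: (s < r); rewrite ?mul1r ?mul0r//.
  ring.
have e2 : k * \int[leb]_s (heav (t - s) * a s) =
    \int[leb]_s (heav (t - s) * U s f x) + a t - resolvent U k f x.
  rewrite e1 (Rint_Fubini mF bF ia ib) -RintZ; last first.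
    apply: (integ_dom (meas_Rint1 mF bF ia ib) _ (integZ (\int[leb]_s (expR (k * t) * (expR t * (heav s * expR (- (1 * s)))))) ib)) => r.
    rewrite mulrC -RintZ//; apply: (Rint_le_norm _ _ (integZ _ ia)).
      exact: (measurable_fun_pair1 r mF).
    by move=> s; rewrite mulrC; exact: bF.
  rewrite /a U_res// /resolvent -RintD// -RintB//; last by apply: integD.
  apply: (Rint_point (a := t)).
  - under eq_fun do rewrite inner; apply: measurable_funM; first exact: exp_meas_s.
    apply: measurable_funB => //.
    have mm : measurable_fun setT (fun r : TR => Num.min t r : R) by exact: measurable_minr.
    exact: (measurableT_comp (meas_expZ k) mm).
  - exact: (integ_meas (integB (integD iFt ir) ip)).
  - move=> r rt; rewrite inner; have [h|h] := ltP t r.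
      rewrite [heav (t - r)]heav0 ?subr_le0 1?ltW// heav1 ?subr_gt0// mul0r add0r mul1r.
      by rewrite !mulrBr opprB expRD; ring.
    have rt' : r < t by rewrite lt_neqAle rt.
    rewrite heav1 ?subr_gt0// [heav (r - t)]heav0 ?subr_le0// mul1r mul0r addr0.
    by rewrite mulrBr mulr1 mulrAC -expRD addNr expR0 mul1r.
have -> : \int[leb]_s (heav (t - s) * U s (fun y => k * resolvent U k f y - f y) x) =
    \int[leb]_s (k * (heav (t - s) * a s) - heav (t - s) * U s f x).
  apply: eq_Rintegral => s _; rewrite (sfunB (opfam_sfun oU _ _))//; last exact: BbZ.
  by rewrite (sfunZ (opfam_sfun oU _ _))// /a; ring.
have ia' := fin_integ t x BR.
rewrite RintB//; last exact: integZ.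
rewrite RintZ// e2 -/(a t); ring.
Qed.

End Resolvent.
End Generator.

(** * The generator of the perturbed semigroup *)

Section PerturbedGenerator.
Context (R : realType) (d : nat).
Notation V := (V R d).
Notation Vb := (Vb R d).
Notation leb := (@lebesgue_measure R).
Notation TR := (measurableTypeR R).
Notation fam := (R -> (V -> R) -> V -> R).
Variables (H : R -> (V -> R) -> Prop) (rH : regspace H).
Variables (CB : R) (B : (V -> R) -> V -> R) (pB : pertop H CB B).
Variables (M lam : R) (T : fam) (oT : opfam M lam T) (lam0 : 0 <= lam) (psi : R -> R).
Hypothesis T_sg : forall (t s : R) (f : V -> R), 0 < t -> 0 < s -> Bb f -> T (t + s) f = T t (T s f).
Hypothesis T_0 : forall (f : V -> R) (x : V) (r : nat -> R), Cb f -> (forall n, 0 < r n) ->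
  r n @[n --> \oo] --> 0 -> T (r n) f x @[n --> \oo] --> f x.
Hypothesis T_H : forall (s : R) (f : V -> R) (c : R),
  Bb f -> (forall x, `|f x| <= c) -> H (psi s * c) (T s f).
Hypothesis ipsi : integ leb (expweight lam psi).
Hypothesis CB0 : 0 <= CB.

Notation psiK := (fun s => CB * psi s).
Notation K := (Kfam B T).
Notation q := (\int[leb]_s expweight lam psiK s).
Hypothesis q1 : q < 1.
Notation S := (vsol T K).

Let iK : inputfam psiK K := Kfam_input rH pB oT T_sg T_0 T_H.

Lemma psi_ge0 s : 0 <= psi s.
Proof.
have h1 (x : V) : `|(fun _ : V => 1 : R) x| <= 1 by rewrite normr1.
by have := reg_bnd rH (T_H s (Bb_cst d 1) h1) 0; rewrite mulr1; exact: le_trans.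
Qed.

Lemma ipsiK : integ leb (expweight lam psiK).
Proof.
rewrite (_ : expweight lam psiK = fun s => CB * expweight lam psi s); first exact: integZ.
by apply/funext => s; rewrite /expweight; ring.
Qed.

Let ipK := ipsiK.
Let oS := vsol_opfam oT iK ipK q1.
Notation A := (M / (1 - q)).

(** Only the weighted [psi] is known to be integrable over the line. On a bounded time interval the
    weight can be removed at the cost of [expR (lam * s)]. *)
Lemma psi_heav_bnd s r : `|heav (s - r)| * psi r <= expR (lam * s) * expweight lam psi r.
Proof.
rewrite ger0_norm ?heav_ge0//; have [sr|sr] := ltP 0 (s - r); last first.
  by rewrite heav0// mul0r !mulr_ge0 ?expR_ge0// psi_ge0.
rewrite heav1// mul1r /expweight mulrA ler_peMl ?psi_ge0// -expRD expR_ge1//.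
by rewrite -mulrBr mulr_ge0// ltW.
Qed.

Lemma heav_T_reg s f c : Bb f -> (forall x, `|f x| <= c) ->
  [/\ measurable_fun setT (fun p : TR * Vb => heav (s - p.1) * T p.1 f p.2),
      forall r, H (`|heav (s - r)| * (psi r * c)) (fun y => heav (s - r) * T r f y) &
      integ leb (fun r => `|heav (s - r)| * (psi r * c))].
Proof.
move=> Bf fc; split.
- apply: measurable_funM; last exact: (opfam_meas oT).
  exact: (measurableT_comp (meas_heav_l s) (@measurable_fst _ _ TR Vb)).
- by move=> r; apply: (regZ rH); exact: T_H.
- have c0 : 0 <= c by rewrite (le_trans _ (fc 0)).
  have m : measurable_fun setT (fun r : TR => `|heav (s - r)| * (psi r * c)).
    have -> : (fun r => `|heav (s - r)| * (psi r * c)) =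
       (fun r => heav (s - r) * c * expR (lam * r) * expweight lam psi r).
      apply/funext => r; rewrite ger0_norm ?heav_ge0// /expweight.
      transitivity (heav (s - r) * c * psi r * (expR (lam * r) * expR (- (lam * r)))); last ring.
      by rewrite -expRD subrr expR0; ring.
    apply: measurable_funM; last exact: integ_meas ipsi.
    apply: measurable_funM; last exact: meas_expZ.
    by apply: measurable_funM => //; exact: meas_heav_l.
  apply: (integ_dom m _ (integZ (c * expR (lam * s)) ipsi)) => r.
  rewrite normrM normr_id [`|psi r * c|]ger0_norm ?mulr_ge0// ?psi_ge0//.
  by rewrite mulrA mulrC -mulrA ler_wpM2l// psi_heav_bnd.
Qed.

(** [B] is applied to the generator identity, in which [T s u] is [u] plus the integral of [T r f];
    that integral lies in [H] because [psi] is integrable on bounded time intervals. *)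
Lemma K_gen u f c s y : gen T u f -> H c u ->
  K s u y = heav s * B u y + \int[leb]_r (heav (s - r) * K r f y).
Proof.
move=> [Bu Bf gT] Hu; have [_ [cf fc]] := Bf.
have [s0|s0] := leP s 0.
  rewrite (input_le0 iK)// heav0// mul0r add0r -[LHS](@Rint0 _ _ _ leb); apply: eq_Rintegral => r _.
  have [r0|r0] := leP r 0; first by rewrite (input_le0 iK)// mulr0.
  by rewrite heav0 ?mul0r//; rewrite subr_le0 ltW// (le_lt_trans s0).
rewrite heav1// mul1r (KfamE rH pB oT).
have [mh Hh ih] := heav_T_reg s Bf fc.
have -> : T s u = (fun y => 1 * u y + \int[leb]_r (heav (s - r) * T r f y)).
  by apply/funext => z; rewrite -gT// mul1r addrCA subrr addr0.
rewrite (pert_lin rH pB 1 y Hu (reg_int rH mh Hh ih)) mul1r; congr (_ + _).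
have [_ ->] := pert_int rH pB mh Hh ih y.
apply: eq_Rintegral => r _.
by rewrite (pertZ rH pB _ _ (T_H r Bf fc)) (KfamE rH pB oT).
Qed.

(** Substituting [K_gen] in the Duhamel integral leaves the integral of [S (t - s) (B u)] and a
    double integral of [S (t - s) (K r f)] over [r < s < t]. A change of variable and Fubini
    identify the latter with the time integral of [conv S K s f], that is of [S s f - T s f]; the
    part in [T] cancels against the generator identity of [T]. *)
Lemma gen_sound u f c : gen T u f -> H c u -> gen S u (fun x => f x + B u x).
Proof.
move=> gTu Hu; have [Bu Bf gT] := gTu; have [_ [cf fc]] := Bf.
have BBu := pert_Bb rH pB Hu.
split => //; first exact: BbD.
move=> t x t0; have A0 : 0 <= A := opfam_C0 oS.
have M0 := opfam_C0 oT.
have q1i : 0 <= (1 - q)^-1 by rewrite invr_ge0 subr_ge0 ltW.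
have cf0 : 0 <= cf by rewrite (le_trans _ (fc 0)).
have w0 r : 0 <= expweight lam psiK r by exact: (expweight_ge0 _ iK).
have iF1 := fin_integ oS lam0 t x BBu.
have iF2 := fin_integ oS lam0 t x Bf.
have iF3 := fin_integ oT lam0 t x Bf.
have mcomp (phi : TR * TR -> R) : measurable_fun setT phi ->
    measurable_fun setT (fun p : TR * TR => S (phi p) (K p.2 f) x).
  move=> mphi.
  have m1 : measurable_fun setT (fun p : TR * TR => (((phi p + p.2, x), p.2) : (TR * Vb) * TR)).
    apply: measurable_fun_pair; last exact: measurable_snd.
    apply: measurable_fun_pair => //.
    by apply: measurable_funD => //; exact: meas_TRsnd.
  have := measurableT_comp (comp_meas oS iK Bf) m1; rewrite /comp/=.
  by under eq_fun do rewrite addrK.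
pose W (s r : TR) : R := heav (s - r) * S (t - s) (K r f) x.
pose W2 (s r : TR) : R := heav (t - s) * S (s - r) (K r f) x.
have mW : measurable_fun setT (fun p => W p.1 p.2).
  apply: measurable_funM.
    by apply: meas_heav_comp; apply: measurable_funB; [exact: meas_TRfst|exact: meas_TRsnd].
  by apply: (mcomp (fun p => t - p.1)); apply: measurable_funB => //; exact: meas_TRfst.
have mW2 : measurable_fun setT (fun p => W2 p.1 p.2).
  apply: measurable_funM.
    by apply: meas_heav_comp; apply: measurable_funB => //; exact: meas_TRfst.
  by apply: (mcomp (fun p => p.1 - p.2)); apply: measurable_funB; [exact: meas_TRfst|exact: meas_TRsnd].
have SK0 a r z : r <= 0 -> S a (K r f) z = 0.
  move=> r0; rewrite (_ : K r f = fun=> 0) ?(sfun0 (opfam_sfun oS _ _))//.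
  by apply/funext => y; exact: (input_le0 iK).
have lexp s : s <= t -> expR (lam * s) <= expR (lam * t).
  by move=> st; rewrite ler_expR ler_wpM2l.
have SKb a r z : `|S a (K r f) z| <= A * expR (lam * a) * (psiK r * cf).
  by apply: (opfam_bnd oS _ _ (input_Bb iK r Bf)) => y; exact: (input_bnd iK).
have ia := integZ (expR t) (exp_halfline ltr01).1.
have ib := integZ (A * expR (lam * t) * expR (lam * t) * cf) ipK.
have wE s r : 0 < r -> r < s -> s <= t -> psiK r * cf <= expR (lam * t) * expweight lam psiK r * cf.
  move=> r0 rs st; rewrite ler_wpM2r// /expweight mulrA ler_peMl//.
    by rewrite (sfun_C0 (input_sfun iK r 0)).
  rewrite -expRD expR_ge1// -mulrBr mulr_ge0// subr_ge0 ltW//; exact: lt_le_trans rs st.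
have rhs0 s r : 0 <= expR t * (heav s * expR (- (1 * s))) *
    (A * expR (lam * t) * expR (lam * t) * cf * expweight lam psiK r).
  by rewrite !mulr_ge0 ?expR_ge0 ?heav_ge0 ?w0 ?psi_ge0.
(* A product majorant common to both forms of the double integral: the factor in [s] dominates the
   indicator of [(0, t)], the factor in [r] carries [psiK]. *)
have prod_bnd s r a (z : R) : 0 < r -> r < s -> s < t -> a <= t ->
   `|z| <= A * expR (lam * a) * (psiK r * cf) ->
   `|z| <= expR t * (heav s * expR (- (1 * s))) *
    (A * expR (lam * t) * expR (lam * t) * cf * expweight lam psiK r).
  move=> r0 rs st at' zb; apply: (le_trans zb).
  apply: (@le_trans _ _ (1 * (A * expR (lam * t) * expR (lam * t) * cf * expweight lam psiK r))); last first.
    rewrite ler_wpM2r ?mulr_ge0 ?expR_ge0 ?w0 ?psi_ge0//.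
    have s0 := lt_trans r0 rs.
    by rewrite heav1// mul1r -expRD expR_ge1// mul1r subr_ge0 ltW.
  rewrite mul1r; apply: (@le_trans _ _ (A * expR (lam * t) * (psiK r * cf))).
    rewrite ler_wpM2r ?mulr_ge0 ?psi_ge0// ler_wpM2l// lexp//.
  have := ler_wpM2l (mulr_ge0 A0 (expR_ge0 (lam * t))) (wE s r r0 rs (ltW st)).
  move/le_trans; apply.
  by rewrite le_eqVlt; apply/orP; left; apply/eqP; ring.
have bW s r : `|W s r| <= expR t * (heav s * expR (- (1 * s))) *
    (A * expR (lam * t) * expR (lam * t) * cf * expweight lam psiK r).
  rewrite /W; have [r0|r0] := leP r 0; first by rewrite SK0// mulr0 normr0.
  have [rs|rs] := ltP r s; last by rewrite heav0 ?subr_le0// mul0r normr0.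
  have [st|st] := ltP s t; last by rewrite (opfam_le0 oS) ?subr_le0// mulr0 normr0.
  rewrite [heav (s - r)]heav1 ?subr_gt0// mul1r.
  by apply: (prod_bnd s r (t - s)) => //; rewrite gerBl ltW// (lt_trans r0).
have bW2 s r : `|W2 s r| <= expR t * (heav s * expR (- (1 * s))) *
    (A * expR (lam * t) * expR (lam * t) * cf * expweight lam psiK r).
  rewrite /W2; have [r0|r0] := leP r 0; first by rewrite SK0// mulr0 normr0.
  have [rs|rs] := ltP r s; last by rewrite (opfam_le0 oS) ?subr_le0// mulr0 normr0.
  have [st|st] := ltP s t; last by rewrite heav0 ?subr_le0// mul0r normr0.
  rewrite [heav (t - s)]heav1 ?subr_gt0// mul1r.
  by apply: (prod_bnd s r (s - r)) => //; rewrite lerBlDr (le_trans (ltW st))// lerDl ltW.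
have iWr s : integ leb (W s).
  apply: (integ_dom (measurable_fun_pair2 s mW) (bW s)); exact: integZ.
have e1 s : S (t - s) (K s u) x = heav s * S (t - s) (B u) x + \int[leb]_r W s r.
  pose h (r : TR) (y : V) := heav (s - r) * K r f y.
  have mh : measurable_fun setT (fun p : TR * Vb => h p.1 p.2).
    apply: measurable_funM; last exact: (input_meas iK).
    exact: (measurableT_comp (meas_heav_l s) (@measurable_fst _ _ TR Vb)).
  have hb (r : TR) y : `|h r y| <= expR (lam * s) * CB * cf * expweight lam psi r.
    rewrite /h normrM; apply: (@le_trans _ _ (`|heav (s - r)| * (psiK r * cf))).
      by rewrite ler_wpM2l//; exact: (input_bnd iK).
    have := ler_wpM2l (mulr_ge0 CB0 cf0) (psi_heav_bnd s r).
    have -> : CB * cf * (`|heav (s - r)| * psi r) = `|heav (s - r)| * (psiK r * cf) by ring.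
    move/le_trans; apply.
    by rewrite le_eqVlt; apply/orP; left; apply/eqP; ring.
  have ih := integZ (expR (lam * s) * CB * cf) ipsi.
  have -> : K s u = (fun y => heav s * B u y + \int[leb]_r h r y).
    by apply/funext => y; rewrite (K_gen s y gTu Hu).
  rewrite (sfun_lin (opfam_sfun oS _ _)) ?BBu//; last exact: (Bb_Rint mh hb ih).
  congr (_ + _); have [_ ->] := sfun_Rint mh hb ih (opfam_sfun oS (t - s) x).
  apply: eq_Rintegral => r _; rewrite /h (sfunZ (opfam_sfun oS _ _))//.
  exact: (input_Bb iK).
have iC := comp_integ oS iK ipK t x Bu.
have iG1 : integ leb (fun s => heav s * S (t - s) (B u) x).
  by have := integ_refl t iF1; under eq_fun do rewrite subKr.
have iG2 : integ leb (fun s => \int[leb]_r W s r).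
  have := integB iC iG1; rewrite /integ; congr (_.-integrable _ _).
  by apply/funext => s /=; rewrite e1 addrAC subrr add0r.
have e2 : conv S K t u x = \int[leb]_s (heav (t - s) * S s (B u) x) + \int[leb]_s \int[leb]_r W s r.
  transitivity (\int[leb]_s (heav s * S (t - s) (B u) x + \int[leb]_r W s r)).
    by apply: eq_Rintegral => s _; exact: e1.
  rewrite RintD//; congr (_ + _).
  rewrite -[RHS](Rint_refl t (integ_meas iF1)).
  by apply: eq_Rintegral => s _; rewrite subKr.
have e3 : \int[leb]_s \int[leb]_r W s r = \int[leb]_s (heav (t - s) * conv S K s f x).
  rewrite (Rint_Fubini mW bW ia ib).
  transitivity (\int[leb]_r \int[leb]_s W2 s r).
    apply: eq_Rintegral => r _.
    have mWr : measurable_fun setT (fun s : TR => W s r) by exact: (measurable_fun_pair1 r mW).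
    (* Replacing [s] by [t + r - s] preserves the region [r < s < t] and exchanges [t - s] with
       [s - r]. *)
    rewrite -[LHS](Rint_refl (t + r) mWr).
    apply: eq_Rintegral => s _; rewrite /W /W2.
    by congr (heav _ * S _ _ _); ring.
  rewrite -(Rint_Fubini mW2 bW2 ia ib); apply: eq_Rintegral => s _.
  by rewrite /W2 /conv RintZ//; exact: (comp_integ oS iK ipK).
rewrite (vsol_eq oT iK ipK q1)// addrAC gT// e2 e3.
have -> : \int[leb]_s (heav (t - s) * conv S K s f x) =
   \int[leb]_s (heav (t - s) * S s f x) - \int[leb]_s (heav (t - s) * T s f x).
  rewrite -RintB//; apply: eq_Rintegral => s _.
  by rewrite (vsol_eq oT iK ipK q1)//; ring.
have -> : \int[leb]_s (heav (t - s) * S s (fun y => f y + B u y) x) =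
   \int[leb]_s (heav (t - s) * S s f x) + \int[leb]_s (heav (t - s) * S s (B u) x).
  rewrite -RintD//; apply: eq_Rintegral => s _.
  by rewrite (sfunD (opfam_sfun oS _ _))//; ring.
by ring.
Qed.

Lemma gen_sub (U : fam) C (oU : opfam C lam U) u1 u2 g1 g2 : gen U u1 g1 -> gen U u2 g2 ->
  gen U (fun x => u1 x - u2 x) (fun x => g1 x - g2 x).
Proof.
move=> [Bu1 Bg1 h1] [Bu2 Bg2 h2]; split; [exact: BbB|exact: BbB|move=> t x t0].
have i1 := fin_integ oU lam0 t x Bg1; have i2 := fin_integ oU lam0 t x Bg2.
transitivity (\int[leb]_s (heav (t - s) * U s g1 x - heav (t - s) * U s g2 x)).
  by rewrite RintB// -h1// -h2// (sfunB (opfam_sfun oU _ _))//; ring.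
by apply: eq_Rintegral => s _; rewrite (sfunB (opfam_sfun oU _ _))//; ring.
Qed.

Notation Ipsi := (\int[leb]_s expweight lam psi s).

Lemma qE : q = CB * Ipsi.
Proof.
rewrite -RintZ//; apply: eq_Rintegral => s _; rewrite /expweight; ring.
Qed.

Section LargeParameter.
Variable (k : R) (lk : lam < k).
Notation Rk := (resolvent T k).

(** For [lam < k] the factor [expR (- (k * s))] is below the weight at positive times, so the
    Laplace transform of [psi] at [k] is at most [Ipsi]. Hence [B Rk] has norm at most [q], the
    contraction constant of the Volterra equation. *)
Lemma res_reg f c : Bb f -> (forall x, `|f x| <= c) -> H (c * Ipsi) (Rk f).
Proof.
move=> Bf fc; have c0 : 0 <= c by rewrite (le_trans _ (fc 0)).
pose a (s : TR) : R := heav s * (expR (- (k * s)) * (psi s * c)).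
have aE s : a s = c * (heav s * expR (- (k * s)) * expR (lam * s)) * expweight lam psi s.
  rewrite /a /expweight; transitivity (heav s * (expR (- (k * s)) * (psi s * c)) * (expR (lam * s) * expR (- (lam * s)))); last ring.
  by rewrite -expRD subrr expR0 mulr1.
have ale s : `|a s| <= c * expweight lam psi s.
  have a0 : 0 <= a s by rewrite !mulr_ge0 ?heav_ge0 ?expR_ge0 ?psi_ge0.
  rewrite ger0_norm// aE ler_wpM2r ?mulr_ge0 ?expR_ge0 ?psi_ge0//.
  rewrite ler_piMr// -mulrA; have [s0|s0] := leP s 0; first by rewrite heav0// mul0r.
  rewrite heav1// mul1r -expRD -[leRHS]expR0 ler_expR.
  by rewrite addrC -mulrBl mulr_le0_ge0 ?ltW// subr_lt0.
have ma : measurable_fun setT a.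
  have -> : a = (fun s => c * (heav s * expR (- (k * s)) * expR (lam * s)) * expweight lam psi s).
    by apply/funext => s; exact: aE.
  apply: measurable_funM; last exact: integ_meas ipsi.
  apply: measurable_funM => //; apply: measurable_funM; last exact: meas_expZ.
  by apply: measurable_funM; [exact: meas_heav|exact: meas_expN].
have iac := integZ c ipsi.
have ia := integ_dom ma ale iac.
have Ha s : H (a s) (fun y => expR (- (k * s)) * T s f y).
  have := regZ rH (expR (- (k * s))) (T_H s Bf fc); rewrite ger0_norm ?expR_ge0// /a => h.
  have [s0|s0] := leP s 0; last by rewrite heav1// mul1r.
  rewrite heav0// mul0r (_ : (fun _ => _) = fun=> 0); first exact: (reg0 rH).
  by apply/funext => y; rewrite (opfam_le0 oT)// mulr0.
apply: (reg_le rH _ (reg_int rH (exp_meas oT k Bf) Ha ia)).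
rewrite -RintZ//; apply: Rint_le => // s.
by rewrite (le_trans (ler_norm _)).
Qed.

Lemma Bres_bnd f c x : Bb f -> (forall x, `|f x| <= c) -> `|B (Rk f) x| <= q * c.
Proof.
by move=> Bf fc; rewrite qE -mulrA [Ipsi * c]mulrC; apply: (pert_bnd pB); exact: res_reg.
Qed.

Lemma Bres_sub f g x : Bb f -> Bb g ->
  B (Rk (fun y => f y - g y)) x = B (Rk f) x - B (Rk g) x.
Proof.
move=> Bf Bg; have [_ [cf fc]] := Bf; have [_ [cg gc]] := Bg.
have -> : Rk (fun y => f y - g y) = (fun y => (-1) * Rk g y + Rk f y).
  apply/funext => y; rewrite /resolvent -Rint_linear; [|exact: (exp_integ oT)..].
  by apply: eq_Rintegral => s _; rewrite (sfunB (opfam_sfun oT _ _))//; ring.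
by rewrite (pert_lin rH pB _ _ (res_reg Bg gc) (res_reg Bf fc)); ring.
Qed.

Lemma Bres_Bb f : Bb f -> Bb (B (Rk f)).
Proof. by move=> Bf; have [_ [c fc]] := Bf; exact: (pert_Bb rH pB (res_reg Bf fc)). Qed.

Fixpoint neumann (h : V -> R) (n : nat) : V -> R :=
  if n is n'.+1 then fun x => h x + B (Rk (neumann h n')) x else h.

(** The partial sums of the series inverting [1 - B Rk] converge uniformly, since [B Rk] has norm at
    most [q < 1]. *)
Lemma neumann_solution h : Bb h -> exists2 f, Bb f & forall x, f x = h x + B (Rk f) x.
Proof.
move=> Bh; have [_ [c hc]] := Bh.
have q01 := contraction_const iK q1.
have c0 : 0 <= c by rewrite (le_trans _ (hc 0)).
have Bn n : Bb (neumann h n) by elim: n => // n IH; apply: BbD => //; exact: Bres_Bb.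
have dn n x : `|neumann h n.+1 x - neumann h n x| <= q * c * q ^+ n.
  elim: n x => [|n IH] x.
    by rewrite expr0 mulr1 /= addrAC subrr add0r; exact: Bres_bnd.
  have -> : neumann h n.+2 x - neumann h n.+1 x =
      B (Rk (neumann h n.+1)) x - B (Rk (neumann h n)) x by rewrite /=; ring.
  rewrite -Bres_sub// exprS mulrCA; apply: Bres_bnd; [exact: BbB|exact: IH].
pose f x := limn (fun n => neumann h n x).
pose E := q * c / (1 - q).
have nf n x : `|neumann h n x - f x| <= E * q ^+ n.
  exact: (geometric_cauchy q01 (fun n => dn n x)).
have E0 : 0 <= E by have := nf 0%N 0; rewrite expr0 mulr1; exact: le_trans.
have cE := cvg_geo q01.
have cf x : neumann h n x @[n --> \oo] --> f x by exact: (cvg_seq0_le (nf ^~ x) (cE E)).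
have qn n : q ^+ n <= 1 by case/andP: q01 => q0 /ltW ?; exact: exprn_ile1.
have nb n x : `|neumann h n x| <= E + E + c.
  have -> : neumann h n x = (neumann h n x - f x) - (neumann h 0 x - f x) + h x by rewrite /=; ring.
  apply: (le_trans (ler_normD _ _)); rewrite lerD//.
  apply: (le_trans (ler_normB _ _)); rewrite lerD//.
    by rewrite (le_trans (nf n x))// ler_piMr.
  by rewrite (le_trans (nf 0%N x))// ler_piMr.
have Bf : Bb f by exact: (Bb_lim Bn nb cf).
exists f => // x.
have h1 : neumann h n.+1 x @[n --> \oo] --> f x.
  by rewrite (cvg_shiftS (fun n => neumann h n x)); exact: cf.
apply: (cvgn_unique h1).
apply: (@cvg_seq0_le _ _ (fun n => q * E * q ^+ n)); last exact: cE.
move=> n /=; have -> : forall a b e : R, a + b - (a + e) = b - e by move=> *; ring.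
by rewrite -Bres_sub// -mulrA; apply: Bres_bnd; [exact: BbB|move=> y; exact: nf].
Qed.

(** If [f = h + B Rk f], then [v = Rk f] satisfies [k v - A v = f], hence
    [(k - A - B) v = f - B Rk f = h]. *)
Lemma perturbed_resolvent h : Bb h -> exists v g c,
  [/\ H c v, gen T v g, gen S v (fun x => k * v x - h x) & forall x, g x + B v x = k * v x - h x].
Proof.
move=> Bh; have [f Bf fE] := neumann_solution Bh; have [_ [c fc]] := Bf.
have Hv := res_reg Bf fc.
have gT := res_gen oT lam0 T_sg lk Bf.
have e : (fun x => k * Rk f x - f x + B (Rk f) x) = (fun x => k * Rk f x - h x).
  by apply/funext => x; rewrite fE; ring.
exists (Rk f), (fun x => k * Rk f x - f x), (c * Ipsi); split => //.
  by rewrite -e; exact: gen_sound gT Hv.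
by move=> x; move/(congr1 (@^~ x)) : e.
Qed.

End LargeParameter.

Let lk1 : lam < lam + 1. Proof. by rewrite ltrDl. Qed.

(** Every element of the domain is a value of the resolvent, because [k] minus the generator is
    injective, and values of the resolvent lie in [H]. This inclusion of the domain in the smooth
    class gives [B u] its meaning. *)
Lemma gen_reg u f : gen T u f -> exists c, H c u.
Proof.
move=> gT; have [Bu Bf _] := gT.
pose g x := (lam + 1) * u x - f x.
have Bg : Bb g by apply: BbB => //; exact: BbZ.
have [_ [c gc]] := Bg.
have gv := res_gen oT lam0 T_sg lk1 Bg.
have w0 : forall x, u x - resolvent T (lam + 1) g x = 0.
  apply: (gen_eigen0 oT lam0 lk1); have := gen_sub oT gT gv.
  by congr (gen _ _ _); apply/funext => x; rewrite /g; ring.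
exists (c * Ipsi); rewrite (_ : u = resolvent T (lam + 1) g); first exact: res_reg.
by apply/funext => x; apply/eqP; rewrite -subr_eq0 w0.
Qed.

Lemma gen_complete u g : gen S u g ->
  exists2 f, gen T u f & forall x, g x = f x + B u x.
Proof.
move=> gS; have [Bu Bg _] := gS.
pose h x := (lam + 1) * u x - g x.
have Bh : Bb h by apply: BbB => //; exact: BbZ.
have [v [f [c [Hv gT gSv e]]]] := perturbed_resolvent lk1 Bh.
have w0 : forall x, u x - v x = 0.
  apply: (gen_eigen0 oS lam0 lk1); have := gen_sub oS gS gSv.
  by congr (gen _ _ _); apply/funext => x; rewrite /h; ring.
have uv : u = v by apply/funext => x; apply/eqP; rewrite -subr_eq0 w0.
exists f; first by rewrite uv.
by move=> x; rewrite uv e /h uv; ring.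
Qed.

Theorem perturbed_gen u g : gen S u g <->
  exists2 f, gen T u f & g = (fun x => f x + B u x).
Proof.
split=> [/gen_complete[f gT e]|[f gT ->]]; first by exists f => //; apply/funext.
by have [c Hu] := gen_reg gT; exact: gen_sound gT Hu.
Qed.

End PerturbedGenerator.

(** * Stability and positivity *)

Section Positivity.
Context (R : realType) (d : nat).
Notation V := (V R d).
Notation leb := (@lebesgue_measure R).
Notation TR := (measurableTypeR R).
Notation fam := (R -> (V -> R) -> V -> R).
Variables (M lam : R) (T : fam) (oT : opfam M lam T) (lam0 : 0 <= lam).

(** * Dependence of the solution on the perturbation *)

Section Stability.
Variables (psi1 psi2 : R -> R) (K1 K2 : fam) (i1 : inputfam psi1 K1) (i2 : inputfam psi2 K2).
Hypotheses (ip1 : integ leb (expweight lam psi1)) (ip2 : integ leb (expweight lam psi2)).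
Notation q1 := (\int[leb]_s expweight lam psi1 s).
Notation q2 := (\int[leb]_s expweight lam psi2 s).
Hypotheses (q1_lt1 : q1 < 1) (q2_lt1 : q2 < 1).
Variables (e : R) (psi : R -> R) (ipsi : integ leb (expweight lam psi)).
Hypothesis e0 : 0 <= e.
Hypothesis psi_ge0 : forall s, 0 <= psi s.
Hypothesis K12 : forall s f c x, Bb f -> (forall x, `|f x| <= c) ->
  `|K1 s f x - K2 s f x| <= e * psi s * c.
Notation S1 := (vsol T K1).
Notation S2 := (vsol T K2).
Notation A1 := (M / (1 - q1)).
Notation A2 := (M / (1 - q2)).

(** The difference satisfies [S1 - S2 = conv S1 (K1 - K2) + conv (S1 - S2) K2]: a source of size
    [e], and a contraction with constant [q2]. *)
Lemma vsol_stable t f c x : Bb f -> (forall x, `|f x| <= c) ->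
  `|S1 t f x - S2 t f x| <= e * (A1 * (\int[leb]_s expweight lam psi s) / (1 - q2)) * (expR (lam * t) * c).
Proof.
move=> Bf fc.
have o1 := vsol_opfam oT i1 ip1 q1_lt1; have o2 := vsol_opfam oT i2 ip2 q2_lt1.
have q01 := contraction_const i2 q2_lt1.
have A10 := opfam_C0 o1; have A20 := opfam_C0 o2.
set I := \int[leb]_s expweight lam psi s.
have I0 : 0 <= I by apply: Rintegral_ge0 => s _; rewrite mulr_ge0 ?expR_ge0.
pose eta := e * (A1 * I).
pose P D := forall t f c x, Bb f -> (forall x, `|f x| <= c) ->
   `|S1 t f x - S2 t f x| <= D * expR (lam * t) * c.
have PD0 : P (A1 + A2).
  move=> t' f' c' x' Bf' fc'; apply: (le_trans (ler_normB _ _)); rewrite !mulrDl lerD//.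
    exact: (opfam_bnd o1).
  exact: (opfam_bnd o2).
have Pi D : 0 <= D -> P D -> P (q2 * D + eta).
  move=> D0 PD t' f' c' x' Bf' fc'.
  rewrite (vsol_eq oT i1 ip1 q1_lt1)// (vsol_eq oT i2 ip2 q2_lt1)//.
  have -> : forall a b b' : R, a + b - (a + b') = b - b' by move=> *; ring.
  have j1 := comp_integ o1 i1 ip1 t' x' Bf'; have j2 := comp_integ o2 i2 ip2 t' x' Bf'.
  rewrite /conv -RintB//.
  have bnd (s : TR) : `|S1 (t' - s) (K1 s f') x' - S2 (t' - s) (K2 s f') x'| <=
     (A1 * e * expR (lam * t') * c') * expweight lam psi s + (D * expR (lam * t') * c') * expweight lam psi2 s.
    have B1 := input_Bb i1 s Bf'; have B2 := input_Bb i2 s Bf'.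
    have -> : S1 (t' - s) (K1 s f') x' - S2 (t' - s) (K2 s f') x' =
      S1 (t' - s) (fun y => K1 s f' y - K2 s f' y) x' + (S1 (t' - s) (K2 s f') x' - S2 (t' - s) (K2 s f') x').
      by rewrite (sfunB (opfam_sfun o1 _ _))//; ring.
    apply: (le_trans (ler_normD _ _)); rewrite lerD//.
      apply: (le_trans (opfam_bnd o1 (t' - s) x' (BbB B1 B2) (fun y => K12 s y Bf' fc'))).
      by rewrite mulrBr expRD /expweight le_eqVlt; apply/orP; left; apply/eqP; ring.
    apply: (le_trans (PD (t' - s) (K2 s f') (psi2 s * c') x' B2 (fun y => input_bnd i2 s y Bf' fc'))).
    by rewrite mulrBr expRD /expweight le_eqVlt; apply/orP; left; apply/eqP; ring.
  apply: (le_trans (Rint_le_norm _ bnd (integD (integZ _ ipsi) (integZ _ ip2)))).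
    exact: integ_meas (integB j1 j2).
  rewrite RintD; [|exact: integZ..]; rewrite !RintZ// -/I.
  rewrite le_eqVlt; apply/orP; left; apply/eqP; rewrite /eta.
  set z := M / _; ring.
have eta0 : 0 <= eta by rewrite mulr_ge0// mulr_ge0.
have D00 : 0 <= A1 + A2 by rewrite addr_ge0.
have HP := contraction_principle q01 D00 eta0 PD0 Pi.
have ec : 0 <= expR (lam * t) * c by rewrite mulr_ge0 ?expR_ge0// (le_trans _ (fc 0)).
have -> : e * (A1 * I / (1 - q2)) = eta / (1 - q2) by rewrite /eta !mulrA.
apply: (contraction_limit (A := (A1 + A2) * (expR (lam * t) * c)) q01) => n.
have [D PD Dn] := HP n; apply: (le_trans (PD t f c x Bf fc)).
rewrite -mulrA; apply: (le_trans (ler_wpM2r ec Dn)).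
by rewrite le_eqVlt; apply/orP; left; apply/eqP; rewrite mulrDl mulrAC.
Qed.

End Stability.

(** * Contractivity and positivity through the shifted equation *)

Section ShiftedDuhamel.
Variables (psi : R -> R) (K : fam) (iK : inputfam psi K).
Hypothesis ipsi : integ leb (expweight lam psi).
Notation q := (\int[leb]_s expweight lam psi s).
Hypothesis q1 : q < 1.
Hypothesis T_sg : forall (t s : R) (f : V -> R), 0 < t -> 0 < s -> Bb f -> T (t + s) f = T t (T s f).
Hypothesis K_T : forall (s r : R) (f : V -> R), 0 < s -> 0 < r -> Bb f -> K (r + s) f = K r (T s f).
Notation S := (vsol T K).
Let oS := vsol_opfam oT iK ipsi q1.
Notation A := (M / (1 - q)).

Lemma SK0 t r f x : r <= 0 -> S t (K r f) x = 0.
Proof.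
move=> r0; rewrite (_ : K r f = fun=> 0) ?(sfun0 (opfam_sfun oS _ _))//.
by apply/funext => y; rewrite (input_le0 iK).
Qed.

(** Letting [T] run up to time [s] and [S] afterwards removes from the Duhamel integral the
    perturbations before [s]; the others are matched by [K r T(s) = K (r + s)]. *)
Lemma S_T_shift t s f x : 0 < s -> s < t -> Bb f ->
  S (t - s) (T s f) x = T t f x + \int[leb]_r (heav (r - s) * S (t - r) (K r f) x).
Proof.
move=> s0 st Bf; have ts : 0 < t - s by rewrite subr_gt0.
rewrite (vsol_eq oT iK ipsi q1); last exact: (opfam_Bb oT).
rewrite -T_sg// subrK; congr (_ + _).
have mF : measurable_fun setT (fun r : TR => heav (r - s) * S (t - r) (K r f) x).
  apply: measurable_funM; first exact: meas_heav_r.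
  exact: (comp_meas_s oS iK).
rewrite -(Rint_shift s mF); apply: eq_Rintegral => r _; rewrite addrK.
have -> : t - s - r = t - (r + s) by ring.
have [r0|r0] := leP r 0; first by rewrite SK0// heav0// mul0r.
by rewrite heav1// mul1r K_T.
Qed.

(* [S] also solves the Duhamel equation of the pair [(A - c, B + c)]. *)
Lemma shifted_duhamel c t f x : 0 < c -> 0 < t -> Bb f ->
  let g s := heav s * (heav (t - s) *
    S (t - s) (fun y => expR (- (c * s)) * (K s f y + c * T s f y)) x) in
  integ leb g /\ S t f x = expR (- (c * t)) * T t f x + \int[leb]_s g s.
Proof.
move=> c0 t0 Bf g; have [_ [cf fc]] := Bf.
have cf0 : 0 <= cf by rewrite (le_trans _ (fc 0)).
pose phi r := S (t - r) (K r f) x.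
have iphi : integ leb phi := comp_integ oS iK ipsi t x Bf.
have mphi := integ_meas iphi.
pose w (s : TR) : R := heav (t - s) * (heav s * expR (- c * s)).
have w0 s : 0 <= w s by rewrite !mulr_ge0 ?heav_ge0 ?expR_ge0.
have E1 s : 0 <= s -> expR (- c * s) <= 1.
  by move=> s0; rewrite -[leRHS]expR0 ler_expR mulNr oppr_le0 mulr_ge0// ltW.
have wb s : `|w s| <= expR t * (heav s * expR (- (1 * s))).
  rewrite ger0_norm//; apply: le_trans (heav2_le t s).
  rewrite /w ler_wpM2l ?heav_ge0//; have [s0|s0] := leP s 0; first by rewrite heav0// mul0r.
  by rewrite heav1// mul1r E1// ltW.
have mw : measurable_fun setT w.
  apply: measurable_funM; first exact: meas_heav_l.
  by apply: measurable_funM; [exact: meas_heav|exact: meas_expZ].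
have ie := integZ (expR t) (exp_halfline (@ltr01 R)).1.
have iw := integ_dom mw wb ie.
have iphiN : integ leb (fun r => `|phi r|) by exact: (integrable_norm iphi).
pose F (s r : TR) : R := w s * (heav (r - s) * phi r).
have mF : measurable_fun setT (fun p => F p.1 p.2).
  apply: measurable_funM; first exact: (measurableT_comp mw (@measurable_fst _ _ TR TR)).
  apply: measurable_funM; last exact: (measurableT_comp mphi (@measurable_snd _ _ TR TR)).
  by apply: meas_heav_comp; apply: measurable_funB; [exact: meas_TRsnd|exact: meas_TRfst].
have bF s r : `|F s r| <= expR t * (heav s * expR (- (1 * s))) * `|phi r|.
  rewrite /F normrM; apply: ler_pM => //; rewrite normrM ler_piMl// heav_norm//.
have iEphi : integ leb (fun s => expR (- c * s) * phi s).
  have m : measurable_fun setT (fun s : TR => expR (- c * s) * phi s).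
    by apply: measurable_funM => //; exact: meas_expZ.
  apply: (integ_dom m _ iphiN) => s; rewrite normrM (ger0_norm (expR_ge0 _)).
  have [s0|s0] := leP s 0; first by rewrite /phi SK0// normr0 mulr0.
  by rewrite ler_piMl// E1// ltW.
have iIF : integ leb (fun s => \int[leb]_r F s r).
  apply: (integ_dom (meas_Rint2 mF bF ie iphiN) _ (integZ (\int[leb]_r `|phi r|) ie)) => s.
  rewrite mulrC -RintZ//; apply: (Rint_le_norm _ (bF s) (integZ _ iphiN)).
  exact: (measurable_fun_pair2 s mF).
have gE s : g s = expR (- c * s) * phi s + (c * T t f x * w s + c * \int[leb]_r F s r).
  have EF : \int[leb]_r F s r = w s * \int[leb]_r (heav (r - s) * phi r).
    rewrite -RintZ//; apply: (integ_dom _ _ iphiN).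
      by apply: measurable_funM => //; exact: meas_heav_r.
    by move=> r; rewrite normrM ler_piMl// heav_norm.
  rewrite EF /g /w; have [s0|s0] := leP s 0.
    by rewrite /phi SK0// (heav0 s0) !(mul0r, mulr0) !addr0.
  have [ts|ts] := leP t s.
    rewrite [heav (t - s)]heav0 ?subr_le0// !(mul0r, mulr0) !addr0.
    by rewrite /phi (opfam_le0 oS) ?subr_le0// mulr0.
  rewrite heav1// heav1 ?subr_gt0// !mul1r.
  have BK := input_Bb iK s Bf; have BT := opfam_Bb oT s Bf.
  have Bc : Bb (fun y => K s f y + c * T s f y) by apply: BbD => //; exact: BbZ.
  rewrite (sfunZ (opfam_sfun oS _ _) _ Bc) (sfunD (opfam_sfun oS _ _) BK); last exact: BbZ.
  rewrite (sfunZ (opfam_sfun oS _ _) _ BT) S_T_shift// mulNr -/(phi s).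
  rewrite (_ : \int[leb]_r (heav (r - s) * S (t - r) (K r f) x) = \int[leb]_r (heav (r - s) * phi r))//.
  ring.
have iG : integ leb (fun s => c * T t f x * w s + c * \int[leb]_r F s r).
  by apply: integD; exact: integZ.
split; first by rewrite (_ : g = fun s => expR (- c * s) * phi s + (c * T t f x * w s + c * \int[leb]_r F s r)); [exact: integD|exact/funext].
(* Integrating [c * expR (- c * s)] over [0 < s < r] gives [1 - expR (- c * r)], exactly what the
   direct term [expR (- c * r) * phi r] lacks to restore the unweighted Duhamel integral. *)
have inner (r : TR) : c * \int[leb]_s F s r = phi r - expR (- c * r) * phi r.
  have Fz : phi r = 0 -> c * \int[leb]_s F s r = phi r - expR (- c * r) * phi r.
    move=> p0; rewrite p0 mulr0 subrr (_ : \int[leb]_s F s r = 0) ?mulr0//.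
    rewrite -[RHS](@Rint0 _ _ _ leb); apply: eq_Rintegral => s _.
    by rewrite /F p0 !mulr0.
  have [r0|r0] := leP r 0; first by apply: Fz; rewrite /phi SK0.
  have [tr|tr] := leP t r; first by apply: Fz; rewrite /phi (opfam_le0 oS) ?subr_le0.
  have nc0 : - c != 0 by rewrite oppr_eq0 gt_eqF.
  have := Rint_exp_itv nc0 (ltW r0).
  set J := \int[leb]_s _ => eJ.
  have -> : \int[leb]_s F s r = phi r * J.
    rewrite /J -RintZ.
      apply: eq_Rintegral => s _; rewrite /F /w.
      have [rs|rs] := leP r s; first by rewrite [heav (r - s)]heav0 ?subr_le0// !(mul0r, mulr0).
      rewrite [heav (r - s)]heav1 ?subr_gt0// [heav (t - s)]heav1 ?subr_gt0 ?(lt_trans rs)//.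
      by rewrite !mul1r mulrC.
    apply: (integ_dom _ _ iw).
      apply: measurable_funM; first exact: meas_heav_l.
      by apply: measurable_funM; [exact: meas_heav|exact: meas_expZ].
    move=> s; rewrite /w normrM !(ger0_norm (mulr_ge0 _ _)) ?heav_ge0 ?expR_ge0//.
    rewrite (ger0_norm (heav_ge0 _)) ler_wpM2r ?mulr_ge0 ?heav_ge0 ?expR_ge0//.
    have [rs|rs] := leP r s; first by rewrite heav0 ?subr_le0// heav_ge0.
    by rewrite !heav1 ?subr_gt0// (lt_trans rs).
  have -> : c * (phi r * J) = - phi r * (- c * J) by ring.
  by rewrite eJ; ring.
have nc0 : - c != 0 by rewrite oppr_eq0 gt_eqF.
have eW : c * \int[leb]_s w s = 1 - expR (- c * t).
  have := Rint_exp_itv nc0 (ltW t0); rewrite -/w => e.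
  by rewrite -[LHS]opprK -mulNr e opprB.
rewrite (vsol_eq oT iK ipsi q1)//.
transitivity (expR (- (c * t)) * T t f x + (\int[leb]_s (expR (- c * s) * phi s) +
    (T t f x * (1 - expR (- c * t)) + \int[leb]_r (phi r - expR (- c * r) * phi r)))).
  rewrite RintB// /conv -/phi mulNr; ring.
congr (_ + _).
transitivity (\int[leb]_s (expR (- c * s) * phi s + (c * T t f x * w s + c * \int[leb]_r F s r))); last first.
  by apply: eq_Rintegral => s _; rewrite gE.
rewrite [RHS]RintD// [X in _ = _ + X]RintD; [|exact: integZ..].
rewrite !RintZ// (Rint_Fubini mF bF ie iphiN) -eW; congr (_ + (_ + _)); first ring.
rewrite -RintZ; first by apply: eq_Rintegral => r _; rewrite inner.
apply: (integ_dom (meas_Rint1 mF bF ie iphiN) _ (integZ (\int[leb]_s (expR t * (heav s * expR (- (1 * s))))) iphiN)) => r.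
rewrite mulrC -RintZ//; apply: (Rint_le_norm _ _ (integZ _ ie)).
  exact: (measurable_fun_pair1 r mF).
by move=> s; rewrite mulrC; exact: bF.
Qed.

Section Contraction.
Hypothesis T_pos : forall t f x, Bb f -> (forall x, 0 <= f x) -> 0 <= T t f x.
Hypothesis T_contr : forall t f c x, Bb f -> (forall x, `|f x| <= c) -> `|T t f x| <= c.
Variable (c : R) (c0 : 0 < c).
Hypothesis K_pos : forall s f x, 0 < s -> Bb f -> (forall x, 0 <= f x) -> 0 <= K s f x + c * T s f x.
Hypothesis K_contr : forall s f a x, 0 < s -> Bb f -> (forall x, `|f x| <= a) ->
  `|K s f x + c * T s f x| <= c * a.

(** In the shifted equation [(B + c) T(s)] is positive of norm at most [c], and [expR (- c * s)]
    plus the integral of [c * expR (- c * r)] over [(0, s)] is 1. Hence the pair of bounds,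
    [(1 + D) * a] on the modulus and [- (D * a)] from below, reproduces itself with [D] multiplied
    by [th < 1], for all times up to the fixed horizon [t]. *)
Lemma vsol_submarkov t f a x : 0 < t -> Bb f -> (forall x, `|f x| <= a) ->
  `|S t f x| <= a /\ ((forall x, 0 <= f x) -> 0 <= S t f x).
Proof.
move=> t0 Bf fa; have a0 : 0 <= a by rewrite (le_trans _ (fa 0)).
pose th := 1 - expR (- c * t).
have nc0 : - c != 0 by rewrite oppr_eq0 gt_eqF.
have th01 : 0 <= th < 1.
  by rewrite /th subr_ge0 -[leRHS]expR0 ler_expR mulNr oppr_le0 mulr_ge0 ?ltW//= gtrBl expR_gt0.
pose P D := forall s f a x, 0 < s <= t -> Bb f -> (forall x, `|f x| <= a) ->
  `|S s f x| <= (1 + D) * a /\ ((forall x, 0 <= f x) -> - (D * a) <= S s f x).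
have A0 := opfam_C0 oS.
have PD0 : P (A * expR (lam * t)).
  move=> s f' a' x' /andP[s0 st] Bf' fa'.
  have a'0 : 0 <= a' by rewrite (le_trans _ (fa' 0)).
  have h : `|S s f' x'| <= A * expR (lam * t) * a'.
    apply: (le_trans (opfam_bnd oS s x' Bf' fa')).
    by rewrite ler_wpM2r// ler_wpM2l// ler_expR ler_wpM2l.
  split; first by rewrite mulrDl mul1r (le_trans h)// lerDr.
  by move=> _; move: h; rewrite ler_norml => /andP[].
have Pi D : 0 <= D -> P D -> P (th * D + 0).
  move=> D0 PD s f' a' x' /andP[s0 st] Bf' fa'; rewrite addr0.
  have a'0 : 0 <= a' by rewrite (le_trans _ (fa' 0)).
  have [ig ->] := shifted_duhamel x' c0 s0 Bf'.
  set g := (fun s => _) in ig *.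
  pose w (r : TR) : R := heav (s - r) * (heav r * expR (- c * r)).
  have w0 r : 0 <= w r by rewrite !mulr_ge0 ?heav_ge0 ?expR_ge0.
  have mw : measurable_fun setT w.
    apply: measurable_funM; first exact: meas_heav_l.
    by apply: measurable_funM; [exact: meas_heav|exact: meas_expZ].
  have iw : integ leb w.
    apply: (integ_dom mw _ (integZ (expR s) (exp_halfline (@ltr01 R)).1)) => r.
    rewrite ger0_norm//; apply: le_trans (heav2_le s r).
    rewrite /w ler_wpM2l ?heav_ge0//; have [r0|r0] := leP r 0; first by rewrite heav0// mul0r.
    by rewrite heav1// mul1r -[leRHS]expR0 ler_expR mulNr oppr_le0 mulr_ge0// ltW.
  have eW : c * \int[leb]_r w r = 1 - expR (- c * s).
    have := Rint_exp_itv nc0 (ltW s0); rewrite -/w => e.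
    by rewrite -[LHS]opprK -mulNr e opprB.
  have Bg r : Bb (fun y => expR (- (c * r)) * (K r f' y + c * T r f' y)).
    by apply: BbZ; apply: BbD; [exact: (input_Bb iK)|apply: BbZ; exact: (opfam_Bb oT)].
  have gb r : 0 < r -> forall y, `|expR (- (c * r)) * (K r f' y + c * T r f' y)| <= c * expR (- c * r) * a'.
    move=> r0 y; rewrite normrM (ger0_norm (expR_ge0 _)).
    have -> : c * expR (- c * r) * a' = expR (- (c * r)) * (c * a') by rewrite mulNr; ring.
    by rewrite ler_wpM2l ?expR_ge0//; exact: K_contr.
  have thle : 1 - expR (- c * s) <= th.
    by rewrite /th lerD2l lerN2 ler_expR !mulNr lerN2 ler_wpM2l// ltW.
  have gup r : `|g r| <= (1 + D) * (c * a') * w r.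
    rewrite /g /w; have [r0|r0] := leP r 0.
      by rewrite (heav0 r0) mul0r normr0 mul0r !mulr0.
    have [sr|sr] := leP s r; first by rewrite [heav (s - r)]heav0 ?subr_le0// !(mul0r, mulr0) normr0.
    rewrite heav1// heav1 ?subr_gt0// !mul1r.
    have sr' : 0 < s - r <= t by rewrite subr_gt0 sr (le_trans _ st)// gerBl ltW.
    have [h _] := PD (s - r) _ _ x' sr' (Bg r) (gb r r0).
    by apply: (le_trans h); rewrite le_eqVlt; apply/orP; left; apply/eqP; ring.
  have eT : expR (- (c * s)) * `|T s f' x'| <= expR (- c * s) * a'.
    by rewrite mulNr ler_wpM2l ?expR_ge0//; exact: T_contr.
  split.
    apply: (le_trans (ler_normD _ _)); rewrite normrM (ger0_norm (expR_ge0 _)).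
    apply: (le_trans (lerD eT (Rint_le_norm (integ_meas ig) gup (integZ _ iw)))).
    rewrite RintZ//.
    have -> : (1 + D) * (c * a') * \int[leb]_r w r = (1 + D) * a' * (c * \int[leb]_r w r) by ring.
    rewrite eW.
    have -> : (1 + th * D) * a' = a' + th * (D * a') by ring.
    have -> : expR (- c * s) * a' + (1 + D) * a' * (1 - expR (- c * s)) =
       a' + (1 - expR (- c * s)) * (D * a') by ring.
    by rewrite lerD2l ler_wpM2r// mulr_ge0.
  move=> fp.
  have glo r : - (D * (c * a')) * w r <= g r.
    rewrite /g /w; have [r0|r0] := leP r 0.
      by rewrite (heav0 r0) !mul0r !mulr0.
    have [sr|sr] := leP s r; first by rewrite [heav (s - r)]heav0 ?subr_le0// !(mul0r, mulr0).
    rewrite [heav r]heav1// [heav (s - r)]heav1 ?subr_gt0// !mul1r.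
    have sr' : 0 < s - r <= t by rewrite subr_gt0 sr (le_trans _ st)// gerBl ltW.
    have [_ h] := PD (s - r) _ _ x' sr' (Bg r) (gb r r0).
    apply: le_trans (h _); last by move=> y; rewrite mulr_ge0 ?expR_ge0//; exact: K_pos.
    by rewrite le_eqVlt; apply/orP; left; apply/eqP; ring.
  have Tp : 0 <= expR (- (c * s)) * T s f' x' by rewrite mulr_ge0 ?expR_ge0//; exact: T_pos.
  apply: (@le_trans _ _ (\int[leb]_r g r)); last by rewrite lerDr.
  apply: le_trans (Rint_le (integZ _ iw) ig glo); rewrite RintZ//.
  have -> : - (D * (c * a')) * \int[leb]_r w r = - (D * a' * (c * \int[leb]_r w r)) by ring.
  rewrite eW lerN2 mulrC; have -> : th * D * a' = th * (D * a') by ring.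
  by rewrite ler_wpM2r// mulr_ge0.
have D00 : 0 <= A * expR (lam * t) by rewrite mulr_ge0 ?expR_ge0.
have HP := contraction_principle th01 D00 (lexx 0) PD0 Pi.
have tt : 0 < t <= t by rewrite t0 lexx.
split.
  apply: (contraction_limit (A := A * expR (lam * t) * a) th01) => n.
  have [D PD Dn] := HP n; have [h _] := PD t f a x tt Bf fa; apply: (le_trans h).
  rewrite mul0r addr0 in Dn; have h2 := ler_wpM2r a0 Dn.
  have -> : (1 + D) * a = D * a + a by ring.
  rewrite lerD2r; apply: (le_trans h2).
  by rewrite le_eqVlt; apply/orP; left; apply/eqP; ring.
move=> fp; rewrite -oppr_le0.
apply: (contraction_limit (A := A * expR (lam * t) * a) th01) => n.
have [D PD Dn] := HP n; have [_ /(_ fp) h] := PD t f a x tt Bf fa.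
rewrite mul0r addr0 in Dn; have := ler_wpM2r a0 Dn => h2.
rewrite addr0 lerNl; apply: le_trans h; rewrite lerN2; apply: (le_trans h2).
by rewrite le_eqVlt; apply/orP; left; apply/eqP; ring.
Qed.

End Contraction.
End ShiftedDuhamel.
End Positivity.

(** * The Euclidean norm *)

Section EuclideanSpace.
Context (R : realType) (d : nat).
Notation V := (V R d).
Notation Vb := (Vb R d).

Lemma enorm_ge0 (x : V) : 0 <= enorm x.
Proof. exact: sqrtr_ge0. Qed.

Lemma enorm_mono (x y : V) : (forall i, `|x 0 i| <= `|y 0 i|) -> enorm x <= enorm y.
Proof.
move=> xy; apply: ler_wsqrtr; apply: ler_sum => i _.
by rewrite -[x 0 i ^+ 2]real_normK ?num_real// -[y 0 i ^+ 2]real_normK ?num_real// lerXn2r ?nnegrE.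
Qed.

Lemma coord_le_enorm (x : V) i : `|x 0 i| <= enorm x.
Proof.
rewrite -sqrtr_sqr; apply: ler_wsqrtr; rewrite (bigD1 i)//= lerDl sumr_ge0// => j _.
exact: sqr_ge0.
Qed.

Lemma enorm_le_sum (x : V) : enorm x <= \sum_i `|x 0 i|.
Proof.
have s0 : 0 <= \sum_i `|x 0 i| by exact: sumr_ge0.
rewrite -[leRHS]ger0_norm// -sqrtr_sqr; apply: ler_wsqrtr.
suff [] : \sum_i x 0 i ^+ 2 <= (\sum_i `|x 0 i|) ^+ 2 /\ 0 <= \sum_i `|x 0 i| by [].
elim/big_ind2 : _ => [|a b a' b' [ha a0] [hb b0]|i _].
- by rewrite expr2 mulr0.
- by split; [rewrite sqrrD; have := mulr_ge0 a0 b0; lra|exact: addr_ge0].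
- by rewrite real_normK ?num_real.
Qed.

Lemma coord_le_norm (x : V) i : `|x 0 i| <= `|x|.
Proof.
rewrite /Num.norm/= mx_normrE; apply: (le_trans _ (le_bigmax _ _ (0, i))).
exact: lexx.
Qed.

Lemma norm_le_enorm (x : V) : `|x| <= enorm x.
Proof.
rewrite /Num.norm/= mx_normrE; apply: bigmax_le; first exact: enorm_ge0.
by move=> [a i] _ /=; rewrite (ord1 a); exact: coord_le_enorm.
Qed.

(** Topology and triangle inequality come with the max norm of row vectors; this comparison and
    [norm_le_enorm] transfer them to the Euclidean norm. *)
Lemma enorm_le_norm (x : V) : enorm x <= d%:R * `|x|.
Proof.
apply: (le_trans (enorm_le_sum x)).
rewrite -[d in d%:R]card_ord -sumr_const mulr_suml; apply: ler_sum => i _.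
by rewrite mul1r; exact: coord_le_norm.
Qed.

Lemma enorm0 : enorm (0 : V) = 0.
Proof. by apply/le_anti; rewrite enorm_ge0 (le_trans (enorm_le_norm _))// normr0 mulr0. Qed.

Lemma enormZ (k : R) (x : V) : enorm (k *: x) = `|k| * enorm x.
Proof.
rewrite /enorm -sqrtr_sqr -sqrtrM ?sqr_ge0// mulr_sumr; congr Num.sqrt.
by apply: eq_bigr => i _; rewrite mxE exprMn.
Qed.

Lemma enorm_evec (h : R) (i : 'I_d) : enorm (h *: evec R i) = `|h|.
Proof.
rewrite enormZ (_ : enorm _ = 1) ?mulr1// /enorm (bigD1 i)//= big1 ?addr0.
  by rewrite mxE !eqxx expr1n sqrtr1.
by move=> j ji; rewrite mxE eqxx (negbTE ji) expr0n.
Qed.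

Lemma continuous_enorm : continuous (@enorm R d).
Proof.
move=> x; apply: (@continuous_comp _ _ _ (fun x : V => \sum_i x 0 i ^+ 2) Num.sqrt); last exact: sqrt_continuous.
have : continuous (\sum_(i < d) (fun x : V => x 0 i ^+ 2)).
  elim/big_ind : _ => [|f g cf cg z|i _ z].
  - exact: cst_continuous.
  - exact: (cvgD (cf z) (cg z)).
  - by apply: (@continuous_comp _ _ _ (fun x : V => x 0 i) (fun y : R => y ^+ 2)); [exact: coord_continuous|exact: exprn_continuous].
rewrite (_ : \sum_(i < d) _ = (fun x : V => \sum_i x 0 i ^+ 2)); first exact.
by apply/funext => y; rewrite fct_sumE.
Qed.

Lemma coord_borel (i : 'I_d) : borelf (fun x : V => x 0 i).
Proof. by apply: continuous_borelf => x; exact: coord_continuous. Qed.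

Lemma enorm_borel : borelf (@enorm R d).
Proof. by apply: continuous_borelf; exact: continuous_enorm. Qed.

(** [Vb] carries the sigma-algebra generated by the open sets, not a product one. Balls of the max
    norm are cubes, so an open set is a countable union of cubes with rational centres, each cut out
    by finitely many coordinate conditions. *)
Lemma meas_coords dX (X : measurableType dX) (f : X -> V) :
  (forall i, measurable_fun setT (fun x => f x 0 i)) ->
  measurable_fun setT (f : X -> Vb).
Proof.
move=> mf; apply: (@measurability _ _ X Vb setT f (@open V)) => //.
move=> _ [U oO <-]; rewrite setTI.
pose c (p : 'rV[rat]_d * nat) : V := \row_i ratr (p.1 0 i).
have -> : f @^-1` U = \bigcup_p
   [set x | ball (c p) (p.2.+1%:R^-1) `<=` U /\ forall i, ball (c p 0 i) (p.2.+1%:R^-1) (f x 0 i)].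
  apply/seteqP; split => [x /= Ox|x [p _ /= [pO px]]]; last first.
    by apply: pO; split => [|i j]; [rewrite invr_gt0|rewrite (ord1 i)].
  have : nbhs (f x) U by exact: open_nbhs_nbhs.
  move=> /nbhs_ballP[e /= e0 eO].
  have [n ne] : exists n : nat, n.+1%:R^-1 < e / 2.
    have e2 : 0 < e / 2 by rewrite divr_gt0.
    have : (n.+1%:R^-1 : R) @[n --> \oo] --> (0 : R) by exact: cvg_harmonic.
    move=> /cvgrPdist_lt/(_ _ e2)[n _ /(_ n (leqnn n))] /=.
    by rewrite sub0r normrN ger0_norm ?invr_ge0//; exists n.
  have n0 : (0 : R) < n.+1%:R^-1 by rewrite invr_gt0.
  have /choice[r rP] : forall i, exists q : rat, `|ratr q - f x 0 i| < n.+1%:R^-1.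
    move=> i; have xy : f x 0 i - n.+1%:R^-1 < f x 0 i + n.+1%:R^-1 by rewrite ltrD2l gtrN.
    by have [q] := rat_in_itvoo xy; rewrite in_itv/= => qq; exists q; rewrite ltr_distl.
  exists (\row_i r i, n) => //=; split.
    move=> y [_ yb]; apply: eO; split => // a i; rewrite (ord1 a).
    have := yb 0 i; rewrite /ball/= !mxE => h; have := rP i => h'.
    have -> : f x 0 i - y 0 i = - (ratr (r i) - f x 0 i) + (ratr (r i) - y 0 i) by ring.
    rewrite (le_lt_trans (ler_normD _ _))// normrN (lt_trans (ltrD h' h))//.
    by rewrite (lt_le_trans (ltrD ne ne))// -splitr.
  by move=> i; rewrite /ball/= !mxE; exact: rP.
apply: countable_bigcupT_measurable; first exact: countableP.
move=> p; have [pO|pO] := pselect (ball (c p) (p.2.+1%:R^-1) `<=` U); last first.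
  by rewrite (_ : [set _ | _] = set0)//; apply/seteqP; split => x //= [].
rewrite (_ : [set x | _] = \bigcap_i (fun x => f x 0 i) @^-1` ball (c p 0 i) (p.2.+1%:R^-1)).
  rewrite -[X in measurable X]setCK setC_bigcap; apply: measurableC.
  apply: countable_bigcupT_measurable => [|i]; first exact: countableP.
  apply: measurableC.
  by rewrite -[X in measurable X]setTI; apply: mf => //; exact: measurable_ball.
apply/seteqP; split => [x [_ h] i _|x h] /=; first exact: h.
by split => // i; exact: h.
Qed.

End EuclideanSpace.

(** * Regularity *)

Section Regularity.
Context (R : realType) (d : nat).
Notation V := (V R d).
Notation Vb := (Vb R d).
Notation leb := (@lebesgue_measure R).
Notation TR := (measurableTypeR R).

Lemma mvt_bound (g dg : R -> R) (t a K : R) : (forall s : R, is_derive s 1 g (dg s)) ->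
  (forall s, `|s| <= `|t| -> `|dg s - a| <= K) -> `|g t - g 0 - t * a| <= K * `|t|.
Proof.
move=> dg' K'.
have cont (u v : R) : {within `[u, v], continuous g}.
  by apply: derivable_within_continuous => x _; have [] := dg' x.
have [t0|t0] := leP 0 t.
  have [xi] := MVT_segment t0 (fun x _ => dg' x) (cont 0 t).
  rewrite in_itv/= subr0 => /andP[x0 xt] ->.
  have -> : dg xi * t - t * a = (dg xi - a) * t by ring.
  by rewrite normrM ler_wpM2r// K'// !ger0_norm.
have [xi] := MVT_segment (ltW t0) (fun x _ => dg' x) (cont t 0).
rewrite in_itv/= sub0r => /andP[x0 xt] e.
have e' : g t - g 0 = dg xi * t by rewrite -opprB e; ring.
have -> : g t - g 0 - t * a = (dg xi - a) * t by rewrite e'; ring.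
by rewrite normrM ler_wpM2r// K'// !ler0_norm// ?lerN2// ltW.
Qed.

Lemma is_derive_line (f : V -> R) (z v : V) (s : R) : derivable f (z + s *: v) v ->
  is_derive s 1 (fun s => f (z + s *: v)) ('D_v f (z + s *: v)).
Proof.
have e : (fun h : R => h^-1 *: (((fun s => f (z + s *: v)) \o shift s) (h *: (1 : R)) - f (z + s *: v))) =
  (fun h : R => h^-1 *: ((f \o shift (z + s *: v)) (h *: v) - f (z + s *: v))).
  apply/funext => h /=; congr (_ *: (f _ - _)).
  by rewrite [h *: 1]mulr1 scalerDl addrCA.
move=> df; split; first by rewrite /derivable e.
by rewrite /derive e.
Qed.

(** The coordinates of [y] are switched on one at a time and the mean value theorem is applied along
    each axis: [Cbrho] provides derivatives along the axes only. All intermediate points stay in the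
    box spanned by [y]. *)
Lemma walk (f : V -> R) (x y : V) (a : 'I_d -> R) (K : R) :
  (forall (z : V) i, derivable f z (evec R i)) ->
  (forall i (z : V), (forall j, `|z 0 j| <= `|y 0 j|) -> `|partial i f (x + z) - a i| <= K) ->
  `|f (x + y) - f x - \sum_i y 0 i * a i| <= K * \sum_i `|y 0 i|.
Proof.
move=> df fK.
pose ym (m : nat) : V := \row_(i < d) (if (i < m)%N then y 0 i else 0).
have step m : (m <= d)%N -> `|f (x + ym m) - f x - \sum_(i < d | (i < m)%N) y 0 i * a i| <=
    K * \sum_(i < d | (i < m)%N) `|y 0 i|.
  elim: m => [_|m IH md].
    rewrite !big_pred0// mulr0 subr0 (_ : ym 0%N = 0) ?addr0 ?subrr ?normr0//.
    by apply/rowP => i; rewrite !mxE.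
  pose i0 := Ordinal md.
  have yS : ym m.+1 = ym m + y 0 i0 *: evec R i0.
    apply/rowP => i; rewrite !mxE eqxx/= ltnS leq_eqVlt -[in i == i0]val_eqE /=.
    case: eqP => [e|_] /=; last by rewrite mulr0 addr0.
    by rewrite e ltnn add0r mulr1; congr (y 0 _); apply: val_inj.
  have sumS (F : 'I_d -> R) : \sum_(i < d | (i < m.+1)%N) F i = F i0 + \sum_(i < d | (i < m)%N) F i.
    rewrite (bigD1 i0)/= ?ltnS//; congr (_ + _); apply: eq_bigl => i.
    by rewrite ltnS leq_eqVlt -val_eqE/=; case: eqP => [->|]; rewrite ?ltnn// andbT.
  rewrite !sumS mulrDr.
  have -> : f (x + ym m.+1) - f x - (y 0 i0 * a i0 + \sum_(i < d | (i < m)%N) y 0 i * a i) =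
     (f (x + ym m + y 0 i0 *: evec R i0) - f (x + ym m) - y 0 i0 * a i0) +
     (f (x + ym m) - f x - \sum_(i < d | (i < m)%N) y 0 i * a i).
    by rewrite yS addrA; ring.
  apply: (le_trans (ler_normD _ _)); rewrite lerD ?IH ?(ltnW md)//.
  pose g (s : R) := f (x + ym m + s *: evec R i0).
  have -> : f (x + ym m) = g 0 by rewrite /g scale0r addr0.
  apply: (@mvt_bound g (fun s => partial i0 f (x + ym m + s *: evec R i0))).
    by move=> s; apply: is_derive_line.
  move=> s sy; rewrite -addrA; apply: fK => j; rewrite !mxE eqxx/=.
  case: (eqVneq j i0) => [->|ji]; first by rewrite /= ltnn add0r mulr1.
  by rewrite mulr0 addr0; case: ifP => // _; rewrite normr0.
have := step d (leqnn d); rewrite (_ : ym d = y); last first.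
  by apply/rowP => i; rewrite mxE ltn_ord.
have bigE (F : 'I_d -> R) : \sum_(i < d | (i < d)%N) F i = \sum_i F i.
  by apply: eq_bigl => i; rewrite ltn_ord.
by rewrite !bigE.
Qed.

Lemma powR_small (p C e : R) : 0 < p -> 0 < e ->
  exists2 del : R, 0 < del & forall h, 0 <= h < del -> C * h `^ p <= e.
Proof.
move=> p0 e0; pose b := e / (`|C| + 1).
have C1 : 0 < `|C| + 1 by rewrite ltr_wpDl.
have b0 : 0 < b by rewrite divr_gt0.
exists (b `^ p^-1); first exact: powR_gt0.
move=> h /andP[h0 hd].
have hp : h `^ p <= b.
  rewrite -[b](powRr1 (ltW b0)) -(mulVf (lt0r_neq0 p0)) powRrM.
  by apply: (ge0_ler_powR (ltW p0)); rewrite ?nnegrE// ?powR_ge0// ltW.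
apply: (@le_trans _ _ (`|C| * b)); last first.
  rewrite /b mulrA ler_pdivrMr// mulrC ler_wpM2l ?ltW//; lra.
apply: (@le_trans _ _ (`|C| * h `^ p)); first by rewrite ler_wpM2r ?powR_ge0// ler_norm.
by rewrite ler_wpM2l.
Qed.

Lemma powR_seq0 (p C : R) (v : nat -> R) : 0 < p -> (forall n, 0 <= v n) ->
  v n @[n --> \oo] --> 0 -> C * v n `^ p @[n --> \oo] --> 0.
Proof.
move=> p0 v0 cv; apply/cvgrPdist_le => e e0.
have [del d0 H] := powR_small (`|C|) p0 e0.
have /cvgrPdist_lt/(_ _ d0) := cv; apply: filterS => n.
rewrite /= !sub0r !normrN ger0_norm// => vn.
by rewrite normrM (ger0_norm (powR_ge0 _ _)) H// v0.
Qed.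

Variables (rho : R) (rho0 : 0 < rho).

Definition grad (i : 'I_d) (f : V -> R) (x : V) : R := if rho <= 1 then 0 else partial i f x.

(** Smoothness beyond order 2 does not improve a first-order Taylor remainder, hence the cap. From
    [beta < 2] and [beta < rho] one still gets [beta < al]. *)
Definition al : R := Num.min rho 2.

(* Of the [C_b^rho] bound only this second-order information enters the
   estimates of the perturbation; for [rho <= 1] there is no gradient. *)
Definition hreg (c : R) (f : V -> R) :=
  [/\ forall x, `|f x| <= c, forall i x, `|grad i f x| <= c
    & forall x y, `|f (x + y) - f x - \sum_i y 0 i * grad i f x| <= c * enorm y `^ al].

Lemma al_gt0 : 0 < al.
Proof. by rewrite lt_min rho0 ltr0n. Qed.

Lemma al_gt1 : 1 < rho -> 1 < al.
Proof. by move=> r1; rewrite lt_min r1 ltr1n. Qed.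

Lemma sum_evec (h : R) (i : 'I_d) (p : 'I_d -> R) :
  \sum_j (h *: evec R i) 0 j * p j = h * p i.
Proof.
rewrite (bigD1 i)//= big1 ?addr0; first by rewrite !mxE !eqxx mulr1.
by move=> j ji; rewrite !mxE eqxx (negbTE ji) mulr0 mul0r.
Qed.

Lemma quotient_bound (c : R) (f : V -> R) (x : V) (p : 'I_d -> R) (h : R) i :
  (forall y, `|f (x + y) - f x - \sum_j y 0 j * p j| <= c * enorm y `^ al) ->
  h != 0 -> `|h^-1 * (f (x + h *: evec R i) - f x) - p i| <= c * `|h| `^ (al - 1).
Proof.
move=> H h0; have := H (h *: evec R i); rewrite sum_evec enorm_evec => hb.
have hn : 0 < `|h| by rewrite normr_gt0.
have -> : h^-1 * (f (x + h *: evec R i) - f x) - p i =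
   h^-1 * (f (x + h *: evec R i) - f x - h * p i) by field.
rewrite normrM normfV ler_pdivrMl//; apply: (le_trans hb).
by rewrite mulrCA mulr_powRB1// ?al_gt0// ltW.
Qed.

Lemma quotient_cvg (c : R) (f : V -> R) (x : V) (p : 'I_d -> R) i : 1 < rho ->
  (forall y, `|f (x + y) - f x - \sum_j y 0 j * p j| <= c * enorm y `^ al) ->
  n.+1%:R * (f (x + n.+1%:R^-1 *: evec R i) - f x) @[n --> \oo] --> p i.
Proof.
move=> r1 H.
have v0 : c * (n.+1%:R^-1 : R) `^ (al - 1) @[n --> \oo] --> (0 : R).
  apply: powR_seq0; [by rewrite subr_gt0 al_gt1|by move=> n; rewrite invr_ge0|exact: cvg_harmonic].
apply: (cvg_seq0_le _ v0) => n.
have n0 : (n.+1%:R^-1 : R) != 0 by rewrite invr_eq0 pnatr_eq0.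
by have := quotient_bound i H n0; rewrite invrK (ger0_norm (_ : 0 <= n.+1%:R^-1)) ?invr_ge0.
Qed.

(** A remainder of order [al > 1] is negligible against the increment, so the difference quotients
    along the axes converge to [p]. *)
Lemma grad_unique (c : R) (f : V -> R) (x : V) (p : 'I_d -> R) i : 1 < rho ->
  (forall y, `|f (x + y) - f x - \sum_j y 0 j * p j| <= c * enorm y `^ al) ->
  partial i f x = p i.
Proof.
move=> r1 H; apply: cvg_lim => //; apply/cvgrPdist_le => e e0.
have a1 : 0 < al - 1 by rewrite subr_gt0 al_gt1.
have [del d0 Hd] := powR_small c a1 e0.
near=> h.
have h0 : h != 0 by near: h; exact: nbhs_dnbhs_neq.
have hd : `|h| < del.
  near: h; apply: dnbhs0_lt; exact: d0.
rewrite distrC /= [h *: _ + x]addrC; apply: (le_trans (quotient_bound i H h0)).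
by apply: Hd; rewrite normr_ge0.
Unshelve. all: by end_near.
Qed.

Lemma hreg_diff_bound c f (x y : V) : hreg c f -> `|f (x + y) - f x| <= c * (d%:R * enorm y) + c * enorm y `^ al.
Proof.
move=> [fc gc H]; have c0 : 0 <= c by rewrite (le_trans _ (fc 0)).
rewrite -[f (x + y) - f x](subrK (\sum_i y 0 i * grad i f x)) addrC.
apply: (le_trans (ler_normD _ _)); rewrite lerD//.
apply: (le_trans (ler_norm_sum _ _ _)).
have -> : c * (d%:R * enorm y) = \sum_(i < d) c * enorm y.
  by rewrite sumr_const card_ord -mulr_natl; ring.
by apply: ler_sum => i _; rewrite normrM mulrC ler_pM// coord_le_enorm.
Qed.

Lemma enorm_cvg0 (u : nat -> V) (x : V) : u n @[n --> \oo] --> x ->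
  enorm (u n - x) @[n --> \oo] --> 0.
Proof.
move=> cu; have h : u n - x @[n --> \oo] --> x - x by apply: cvgB => //; exact: cvg_cst.
rewrite subrr in h; rewrite -(enorm0 R d).
exact: (cvg_comp _ _ h (@continuous_enorm R d 0)).
Qed.

Lemma hreg_continuous c f : hreg c f -> continuous f.
Proof.
move=> Hf x; apply: cvg_seqP => u cu; have ce := enorm_cvg0 cu.
pose v n := c * (d%:R * enorm (u n - x)) + c * enorm (u n - x) `^ al.
have v0 : v n @[n --> \oo] --> 0.
  rewrite -[X in _ --> X]addr0; apply: cvgD.
    rewrite -[X in _ --> X](mulr0 c); apply: cvgMr.
    by rewrite -[X in _ --> X](mulr0 (d%:R : R)); apply: cvgMr.
  by apply: powR_seq0 => //; [exact: al_gt0|move=> n; exact: enorm_ge0].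
apply: (cvg_seq0_le _ v0) => n.
by have := hreg_diff_bound x (u n - x) Hf; rewrite [x + _]addrC subrK.
Qed.

Lemma grad_spec i (f : V -> R) (x : V) (p : 'I_d -> R) (c : R) : (rho <= 1 -> p i = 0) ->
  (forall y, `|f (x + y) - f x - \sum_j y 0 j * p j| <= c * enorm y `^ al) ->
  grad i f x = p i.
Proof.
rewrite /grad; have [r1 -> //|r1 _ H] := leP rho 1.
exact: grad_unique H.
Qed.

Lemma grad_le1 i (f : V -> R) (x : V) : rho <= 1 -> grad i f x = 0.
Proof. by rewrite /grad => ->. Qed.

Lemma grad_gt1 (i : 'I_d) (f : V -> R) (x : V) : 1 < rho -> grad i f x = partial i f x.
Proof. by rewrite /grad leNgt => ->. Qed.

(** The candidate [p] is not assumed to be a gradient: for [1 < rho] the Taylor estimate forces it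
    to be one. Closure of [hreg] under time integrals is thereby obtained without differentiating
    under the integral sign. *)
Lemma hreg_of_grad (c : R) (f : V -> R) (p : 'I_d -> V -> R) : (forall x, `|f x| <= c) ->
  (forall i x, rho <= 1 -> p i x = 0) -> (forall i x, `|p i x| <= c) ->
  (forall x y, `|f (x + y) - f x - \sum_i y 0 i * p i x| <= c * enorm y `^ al) ->
  hreg c f.
Proof.
move=> fc p1 pc H.
have e i x : grad i f x = p i x.
  by apply: (@grad_spec i f x (p ^~ x) c) => [|y]; [exact: p1|exact: H].
split => // [i x|x y]; first by rewrite e.
by under eq_bigr do rewrite e.
Qed.

Lemma regspace_hreg : regspace hreg.
Proof.
split.
- by move=> c f Hf; split; [exact: hreg_continuous Hf|case: Hf].
- apply: (@hreg_of_grad 0 (fun=> 0) (fun _ _ => 0)) => //; try by move=> *; rewrite normr0.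
  move=> x y; rewrite subrr big1 ?subr0 ?normr0 ?mul0r// => i _.
  by rewrite mulr0.
- move=> c c' f cc' [fc gc H]; split.
  + by move=> x; exact: le_trans (fc x) cc'.
  + by move=> i x; exact: le_trans (gc i x) cc'.
  + by move=> x y; apply: (le_trans (H x y)); rewrite ler_wpM2r// powR_ge0.
- move=> k c c' f g [fc gfc Hf] [gc ggc Hg].
  apply: (@hreg_of_grad _ _ (fun i x => k * grad i f x + grad i g x)).
  + by move=> x; rewrite (le_trans (ler_normD _ _))// lerD// normrM ler_wpM2l.
  + by move=> i x r1; rewrite !grad_le1// mulr0 addr0.
  + by move=> i x; rewrite (le_trans (ler_normD _ _))// lerD// normrM ler_wpM2l.
  + move=> x y.
    have -> : k * f (x + y) + g (x + y) - (k * f x + g x) - \sum_i y 0 i * (k * grad i f x + grad i g x) =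
      k * (f (x + y) - f x - \sum_i y 0 i * grad i f x) + (g (x + y) - g x - \sum_i y 0 i * grad i g x).
      have -> : \sum_i y 0 i * (k * grad i f x + grad i g x) =
         k * (\sum_i y 0 i * grad i f x) + \sum_i y 0 i * grad i g x.
        by rewrite mulr_sumr -big_split/=; apply: eq_bigr => i _; ring.
      ring.
    rewrite mulrDl (le_trans (ler_normD _ _))// lerD// normrM -mulrA ler_wpM2l//.
- move=> h a mh Hh ia.
  have mhx x : measurable_fun setT (fun s : TR => h s x) := measurable_fun_pair1 (x : Vb) mh.
  have ha s x : `|h s x| <= a s by have [+ _ _] := Hh s; apply.
  have ih x : integ leb (h ^~ x) := integ_dom (mhx x) (fun s => ha s x) ia.
  (* Measurability in [s] comes from difference quotients of the jointly measurable [h]. *)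
  have mg i x : measurable_fun setT (fun s : TR => grad i (h s) x).
    have [r1|r1] := leP rho 1.
      by under eq_fun do rewrite grad_le1//; exact: measurable_cst.
    apply: (@measurable_fun_cvg _ _ _ _ (fun n s => n.+1%:R * (h s (x + n.+1%:R^-1 *: evec R i) - h s x))).
      by move=> n; apply: measurable_funM => //; exact: measurable_funB.
    move=> s _; have [_ _ H] := Hh s.
    exact: (quotient_cvg r1 (H x)).
  have gb i x s : `|grad i (h s) x| <= a s by have [_ + _] := Hh s; apply.
  have ig i x : integ leb (fun s => grad i (h s) x) := integ_dom (mg i x) (gb i x) ia.
  apply: (@hreg_of_grad _ _ (fun i x => \int[leb]_s grad i (h s) x)).
  + by move=> x; exact: Rint_le_norm.
  + move=> i x r1; rewrite -[RHS](@Rint0 _ _ _ leb); apply: eq_Rintegral => s _.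
    exact: grad_le1.
  + by move=> i x; exact: Rint_le_norm.
  + move=> x y.
    have isum (r : seq 'I_d) : integ leb (fun s => \sum_(i <- r) y 0 i * grad i (h s) x) /\
        \int[leb]_s (\sum_(i <- r) y 0 i * grad i (h s) x) = \sum_(i <- r) y 0 i * \int[leb]_s grad i (h s) x.
      elim: r => [|i r [IH1 IH2]].
        under eq_fun do rewrite big_nil; rewrite big_nil; split; last first.
          by rewrite -[RHS](@Rint0 _ _ _ leb); apply: eq_Rintegral => s _; rewrite ?big_nil.
        by have := integZ 0 ia; under eq_fun do rewrite mul0r.
      have e : (fun s => \sum_(j <- i :: r) y 0 j * grad j (h s) x) =
         (fun s => y 0 i * grad i (h s) x + \sum_(j <- r) y 0 j * grad j (h s) x).
        by apply/funext => s; rewrite big_cons.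
      split; first by rewrite e; apply: integD => //; exact: integZ.
      rewrite e big_cons RintD//; last exact: integZ.
      by rewrite RintZ// IH2.
    have [is1 is2] := isum (index_enum 'I_d).
    rewrite -is2 -RintB// -RintB//; last exact: (integB (ih (x + y)) (ih x)).
    rewrite mulrC -RintZ//; apply: Rint_le_norm.
    * exact: (integ_meas (integB (integB (ih (x + y)) (ih x)) is1)).
    * by move=> s; rewrite mulrC; have [_ _ H] := Hh s; exact: H.
    * exact: integZ.
Qed.

(** One factor [1 + d] comes from summing over the coordinates of [y] in the first-order expansion,
    the other from doing the same for the increments of the gradient when [rho > 2]. *)
Lemma hreg_of_bounds (f : V -> R) (a : R) : Cbrho rho f ->
  (forall l : seq 'I_d, (size l <= hord rho)%N -> forall x, `|pd l f x| <= a) ->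
  (forall l : seq 'I_d, size l = hord rho -> forall x y,
     `|pd l f x - pd l f y| <= a * (enorm (x - y)) `^ (hexp rho)) ->
  hreg ((1 + d%:R) ^+ 2 * a) f.
Proof.
move=> [df _] bf hf; have a0 : 0 <= a by rewrite (le_trans _ (bf [::] _ 0)).
have D1 : a <= (1 + d%:R) ^+ 2 * a.
  by rewrite ler_peMl// exprn_ege1// lerDl.
have d0 : 0 <= (d%:R : R) by exact: ler0n.
have [r1|r1] := leP rho 1.
  have ceil1 : Num.ceil rho = 1.
    by apply/eqP; rewrite eq_le ceil_le_int r1/= -gtz0_ge1 ceil_gt_int.
  (* Since [hord] is the ceiling minus 1, no derivative is involved even at [rho = 1], where the
     class consists of Lipschitz functions. *)
  have ho : hord rho = 0%N by rewrite /hord ceil1 subrr.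
  have he : hexp rho = rho by rewrite /hexp ho subr0.
  have alE : al = rho by rewrite /al; apply/min_idPl; rewrite (le_trans r1)// ler1n.
  apply: (@hreg_of_grad _ _ (fun _ _ => 0)) => //.
  - by move=> x; apply: le_trans D1; apply: (bf [::]).
  - by move=> i x; rewrite normr0 mulr_ge0// exprn_ge0// addr_ge0.
  - move=> x y; rewrite big1 ?subr0; last by move=> i _; rewrite mulr0.
    have := hf [::]; rewrite ho he => /(_ erefl (x + y) x); rewrite /= addrAC subrr add0r alE.
    by move/le_trans; apply; rewrite ler_wpM2r// powR_ge0.
have ceil2 : (2 <= Num.ceil rho)%R.
  by rewrite -[2%R]/(1 + 1 : int) lezD1 ceil_gt_int.
have ho1 : (1 <= hord rho)%N.
  rewrite /hord -lez_nat gez0_abs; lia.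
have hoZ : ((hord rho)%:Z = Num.ceil rho - 1)%R by rewrite /hord gez0_abs//; lia.
have dfi i (z : V) : derivable f z (evec R i) by apply: (df [::]).
have gi i x : grad i f x = pd [:: i] f x by rewrite /grad leNgt r1.
have ga i x : `|pd [:: i] f x| <= a by apply: bf.
have al1 := al_gt1 r1.
have smono (y z : V) : (forall j, `|z 0 j| <= `|y 0 j|) -> \sum_i `|z 0 i| <= d%:R * enorm y.
  move=> zy; have -> : d%:R * enorm y = \sum_(i < d) enorm y.
    by rewrite sumr_const card_ord mulr_natl.
  by apply: ler_sum => i _; rewrite (le_trans (zy i))// coord_le_enorm.
(* The gradient varies by order [al - 1] over the box of [y]: by the Holder bound if [rho <= 2], and
   by bounded second derivatives, available since [hord rho >= 2], if [rho > 2]. *)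
have K i x (y z : V) : (forall j, `|z 0 j| <= `|y 0 j|) ->
    `|partial i f (x + z) - partial i f x| <= (1 + d%:R) * a * enorm y `^ (al - 1).
  move=> zy; have [r2|r2] := leP rho 2.
    have ceil2' : Num.ceil rho = 2.
      by apply/eqP; rewrite eq_le ceil2 andbT ceil_le_int.
    have ho : hord rho = 1%N by rewrite /hord ceil2'.
    have he : hexp rho = al - 1 by rewrite /hexp ho /al (min_idPl r2).
    have := hf [:: i]; rewrite ho he => /(_ erefl (x + z) x); rewrite addrAC subrr add0r.
    move/le_trans; apply; apply: (@le_trans _ _ (a * enorm y `^ (al - 1))).
      rewrite ler_wpM2l//; apply: ge0_ler_powR; rewrite ?nnegrE ?enorm_ge0//.
        by rewrite subr_ge0 ltW.
      exact: enorm_mono.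
    by rewrite ler_wpM2r ?powR_ge0// ler_peMl// lerDl.
  have alE : al = 2 by rewrite /al (min_idPr (ltW r2)).
  have ho2 : (2 <= hord rho)%N.
    have : (3 <= Num.ceil rho)%R by rewrite -[3%R]/(2 + 1 : int) lezD1 ceil_gt_int.
    move: hoZ; lia.
  have -> : al - 1 = 1 by rewrite alE; ring.
  rewrite powRr1 ?enorm_ge0//.
  have dg (w : V) j : derivable (pd [:: i] f) w (evec R j) by apply: df.
  have := @walk (pd [:: i] f) x z (fun=> 0) a dg.
  rewrite big1 ?subr0; last by move=> j _; rewrite mulr0.
  have gb j (w : V) : (forall k, `|w 0 k| <= `|z 0 k|) -> `|partial j (pd [:: i] f) (x + w) - 0| <= a.
    by move=> _; rewrite subr0; apply: (bf [:: j; i]).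
  move=> /(_ gb) /le_trans; apply.
  rewrite [_ * a]mulrC -mulrA ler_wpM2l// mulrDl mul1r (le_trans (smono y z zy))// lerDr.
  exact: enorm_ge0.
split.
- by move=> x; apply: le_trans D1; apply: (bf [::]).
- by move=> i x; rewrite gi; apply: le_trans D1; exact: ga.
- move=> x y.
  have := @walk f x y (fun i => grad i f x) _ (fun z i => dfi i z) (fun i z zy => _).
  move=> /(_ ((1 + d%:R) * a * enorm y `^ (al - 1))) W.
  have W' : `|f (x + y) - f x - \sum_i y 0 i * grad i f x| <=
      ((1 + d%:R) * a * enorm y `^ (al - 1)) * \sum_i `|y 0 i|.
    apply: walk => [z i|i z zy]; first exact: dfi.
    by rewrite gi; exact: K.
  apply: (le_trans W').
  apply: (@le_trans _ _ ((1 + d%:R) * a * enorm y `^ (al - 1) * ((1 + d%:R) * enorm y))).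
    rewrite ler_wpM2l// ?mulr_ge0 ?powR_ge0 ?addr_ge0//.
    by rewrite mulrDl mul1r (le_trans (smono y y _))// lerDr enorm_ge0.
  rewrite -(mulr_powRB1 (enorm_ge0 y) al_gt0) le_eqVlt; apply/orP; left; apply/eqP; ring.
Qed.

End Regularity.

(** * Measurability of the Levy kernel *)

Section LevyKernel.
Context (R : realType) (d : nat).
Notation V := (V R d).
Notation Vb := (Vb R d).

Definition clamp (t : R) : R := Num.max 0 (Num.min 1 t).

Lemma clamp_ge0 t : 0 <= clamp t. Proof. by rewrite le_max lexx. Qed.

Lemma clamp_le1 t : clamp t <= 1. Proof. by rewrite ge_max ler01 ge_min lexx. Qed.

Lemma clamp0 t : t <= 0 -> clamp t = 0.
Proof. by move=> t0; apply/max_idPl; rewrite ge_min t0 orbT. Qed.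

Lemma clamp1 t : 1 <= t -> clamp t = 1.
Proof. by move=> t1; rewrite /clamp (min_idPl t1); apply/max_idPr. Qed.

Lemma continuous_clamp : continuous clamp.
Proof.
move=> t.
have c0 : {for t, continuous (fun=> 0 : R^o)} by exact: cvg_cst.
have c1 : {for t, continuous (fun=> 1 : R^o)} by exact: cvg_cst.
have ci : {for t, continuous (id : R -> R^o)} by exact: cvg_id.
exact: (continuous_max c0 (continuous_min c1 ci)).
Qed.

(** Distance to the complement of [U], capped at 1; the cap also keeps the infimum over a nonempty
    set when [U] is the whole space. *)
Definition infdist (U : set V) (y : V) : R := inf ([set 1] `|` [set `|y - z| | z in ~` U]).

Section InfDist.
Variable U : set V.

Let nonempty (y : V) : [set 1] `|` [set `|y - z| | z in ~` U] !=set0.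
Proof. by exists 1; left. Qed.

Let lbnd (y : V) : has_lbound ([set 1] `|` [set `|y - z| | z in ~` U]).
Proof. by exists 0 => _ [->//|[z _ <-]]. Qed.

Lemma infdist_ge0 y : 0 <= infdist U y.
Proof. by apply: lb_le_inf => // _ [->//|[z _ <-]]. Qed.

Lemma infdist_out y : ~ U y -> infdist U y = 0.
Proof.
move=> Uy; apply/le_anti; rewrite infdist_ge0 andbT.
by apply: ge_inf => //; right; exists y => //; rewrite subrr normr0.
Qed.

Lemma infdist_in y : open U -> U y -> 0 < infdist U y.
Proof.
move=> oU Uy; have : nbhs y U by exact: open_nbhs_nbhs.
move=> /nbhs_ballP[e /= e0 eU].
apply: (@lt_le_trans _ _ (Num.min 1 e)); first by rewrite lt_min ltr01.
apply: lb_le_inf => // _ [->|[z Uz <-]]; first by rewrite ge_min lexx.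
rewrite ge_min; apply/orP; right; rewrite leNgt; apply/negP => yz; apply: Uz; apply: eU.
by rewrite mx_norm_ball.
Qed.

Lemma infdist_lip y y' : infdist U y <= infdist U y' + `|y - y'|.
Proof.
rewrite -lerBlDr; apply: lb_le_inf => // _ [->|[z Uz <-]].
  by rewrite lerBlDr (@le_trans _ _ 1) ?lerDl//; apply: ge_inf => //; left.
rewrite lerBlDr (@le_trans _ _ `|y - z|)//; first by apply: ge_inf => //; right; exists z.
have -> : y - z = (y - y') + (y' - z) by rewrite addrA subrK.
by rewrite addrC ler_normD.
Qed.

Lemma infdist_continuous : continuous (infdist U).
Proof.
move=> x; apply/(@cvgrPdist_le _ _ _ _ (nbhs_filter x)) => e e0.
have : nbhs x (ball x e) by exact: nbhsx_ballx.
apply: (@filterS _ (nbhs x) (nbhs_filter x)) => y; rewrite -ball_normE /= => /ltW xy.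
apply: le_trans xy; rewrite ler_norml.
have h1 := infdist_lip x y; have h2 := infdist_lip y x.
by rewrite [`|y - x|]distrC in h2; apply/andP; split; lra.
Qed.

End InfDist.

Variables (mu : V -> {measure set Vb -> \bar R}) (beta C : R).
Hypothesis mu_Cc0 : forall f, Cc0 f ->
     measurable_fun (setT : set (Vb)) (fun x => (\int[mu x]_y (f y)%:E)%E).
Hypothesis beta0 : 0 < beta.
Hypothesis mu_C : forall x, (\int[mu x]_y (Num.min ((enorm y) `^ beta) 1)%:E <= C%:E)%E.

Definition mbeta (y : V) : R := Num.min ((enorm y) `^ beta) 1.

Lemma mbeta_ge0 y : 0 <= mbeta y.
Proof. by rewrite le_min powR_ge0 ler01. Qed.

Lemma mbeta_borel : borelf mbeta.
Proof.
apply: measurable_minr => //.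
exact: (measurableT_comp (measurable_powR beta) (@enorm_borel R d)).
Qed.

Lemma mbeta_integ x : integ (mu x) mbeta.
Proof.
apply/integrableP; split; first by apply/measurable_EFinP; exact: mbeta_borel.
under eq_integral => y _ do rewrite gee0_abs ?lee_fin ?mbeta_ge0//.
by rewrite (le_lt_trans (mu_C x))// ltry.
Qed.

Lemma mbeta_int_le x : \int[mu x]_y mbeta y <= C.
Proof.
rewrite -lee_fin /Rintegral fineK; first exact: mu_C.
exact: (integrable_fin_num measurableT (mbeta_integ x)).
Qed.

Lemma C_ge0 : 0 <= C.
Proof. by apply: le_trans (mbeta_int_le 0); apply: Rintegral_ge0 => y _; exact: mbeta_ge0. Qed.

(** The constant of a Markov inequality: on [r <= enorm y] the function [mbeta] is at least the
    smaller of [r] to the power [beta] and 1, and [tailc r] exceeds both reciprocals. *)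
Definition tailc (r : R) : R := (r `^ beta)^-1 + 1.

Lemma mbeta_tail r y : 0 < r -> r <= enorm y -> 1 <= tailc r * mbeta y.
Proof.
move=> r0 ry; have rb : 0 < r `^ beta by exact: powR_gt0.
have t0 : 0 <= tailc r by rewrite addr_ge0 ?invr_ge0 ?(ltW rb).
rewrite /mbeta minr_pMr// le_min; apply/andP; split.
  have h : r `^ beta <= enorm y `^ beta.
    by apply: (ge0_ler_powR (ltW beta0)); rewrite ?nnegrE ?(ltW r0) ?enorm_ge0.
  rewrite mulrDl mul1r; apply: (@le_trans _ _ ((r `^ beta)^-1 * enorm y `^ beta)).
    by rewrite ler_pdivlMl// mulr1.
  by rewrite lerDl powR_ge0.
by rewrite mulr1 lerDr invr_ge0 ltW.
Qed.

(** Away from the origin [mu x] is finite, with mass bounded uniformly in [x]; these sets exhaust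
    the complement of the origin. *)
Definition Dset (n : nat) : set Vb := [set y | n.+1%:R^-1 <= enorm y].

Lemma Dset_meas n : measurable (Dset n).
Proof.
rewrite -[X in measurable X]setTI.
have -> : Dset n = (@enorm R d : Vb -> R) @^-1` `[n.+1%:R^-1, +oo[.
  by apply/seteqP; split => y /=; rewrite in_itv/= andbT.
by apply: (@enorm_borel R d) => //; exact: measurable_itv.
Qed.

Definition indD (n : nat) (y : V) : R := \1_(Dset n) y.

Lemma indD_ge0 n y : 0 <= indD n y. Proof. by rewrite /indD indicE ler0n. Qed.

Lemma indD_le1 n y : indD n y <= 1. Proof. by rewrite /indD indicE; case: (_ \in _). Qed.

Lemma indD_mem n y : n.+1%:R^-1 <= enorm y -> indD n y = 1.
Proof. by move=> h; rewrite /indD indicE mem_set. Qed.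

Lemma indD_notin n y : enorm y < n.+1%:R^-1 -> indD n y = 0.
Proof. by move=> h; rewrite /indD indicE memNset//= => /le_lt_trans/(_ h); rewrite ltxx. Qed.

Lemma indD_borel n : borelf (indD n).
Proof. exact: measurable_indic (Dset_meas n). Qed.

Notation mass n := (tailc n.+1%:R^-1).

Lemma mass_ge0 n : 0 <= mass n.
Proof. by rewrite addr_ge0 ?invr_ge0 ?powR_ge0. Qed.

Lemma indD_mbeta n y : indD n y <= mass n * mbeta y.
Proof.
have [h|h] := leP n.+1%:R^-1 (enorm y); first by rewrite indD_mem// mbeta_tail.
by rewrite indD_notin// mulr_ge0 ?mbeta_ge0 ?mass_ge0.
Qed.

Lemma integ_dom_m x (g : V -> R) (K : R) : borelf g -> (forall y, `|g y| <= K * mbeta y) ->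
  integ (mu x) g.
Proof. by move=> mg gK; exact: (integ_dom mg gK (integZ K (mbeta_integ x))). Qed.

Lemma indD_dom n (g : V -> R) K y : `|g y| <= K -> `|indD n y * g y| <= K * mass n * mbeta y.
Proof.
move=> gK; rewrite normrM (ger0_norm (indD_ge0 _ _)) mulrC -mulrA.
exact: ler_pM (normr_ge0 _) (indD_ge0 _ _) gK (indD_mbeta _ _).
Qed.

Lemma integ_indD n x (g : V -> R) K : borelf g -> (forall y, `|g y| <= K) ->
  integ (mu x) (fun y => indD n y * g y).
Proof.
move=> mg gK; have mi : borelf (fun y => indD n y * g y) by exact: (measurable_funM (indD_borel n) mg).
exact: (integ_dom_m x mi (fun y => indD_dom n (gK y))).
Qed.

(** Borel dependence on [x] is given for continuous functions with compact support away from 0. The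
    indicator of [U] cut down to [Dset n] is a dominated pointwise limit of such functions. *)
Lemma mu_open_meas (n : nat) (U : set V) : open U ->
  borelf (fun x => \int[mu x]_y (indD n y * \1_U y)).
Proof.
move=> oU; pose del : R := n.+1%:R^-1.
have d0 : 0 < del by rewrite invr_gt0.
(* The first factor increases to the indicator of the open set [U]. The second is 1 from radius
   [del] on, vanishes below [del / 2] for every [k], and tends to 0 in between. The third is 1 up to
   radius [k + 1] and cuts off at radius [k + 2]. *)
pose phi (k : nat) (y : V) : R := clamp (k%:R * infdist U y) *
   (clamp (1 + k.+1%:R * ((enorm y - del) * (2 / del))) * clamp (k.+2%:R - enorm y)).
have phi0 k y : 0 <= phi k y by rewrite !mulr_ge0 ?clamp_ge0.
have phic k : continuous (phi k).
  have cl (g : V -> R) : continuous g -> continuous (fun y => clamp (g y)).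
    by move=> cg y; exact: (continuous_comp (cg y) (@continuous_clamp (g y))).
  have cc (r : R) : continuous (fun _ : V => r) by move=> y; exact: (@cst_continuous _ _ r y).
  have cD (g h : V -> R) : continuous g -> continuous h -> continuous (fun y => g y + h y).
    by move=> cg ch y; exact: (continuousD (cg y) (ch y)).
  have cM (g h : V -> R) : continuous g -> continuous h -> continuous (fun y => g y * h y).
    by move=> cg ch y; exact: (continuousM (cg y) (ch y)).
  have cN (g : V -> R) : continuous g -> continuous (fun y => - g y).
    by move=> cg y; exact: (continuousN (cg y)).
  have ce := @continuous_enorm R d; have ci := @infdist_continuous U.
  apply: (cM); first by apply: (cl); apply: (cM).
  apply: (cM); apply: (cl); last by apply: (cD) => //; exact: cN.
  by apply: (cD) => //; apply: (cM) => //; apply: (cM) => //; exact: (cD).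
have small k y : enorm y <= del / 2 -> phi k y = 0.
  move=> yd; rewrite /phi [clamp (1 + _)]clamp0 ?mul0r ?mulr0//.
  have h : (enorm y - del) * (2 / del) <= - 1.
    rewrite -ler_pdivlMr ?divr_gt0// invf_div mulN1r; lra.
  have h2 : k.+1%:R * ((enorm y - del) * (2 / del)) <= k.+1%:R * (- 1 : R) by rewrite ler_wpM2l.
  have : (1 : R) <= k.+1%:R by rewrite ler1n.
  by move: h2; rewrite mulrN1; lra.
have Cphi k : Cc0 (phi k).
  split => //; exists [set y : V | del / 2 <= enorm y <= k.+2%:R]; split; [|split].
  - apply: bounded_closed_compact.
      exists k.+2%:R; split; first exact: num_real.
      move=> M kM y /= /andP[_ yk]; apply: (le_trans (norm_le_enorm y)).
      by rewrite (le_trans yk)// ltW.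
    rewrite (_ : [set y | _] = (@enorm R d) @^-1` `[del / 2, k.+2%:R]).
      by apply: closed_comp => [y _|]; [exact: continuous_enorm|exact: itv_closed].
    by apply/seteqP; split => y /=; rewrite in_itv.
  - move=> y /= /andP[h _] y0; rewrite y0 enorm0 in h.
    by have := lt_le_trans (divr_gt0 d0 (ltr0Sn _ 1)) h; rewrite ltxx.
  - move=> y /= /negP; rewrite negb_and -!ltNge => /orP[h|h]; first by rewrite small// ltW.
    by rewrite /phi [clamp (_ - _)]clamp0 ?mulr0// subr_le0 ltW.
have phib k y : `|phi k y| <= tailc (del / 2) * mbeta y.
  rewrite ger0_norm//; have [h|h] := leP (enorm y) (del / 2).
    by rewrite small// mulr_ge0 ?mbeta_ge0// addr_ge0 ?invr_ge0 ?powR_ge0.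
  apply: (@le_trans _ _ 1); last by apply: mbeta_tail; [rewrite divr_gt0|exact: ltW].
  by rewrite !mulr_ile1 ?mulr_ge0 ?clamp_ge0 ?clamp_le1// mulr_ile1 ?clamp_ge0 ?clamp_le1.
have cphi y : phi k y @[k --> \oo] --> indD n y * \1_U y.
  have large (a : R) : exists k0, forall k, (k0 <= k)%N -> a <= k%:R.
    exists (Num.truncn `|a|).+1 => k kk; apply: (le_trans (ler_norm _)).
    by rewrite ltW// (lt_le_trans (truncnS_gt _))// ler_nat.
  have evc (l : R) k0 : (forall k, (k0 <= k)%N -> phi k y = l) -> phi k y @[k --> \oo] --> l.
    move=> H; apply/cvgrPdist_le => e e0; exists k0 => // k /= kk.
    by rewrite H// subrr normr0 ltW.
  have [Uy|Uy] := pselect (U y); last first.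
    rewrite indicE memNset// mulr0; apply: (evc _ 0%N) => k _.
    by rewrite /phi infdist_out// mulr0 clamp0// mul0r.
  rewrite indicE mem_set// mulr1.
  have [h|h] := leP del (enorm y).
    rewrite indD_mem//; have g0 := infdist_in oU Uy.
    have [k1 H1] := large (infdist U y)^-1; have [k2 H2] := large (enorm y).
    apply: (evc _ (maxn k1 k2)) => k; rewrite geq_max => /andP[kk1 kk2].
    rewrite /phi !clamp1 ?mulr1//.
    - by have := H2 k kk2; rewrite -natr1 -[k.+1%:R]natr1; lra.
    - by rewrite lerDl mulr_ge0// mulr_ge0 ?subr_ge0// divr_ge0// ltW.
    - by rewrite -ler_pdivrMr// mul1r; exact: H1.
  rewrite indD_notin//.
  pose z := (del - enorm y) * (2 / del).
  have z0 : 0 < z by rewrite mulr_gt0 ?subr_gt0// divr_gt0.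
  have [k1 H1] := large z^-1.
  apply: (evc _ k1) => k kk; rewrite /phi [clamp (1 + _)]clamp0 ?mul0r ?mulr0//.
  have -> : (enorm y - del) * (2 / del) = - z by rewrite /z -mulNr opprB.
  have : 1 <= k%:R * z by rewrite -ler_pdivrMr// mul1r; exact: H1.
  by rewrite mulrN -natr1 mulrDl mul1r; lra.
apply: (@measurable_fun_cvg _ Vb _ _ (fun k x => \int[mu x]_y phi k y)).
  move=> k; exact: (measurableT_comp (fine_measurable measurableT) (mu_Cc0 (Cphi k))).
move=> x _; exact: (Rint_dct (fun k => continuous_borelf (phic k)) cphi phib (integZ _ (mbeta_integ x))).
Qed.

(** Dynkin's argument, starting from the open sets. The factor [indD n] makes the measures finite,
    as the complement step requires. *)
Lemma mu_borel_meas (n : nat) (S : set Vb) : measurable S ->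
  borelf (fun x => \int[mu x]_y (indD n y * \1_S y)).
Proof.
have iS x (A : set Vb) : measurable A -> integ (mu x) (fun y => indD n y * \1_A y).
  move=> mS; apply: (@integ_indD _ _ _ 1) => [|y]; first exact: measurable_indic.
  by rewrite indicE; case: (_ \in _); rewrite ?normr0 ?normr1.
move=> mS; move: S mS; apply: (@dynkin_induction _ Vb (@open V)
   (fun S => borelf (fun x => \int[mu x]_y (indD n y * \1_S y)))) => //.
- exact: openI.
- by apply: mu_open_meas; exact: openT.
- by move=> U oU; exact: mu_open_meas.
- move=> S mS PS.
  have -> : (fun x => \int[mu x]_y (indD n y * \1_(~` S) y)) =
     (fun x => \int[mu x]_y (indD n y * \1_(setT : set Vb) y) - \int[mu x]_y (indD n y * \1_S y)).
    apply/funext => x; rewrite -RintB; [|exact: iS..].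
    by apply: eq_Rintegral => y _; rewrite !indicE in_setT in_setC; case: (y \in S); rewrite /=; ring.
  by apply: measurable_funB => //; apply: mu_open_meas; exact: openT.
- move=> F mF tF PF.
  have cF y : \sum_(0 <= i < k) (\1_(F i) y : R) @[k --> \oo] --> (\1_(\bigcup_k F k) y : R).
    exact: indic_bigcup_cvg.
  apply: (@measurable_fun_cvg _ Vb _ _ (fun k x => \int[mu x]_y (indD n y * \sum_(0 <= i < k) \1_(F i) y))).
    move=> k.
    have isum x (r : seq nat) : integ (mu x) (fun y => indD n y * \sum_(i <- r) \1_(F i) y) /\
       \int[mu x]_y (indD n y * \sum_(i <- r) \1_(F i) y) = \sum_(i <- r) \int[mu x]_y (indD n y * \1_(F i) y).
      elim: r => [|i r [IH1 IH2]].
        rewrite (_ : (fun y => _) = (fun=> 0)); last by apply/funext => y; rewrite big_nil mulr0.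
        rewrite Rint0 big_nil; split => //.
        by have := integZ 0 (mbeta_integ x); under eq_fun do rewrite mul0r.
      have e : (fun y => indD n y * \sum_(j <- i :: r) \1_(F j) y) =
        (fun y => indD n y * \1_(F i) y + indD n y * \sum_(j <- r) \1_(F j) y).
        by apply/funext => y; rewrite big_cons mulrDr.
      have iFi := iS x (F i) (mF i).
      split; first by rewrite e; exact: (integD iFi IH1).
      by rewrite e big_cons (RintD iFi IH1) IH2.
    under eq_fun do rewrite (isum _ _).2.
    by apply: measurable_sum => i; exact: PF.
  move=> x _.
  have mk k : measurable_fun (setT : set Vb) (fun y => indD n y * \sum_(0 <= i < k) \1_(F i) y).
    apply: measurable_funM; first exact: indD_borel.
    by apply: measurable_sum => i; exact: measurable_indic.
  have ck y : indD n y * \sum_(0 <= i < k) \1_(F i) y @[k --> \oo] --> indD n y * \1_(\bigcup_k F k) y.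
    by apply: cvgMr; exact: cF.
  have bk k y : `|indD n y * \sum_(0 <= i < k) \1_(F i) y| <= 1 * mass n * mbeta y.
    apply: (@indD_dom n (fun y => \sum_(0 <= i < k) \1_(F i) y)).
    exact: indic_sum_le1.
  exact: (Rint_dct mk ck bk (integZ _ (mbeta_integ x))).
Qed.

End LevyKernel.

(** * The large jumps as a finite kernel *)

Section LevyPerturbation.
Context (R : realType) (d : nat).
Notation V := (V R d).
Notation Vb := (Vb R d).
Variables (mu : V -> {measure set Vb -> \bar R}) (beta C : R).
Hypothesis mu_Cc0 : forall f, Cc0 f ->
     measurable_fun (setT : set (Vb)) (fun x => (\int[mu x]_y (f y)%:E)%E).
Hypothesis beta0 : 0 < beta.
Hypothesis mu_C : forall x, (\int[mu x]_y (Num.min ((enorm y) `^ beta) 1)%:E <= C%:E)%E.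
Notation mass n := (tailc beta n.+1%:R^-1).
Notation mb := (mbeta beta).

Let C0 : 0 <= C := C_ge0 mu_C.

Lemma mass_C_ge0 n : 0 <= C * mass n.
Proof. by rewrite mulr_ge0// mass_ge0. Qed.

Lemma sfun_intD n x : sfun (C * mass n) (fun g => \int[mu x]_y (indD n y * g y)).
Proof.
have iD (g : V -> R) : Bb g -> integ (mu x) (fun y => indD n y * g y).
  by move=> [mg [K gK]]; exact: (integ_indD beta0 mu_C n x mg gK).
split.
- move=> k f g Bf Bg; rewrite -Rint_linear; [|exact: iD..].
  by apply: eq_Rintegral => y _; ring.
- move=> f c Bf fc.
  have ia := integZ (c * mass n) (mbeta_integ mu_C x).
  apply: (le_trans (Rint_le_norm (integ_meas (iD f Bf)) (fun y => indD_dom beta0 n (fc y)) ia)).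
  rewrite RintZ; last exact: mbeta_integ mu_C x.
  have c0 : 0 <= c by rewrite (le_trans _ (fc 0)).
  rewrite [X in _ <= X](_ : _ = c * mass n * C); last by ring.
  by apply: ler_wpM2l; [rewrite mulr_ge0// mass_ge0|exact: mbeta_int_le].
- move=> fn f c Bn bn cf.
  have ia := integZ (c * mass n) (mbeta_integ mu_C x).
  have ck y : indD n y * fn m y @[m --> \oo] --> indD n y * f y by apply: cvgMr; exact: cf.
  exact: (Rint_dct (fun m => integ_meas (iD _ (Bn m))) ck (fun m y => indD_dom beta0 n (bn m y)) ia).
Qed.

Section RestrictedKernel.
Variable n : nat.

Definition restr_ker (x : Vb) : {measure set Vb -> \bar R} := mrestr (mu x) (@Dset_meas R d n).

Lemma restr_kerE x A : measurable A -> restr_ker x A = (\int[mu x]_y (indD n y * \1_A y))%:E.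
Proof.
move=> mA; have BA : Bb (\1_A : V -> R) by exact: Bb_indic.
have iA : integ (mu x) (fun y => indD n y * \1_A y).
  by move: BA => [mg [K gK]]; exact: (integ_indD beta0 mu_C n x mg gK).
rewrite /Rintegral fineK; last exact: (integrable_fin_num measurableT iA).
rewrite (eq_integral (fun y => (\1_(A `&` Dset n) y)%:E)); last first.
  by move=> y _; rewrite indicI /indD mulrC.
by rewrite integral_indic ?setIT//; apply: measurableI => //; exact: Dset_meas.
Qed.

Let ker_meas A : measurable A -> measurable_fun (setT : set Vb) (fun x => restr_ker x A).
Proof.
move=> mA; rewrite (_ : (fun x => _) = EFin \o (fun x => \int[mu x]_y (indD n y * \1_A y))).
  by apply/measurable_EFinP; exact: (mu_borel_meas mu_Cc0 beta0 mu_C).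
by apply/funext => x; rewrite restr_kerE.
Qed.

HB.instance Definition _ := isKernel.Build _ _ _ _ R restr_ker ker_meas.

Let ker_le x : (restr_ker x setT <= (C * mass n)%:E)%E.
Proof.
rewrite restr_kerE// lee_fin (le_trans (ler_norm _))//.
rewrite -[leRHS]mulr1; apply: (sfun_bnd (sfun_intD n x)); first exact: Bb_indic.
by move=> y; rewrite indicE; case: (_ \in _); rewrite ?normr0 ?normr1.
Qed.

Let ker_fin : measure_fam_uub restr_ker.
Proof.
exists (C * mass n + 1) => x; apply: (le_lt_trans (ker_le x)).
by rewrite lte_fin ltrDl.
Qed.

HB.instance Definition _ := Kernel_isFinite.Build _ _ _ _ R restr_ker ker_fin.

Lemma restr_ker_int x g : Bb g -> \int[restr_ker x]_y g y = \int[mu x]_y (indD n y * g y).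
Proof.
apply: (sfun_ext (sfun_meas (ker_le x)) (sfun_intD n x)) => A mA.
rewrite /Rintegral integral_indic// setIT restr_kerE//.
Qed.

Lemma meas_intD (F : Vb * Vb -> R) K : measurable_fun setT F -> (forall p, `|F p| <= K) ->
  borelf (fun x => \int[mu x]_y (indD n y * F (x, y))).
Proof.
move=> mF FK.
have BF x : Bb (fun y => F (x, y)).
  by split; [exact: (measurableT_comp mF (measurable_pair1 x))|exists K].
(* Adding the bound [K] makes the integrand nonnegative, as the measurability theorem for kernels
   demands; finiteness of the kernel allows the constant to be subtracted afterwards. *)
have m1 : measurable_fun (setT : set Vb) (fun x => \int[restr_ker x]_y (F (x, y) + K)).
  apply: (measurableT_comp (fine_measurable measurableT)).
  apply: (@measurable_fun_integral_finite_kernel _ _ _ _ _ (fun p => (F p + K)%:E) restr_ker).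
    by move=> p; rewrite lee_fin -lerBlDr sub0r; move: (FK p); rewrite ler_norml => /andP[].
  by apply/measurable_EFinP; exact: measurable_funD.
have m2 : measurable_fun (setT : set Vb) (fun x => \int[restr_ker x]_y K).
  apply: (measurableT_comp (fine_measurable measurableT)).
  apply: (@measurable_fun_integral_finite_kernel _ _ _ _ _ (fun p => K%:E) restr_ker) => //.
  by move=> p; rewrite lee_fin (le_trans _ (FK p)).
rewrite (_ : (fun x => _) = (fun x => \int[restr_ker x]_y (F (x, y) + K) - \int[restr_ker x]_y K)).
  exact: measurable_funB.
apply/funext => x; rewrite -restr_ker_int; last exact: BF.
rewrite RintD ?addrK//; first exact: (integ_Bb (ker_le x) (BF x)).
exact: (integ_cst (ker_le x) K).
Qed.

End RestrictedKernel.
End LevyPerturbation.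

(** * The Levy operator *)

Section Vanishing.
Context (R : realType) (d : nat).
Notation V := (V R d).

(** The decay half of [Cinf], without continuity: [B f] is merely Borel, so [Cinf] itself is not
    stable under the steps of the Picard iteration. *)
Definition vanish (f : V -> R) :=
  forall e : R, 0 < e -> exists r : R, forall x, r < enorm x -> `|f x| < e.

(** The triangle inequality is used in the max norm; the factor [d] pays for the passage to the
    Euclidean norm. *)
Lemma enorm_shift_large (r s : R) (x y : V) :
  d%:R * (r + s) < enorm x -> enorm y <= s -> r < enorm (x + y).
Proof.
move=> h ys; rewrite ltNge; apply/negP => hr; move: h; apply/negP; rewrite -leNgt.
apply: (le_trans (enorm_le_norm x)); apply: ler_wpM2l => //.
rewrite -[x in `|x|](addrK y); apply: (le_trans (ler_normB _ _)); apply: lerD.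
  exact: le_trans (norm_le_enorm _) hr.
exact: le_trans (norm_le_enorm _) ys.
Qed.

Lemma vanish_unif (fn : nat -> V -> R) (f : V -> R) (e : nat -> R) :
  (forall n, vanish (fn n)) -> (forall n x, `|fn n x - f x| <= e n) ->
  e n @[n --> \oo] --> 0 -> vanish f.
Proof.
move=> vf fe ce z z0; have z2 : 0 < z / 2 by rewrite divr_gt0.
have /cvgrPdist_lt/(_ _ z2)[n _ /(_ n (leqnn n))] := ce.
rewrite /= sub0r normrN => en; have [r Hr] := vf n _ z2.
exists r => x /Hr fx; rewrite -[f x](subKr (fn n x)).
apply: (le_lt_trans (ler_normB _ _)); rewrite [z]splitr ltrD//.
exact: le_lt_trans (fe n x) (le_lt_trans (ler_norm _) en).
Qed.

(** The sequential form makes decay at infinity accessible to dominated convergence. *)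
Lemma vanish_seqP (f : V -> R) : vanish f <->
  forall u : nat -> V, enorm (u n) @[n --> \oo] --> +oo -> f (u n) @[n --> \oo] --> 0.
Proof.
split=> [vf u /cvgryPgt cu|H e e0].
  apply/cvgrPdist_lt => e e0; have [r Hr] := vf _ e0.
  by near=> n; rewrite sub0r normrN; apply: Hr; near: n; exact: cu.
apply: contrapT => N.
have ex n : exists x : V, n%:R < enorm x /\ e <= `|f x|.
  apply: contrapT => N2; apply: N; exists n%:R => x nx; rewrite ltNge; apply/negP => ef.
  by apply: N2; exists x.
have [u Hu] := choice ex.
have cu : enorm (u n) @[n --> \oo] --> +oo.
  apply/cvgryPgt => A; exists (Num.truncn `|A|).+1 => // n /= kn.
  apply: (le_lt_trans (ler_norm A)); apply: lt_trans (Hu n).1.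
  by rewrite (lt_le_trans (truncnS_gt _))// ler_nat.
have /cvgrPdist_lt/(_ _ e0)[n _ /(_ n (leqnn n))] := H u cu.
by rewrite /= sub0r normrN ltNge (Hu n).2.
Unshelve. all: by end_near. Qed.

End Vanishing.

(** * Approximation of the Levy operator by bounded jump operators *)

Section LevyOperator.
Context (R : realType) (d : nat).
Notation V := (V R d).
Notation Vb := (Vb R d).
Variables (mu : V -> {measure set Vb -> \bar R}) (beta C rho bb : R) (chi : V -> R) (b : V -> V).
Hypothesis mu_Cc0 : forall f, Cc0 f ->
     measurable_fun (setT : set (Vb)) (fun x => (\int[mu x]_y (f y)%:E)%E).
Hypothesis beta0 : 0 < beta.
Hypothesis mu_C : forall x, (\int[mu x]_y (Num.min ((enorm y) `^ beta) 1)%:E <= C%:E)%E.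
Hypothesis rho0 : 0 < rho.
Hypothesis beta_al : beta < al rho.
Hypothesis chi_borel : borelf chi.
Hypothesis chi_bnd : forall y, \1_[set z | enorm z < 1] y <= chi y <= \1_[set z | enorm z < 2] y.
Hypothesis b_borel : forall i, borelf (fun x => b x 0 i).
Hypothesis b_bnd : forall x, enorm (b x) <= bb.
Notation mass n := (tailc beta n.+1%:R^-1).
Notation mb := (mbeta beta).
Notation grad := (grad rho).
Notation hreg := (hreg rho).

Let C0 : 0 <= C := C_ge0 mu_C.

Let bb0 : 0 <= bb. Proof. exact: le_trans (enorm_ge0 _) (b_bnd 0). Qed.

Lemma chi01 y : 0 <= chi y <= 1.
Proof.
have /andP[h1 h2] := chi_bnd y; apply/andP; split.
  by apply: le_trans h1; rewrite indicE ler0n.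
by apply: (le_trans h2); rewrite indicE; case: (_ \in _).
Qed.

Lemma chi_in y : enorm y < 1 -> chi y = 1.
Proof.
move=> y1; have /andP[h1 _] := chi_bnd y; apply/le_anti.
by have /andP[_ ->] := chi01 y; move: h1; rewrite indicE mem_set.
Qed.

Lemma chi_out y : 2 <= enorm y -> chi y = 0.
Proof.
move=> y1; have /andP[_ h1] := chi_bnd y; apply/le_anti.
have /andP[-> _] := chi01 y; move: h1; rewrite indicE memNset ?andbT//= => h.
by have := le_lt_trans y1 h; rewrite ltxx.
Qed.

Lemma chi_enorm y : enorm y * chi y <= 2.
Proof.
have [h|h] := leP 2 (enorm y); first by rewrite chi_out// mulr0.
have /andP[c0 c1] := chi01 y.
apply: (le_trans (ler_pM (enorm_ge0 y) c0 (ltW h) c1)); by rewrite mulr1.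
Qed.

Definition truncated (f : V -> R) (x y : V) : R :=
  f (x + y) - f x - (\sum_i y 0 i * grad i f x) * chi y.

Lemma sum_coord_le (y : V) (p : 'I_d -> R) c : (forall i, `|p i| <= c) ->
  `|\sum_i y 0 i * p i| <= d%:R * (enorm y * c).
Proof.
move=> pc; apply: (le_trans (ler_norm_sum _ _ _)).
have -> : d%:R * (enorm y * c) = \sum_(i < d) enorm y * c.
  by rewrite sumr_const card_ord mulr_natl.
apply: ler_sum => i _; rewrite normrM; apply: ler_pM => //; exact: coord_le_enorm.
Qed.

Let p1 (a : R) : 1 `^ a = 1. Proof. by rewrite powR1. Qed.

(** Of the order [al] of the Taylor remainder, [beta] is spent on integrability against [mu x]; the
    surplus [al - beta] is the gain from keeping only jumps shorter than [r]. *)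
Lemma truncated_small f c x y r : hreg c f -> enorm y < r -> r <= 1 ->
  `|truncated f x y| <= c * r `^ (al rho - beta) * mb y.
Proof.
move=> [fc gc H] yr r1; have y1 := lt_le_trans yr r1.
have c0 : 0 <= c by rewrite (le_trans _ (fc 0)).
have y0 := enorm_ge0 y.
rewrite /truncated chi_in// mulr1; apply: (le_trans (H x y)).
rewrite -mulrA; apply: ler_wpM2l => //.
have -> : mb y = enorm y `^ beta.
  apply: min_idPl; rewrite -(p1 beta) (ge0_ler_powR (ltW beta0))// ?nnegrE// ltW//.
have ab : al rho = (al rho - beta) + beta by rewrite subrK.
have [/eqP e0|e0] := boolP (enorm y == 0).
  by rewrite e0 !powR0 ?mulr0// gt_eqF// al_gt0.
rewrite [in leLHS]ab powRD; last by rewrite e0 implybT.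
apply: ler_wpM2r; first exact: powR_ge0.
have r0 : 0 <= r by rewrite (le_trans y0)// ltW.
by apply: ge0_ler_powR; rewrite ?nnegrE// ?subr_ge0 ltW.
Qed.

Lemma truncated_le f c x y : hreg c f -> `|truncated f x y| <= c * (2 + 2 * d%:R) * mb y.
Proof.
move=> Hf; have [fc gc _] := Hf.
have c0 : 0 <= c by rewrite (le_trans _ (fc 0)).
have d0 : (0 : R) <= d%:R by exact: ler0n.
have [y1|y1] := ltP (enorm y) 1.
  apply: (le_trans (truncated_small x Hf y1 (lexx _))); rewrite p1 mulr1.
  rewrite -mulrA; apply: ler_wpM2l => //; rewrite ler_peMl ?mbeta_ge0//; lra.
have -> : mb y = 1.
  apply: min_idPr; rewrite -(p1 beta) (ge0_ler_powR (ltW beta0))// ?nnegrE//.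
  exact: enorm_ge0.
rewrite mulr1 /truncated.
have h1 := ler_normB (f (x + y) - f x) ((\sum_i y 0 i * grad i f x) * chi y).
have h2 := ler_normB (f (x + y)) (f x).
have h3 : `|(\sum_i y 0 i * grad i f x) * chi y| <= d%:R * (2 * c).
  have /andP[c01 _] := chi01 y; rewrite normrM (ger0_norm c01).
  apply: (le_trans (ler_wpM2r c01 (sum_coord_le y (gc ^~ x)))).
  rewrite [leLHS](_ : _ = d%:R * (enorm y * chi y * c)); last by ring.
  by apply: ler_wpM2l => //; apply: ler_wpM2r => //; exact: chi_enorm.
have h4 := fc (x + y); have h5 := fc x.
apply: (le_trans h1); have -> : c * (2 + 2 * d%:R) = (c + c) + d%:R * (2 * c) by ring.
by apply: lerD => //; apply: (le_trans h2); exact: lerD.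
Qed.

Lemma shift_borel (f : V -> R) (x : V) : borelf f -> borelf (fun y => f (x + y)).
Proof.
move=> mf; have ms : measurable_fun setT ((fun y => x + y) : Vb -> Vb).
  apply: meas_coords => i.
  rewrite (_ : (fun _ => _) = (fun y : V => x 0 i + y 0 i)); last by apply/funext => y; rewrite mxE.
  by apply: measurable_funD => //; exact: coord_borel.
exact: (measurableT_comp mf ms).
Qed.

Lemma Bb_shift (f : V -> R) (x : V) : Bb f -> Bb (fun y => f (x + y)).
Proof. by move=> [mf [K fK]]; split; [exact: shift_borel|exists K]. Qed.

Lemma coord_chi_borel (i : 'I_d) : borelf (fun y : V => y 0 i * chi y).
Proof. by apply: measurable_funM => //; exact: coord_borel. Qed.

Lemma coord_chi_le (i : 'I_d) (y : V) : `|y 0 i * chi y| <= 2.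
Proof.
have /andP[c01 _] := chi01 y; rewrite normrM (ger0_norm c01); apply: le_trans (chi_enorm y).
by apply: ler_wpM2r => //; exact: coord_le_enorm.
Qed.

Lemma truncated_borel f x : borelf f -> borelf (truncated f x).
Proof.
move=> mf; apply: measurable_funB; first by apply: measurable_funB => //; exact: shift_borel.
apply: measurable_funM => //; apply: measurable_sum => i.
by apply: measurable_funM => //; exact: coord_borel.
Qed.

Lemma integ_truncated f c x : hreg c f -> integ (mu x) (truncated f x).
Proof.
move=> Hf; apply: (integ_dom_m mu_C x (K := c * (2 + 2 * d%:R))).
  apply: truncated_borel; apply: continuous_borelf; exact: hreg_continuous Hf.
by move=> y; exact: truncated_le.
Qed.

(** The integrand vanishes at the origin, so the integral may be taken over the whole space. Since
    [grad] is zero for [rho <= 1], the compensated formula then reduces to the pure jump form. *)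
Lemma BhatE f c x : hreg c f ->
  Bhat rho b chi mu f x = \sum_i b x 0 i * grad i f x + \int[mu x]_y truncated f x y.
Proof.
move=> Hf.
have RT (g : V -> R) : g 0 = 0 -> Rintegral (mu x) (~` [set 0]) g = \int[mu x]_y g y.
  move=> g0; rewrite Rintegral_mkcond; apply: eq_Rintegral => y _.
  rewrite patchE; case: ifPn => //; rewrite notin_setE /= => /contrapT ->.
  by rewrite g0.
rewrite /Bhat; have [r1|r1] := leP rho 1.
  rewrite big1 ?add0r; last by move=> i _; rewrite grad_le1// mulr0.
  rewrite RT; last by rewrite addr0 subrr.
  apply: eq_Rintegral => y _; rewrite /truncated big1 ?mul0r ?subr0// => i _.
  by rewrite grad_le1// mulr0.
have ge i : grad i f x = partial i f x by exact: grad_gt1.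
congr (_ + _); first by apply: eq_bigr => i _; rewrite ge.
rewrite RT.
  by apply: eq_Rintegral => y _; rewrite /truncated; under [in RHS]eq_bigr do rewrite ge.
by rewrite addr0 subrr big1 ?mul0r ?subr0// => i _; rewrite mxE mul0r.
Qed.

(** Once the small jumps are dropped, the compensator of the others is a finite integral and can be
    merged with [b]. It is controlled through [mass n] and may grow with [n]. *)
Definition drift (n : nat) (x : V) : V := \row_i
  (if rho <= 1 then 0 else b x 0 i - \int[mu x]_y (indD n y * (y 0 i * chi y))).

Lemma drift_borel n (i : 'I_d) : borelf (fun x => drift n x 0 i).
Proof.
rewrite (_ : (fun x => _) = (fun x => if rho <= 1 then 0 else
   b x 0 i - \int[mu x]_y (indD n y * (y 0 i * chi y)))); last by apply/funext => x; rewrite mxE.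
case: (rho <= 1); first exact: measurable_cst.
apply: measurable_funB; first exact: (b_borel i).
have mF : measurable_fun setT (fun p : Vb * Vb => p.2 0 i * chi p.2).
  exact: (measurableT_comp (coord_chi_borel i) measurable_snd).
exact: (meas_intD mu_Cc0 beta0 mu_C n mF (fun p => coord_chi_le i p.2)).
Qed.

Definition driftbd n : R := d%:R * (bb + C * mass n * 2).

Lemma coord_chi_Bb (i : 'I_d) : Bb (fun y : V => y 0 i * chi y).
Proof. by split; [exact: coord_chi_borel|exists 2 => y; exact: coord_chi_le]. Qed.

Lemma drift_bnd n x : enorm (drift n x) <= driftbd n.
Proof.
have mC := mass_C_ge0 mu_C n.
apply: (le_trans (enorm_le_sum _)).
have -> : driftbd n = \sum_(i < d) (bb + C * mass n * 2) by rewrite sumr_const card_ord /driftbd mulr_natl.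
apply: ler_sum => i _; rewrite mxE; case: ifP => _; first by rewrite normr0 addr_ge0// mulr_ge0.
apply: (le_trans (ler_normB _ _)); apply: lerD.
  exact: le_trans (coord_le_enorm _ _) (b_bnd x).
exact: (sfun_bnd (sfun_intD beta0 mu_C n x) (coord_chi_Bb i) (coord_chi_le i)).
Qed.

(** [k] is the inverse step of a difference quotient along a drift of length [h], whose error is of
    order [k * (h / k)] with the quotient raised to the power [al]. For [rho > 1] also [al > 1], and
    a step chosen small in terms of [driftbd n] brings the error below [1 / (n + 1)]. *)
Lemma scale_exists n : exists k : R, 0 < k /\
  (1 < rho -> forall h, 0 <= h <= driftbd n -> k * (k^-1 * h) `^ al rho <= n.+1%:R^-1).
Proof.
have [r1|r1] := leP rho 1; first by exists 1.
have a1 : 0 < al rho - 1 by rewrite subr_gt0 al_gt1.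
have n0 : 0 < n.+1%:R^-1 :> R by rewrite invr_gt0.
have [del d0 H] := powR_small (driftbd n `^ al rho) a1 n0.
pose h0 := del / 2; have h00 : 0 < h0 by rewrite divr_gt0.
exists h0^-1; split=> [|_ h /andP[hh hv]]; first by rewrite invr_gt0.
apply: le_trans (H h0 _); last by rewrite ltW//= ltr_pdivrMr// ltr_pMr// ltr1n.
rewrite invrK powRM//; last exact: ltW.
have -> : h0 `^ al rho = h0 `^ (al rho - 1) * h0.
  by rewrite -[X in _ = _ * X](powRr1 (ltW h00)) -powRD ?subrK// (gt_eqF h00) implybT.
rewrite [leLHS](_ : _ = h `^ al rho * h0 `^ (al rho - 1) * (h0^-1 * h0)); last by ring.
rewrite mulVf ?gt_eqF// mulr1; apply: ler_wpM2r; first exact: powR_ge0.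
apply: ge0_ler_powR; rewrite ?nnegrE//; first exact: ltW (al_gt0 rho0).
exact: le_trans hv.
Qed.

Definition scale n : R := sval (cid (scale_exists n)).

Lemma scale_gt0 n : 0 < scale n. Proof. exact: (svalP (cid (scale_exists n))).1. Qed.

Lemma scale_small n h : 1 < rho -> 0 <= h <= driftbd n ->
  scale n * ((scale n)^-1 * h) `^ al rho <= n.+1%:R^-1.
Proof. by move=> r1; exact: (svalP (cid (scale_exists n))).2. Qed.

(* The drift is replaced by a difference quotient along [drift n] and the small
   jumps are removed: the result is bounded on bounded Borel functions and, up
   to a multiple of the identity, positive. *)
Definition Bn n (f : V -> R) x := scale n * (f (x + (scale n)^-1 *: drift n x) - f x) +
  \int[mu x]_y (indD n y * (f (x + y) - f x)).

Notation jumps n x := (fun g => \int[mu x]_y (indD n y * g y)).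

Lemma jumps1 n x : 0 <= jumps n x (fun=> 1) <= C * mass n.
Proof.
apply/andP; split; first by apply: Rintegral_ge0 => y _; rewrite mulr1 indD_ge0.
rewrite -[leRHS]mulr1; apply: (le_trans (ler_norm _)).
by apply: (sfun_bnd (sfun_intD beta0 mu_C n x) (Bb_cst d 1)) => y; rewrite normr1.
Qed.

Lemma jumpsE n x f : Bb f ->
  \int[mu x]_y (indD n y * (f (x + y) - f x)) = jumps n x (fun y => f (x + y)) - f x * jumps n x (fun=> 1).
Proof.
move=> Bf; have sL := sfun_intD beta0 mu_C n x.
transitivity (jumps n x (fun y => f (x + y) - f x * 1)).
  by apply: eq_Rintegral => y _; rewrite mulr1.
by rewrite (sfunB sL (Bb_shift x Bf) (BbZ (f x) (Bb_cst d 1))) (sfunZ sL (f x) (Bb_cst d 1)).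
Qed.

Lemma sfun_Bn n x : sfun (2 * (scale n + C * mass n)) (fun f => Bn n f x).
Proof.
have k0 := scale_gt0 n; have /andP[j0 j1] := jumps1 n x.
have s1 := sfun_comb (scale n) (- scale n) (sfun_eval (x + (scale n)^-1 *: drift n x)) (sfun_eval x).
have s2 := sfun_comp_Bb (fun f Bf => Bb_shift x Bf) (sfun_intD beta0 mu_C n x).
have s3 := sfun_comb 1 (- jumps n x (fun=> 1)) s2 (sfun_eval x).
have s4 := sfun_comb 1 1 s1 s3.
apply: (sfun_le _ (sfun_eq _ s4)) => [|f Bf].
  rewrite !normrN !normr1 !mul1r !mulr1 (ger0_norm j0) (gtr0_norm k0); lra.
by rewrite /Bn jumpsE// /comp; ring.
Qed.

Lemma Bn_borel n f : Cb f -> borelf (Bn n f).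
Proof.
move=> Cf; have [cf [K fK]] := Cf; have mf := continuous_borelf cf.
apply: measurable_funD.
  apply: measurable_funM => //; apply: measurable_funB => //.
  have ms : measurable_fun setT ((fun x => x + (scale n)^-1 *: drift n x) : Vb -> Vb).
    apply: meas_coords => i.
    rewrite (_ : (fun _ => _) = (fun x : V => x 0 i + (scale n)^-1 * drift n x 0 i)).
      apply: measurable_funD; first exact: coord_borel.
      by apply: measurable_funM => //; exact: drift_borel.
    by apply/funext => y; rewrite 2!mxE.
  exact: (measurableT_comp mf ms).
have ms : measurable_fun setT ((fun p => p.1 + p.2) : Vb * Vb -> Vb).
  apply: meas_coords => i.
  rewrite (_ : (fun _ => _) = (fun p : Vb * Vb => p.1 0 i + p.2 0 i)); last by apply/funext => y; rewrite mxE.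
  apply: measurable_funD; first exact: (measurableT_comp (coord_borel i) measurable_fst).
  exact: (measurableT_comp (coord_borel i) measurable_snd).
have mF : measurable_fun setT (fun p : Vb * Vb => f (p.1 + p.2) - f p.1).
  apply: measurable_funB; [exact: (measurableT_comp mf ms)|exact: (measurableT_comp mf measurable_fst)].
have hK (p : Vb * Vb) : `|f (p.1 + p.2) - f p.1| <= K + K.
  by apply: (le_trans (ler_normB _ _)); exact: lerD.
exact: (meas_intD mu_Cc0 beta0 mu_C n mF hK).
Qed.

(** The first term is the error of the difference quotient, the second that of the discarded
    jumps. *)
Definition apx_err n : R := n.+1%:R^-1 + C * n.+1%:R^-1 `^ (al rho - beta).

Lemma apx_err_cvg0 : apx_err n @[n --> \oo] --> 0.
Proof.
rewrite -[X in _ --> X]addr0; apply: cvgD; first exact: cvg_harmonic.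
apply: powR_seq0; [by rewrite subr_gt0|by move=> n; rewrite invr_ge0|exact: cvg_harmonic].
Qed.

Lemma apx_err_le n : 0 <= apx_err n <= 1 + C.
Proof.
have n0 : 0 <= n.+1%:R^-1 :> R by rewrite invr_ge0.
have n1 : n.+1%:R^-1 <= 1 :> R by rewrite invf_le1// ler1n.
have ab : 0 <= al rho - beta by rewrite subr_ge0 ltW.
have h : n.+1%:R^-1 `^ (al rho - beta) <= 1 :> R.
  by rewrite -[leRHS](p1 (al rho - beta)); apply: ge0_ler_powR; rewrite ?nnegrE.
apply/andP; split; first by rewrite addr_ge0 ?mulr_ge0 ?powR_ge0.
by apply: lerD => //; rewrite ler_piMr.
Qed.

Lemma drift_err n c f x : hreg c f ->
  `|scale n * (f (x + (scale n)^-1 *: drift n x) - f x) - \sum_i drift n x 0 i * grad i f x| <= c * n.+1%:R^-1.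
Proof.
move=> [fc gc H]; have k0 := scale_gt0 n.
have c0 : 0 <= c by rewrite (le_trans _ (fc 0)).
have [r1|r1] := leP rho 1.
  have d0 : drift n x = 0 by apply/rowP => i; rewrite !mxE r1.
  rewrite d0 scaler0 addr0 subrr mulr0 sub0r normrN big1 ?normr0; first by rewrite mulr_ge0// invr_ge0.
  by move=> i _; rewrite mxE mul0r.
have := H x ((scale n)^-1 *: drift n x).
have -> : \sum_i ((scale n)^-1 *: drift n x) 0 i * grad i f x = (scale n)^-1 * \sum_i drift n x 0 i * grad i f x.
  by rewrite mulr_sumr; apply: eq_bigr => i _; rewrite mxE mulrA.
move=> /(ler_wpM2l (ltW k0)); rewrite -{1}(gtr0_norm k0) -normrM mulrBr mulrA mulfV ?gt_eqF// mul1r.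
move=> h; apply: (le_trans h); rewrite mulrCA; apply: ler_wpM2l => //.
rewrite enormZ gtr0_norm ?invr_gt0//; apply: scale_small => //.
by rewrite enorm_ge0 drift_bnd.
Qed.

(** The uncompensated large jumps are [truncated] plus its compensator, and that compensator cancels
    the correction contained in [drift]. What remains is the error of the difference quotient and
    the integral of [truncated] over the small jumps. *)
Lemma Bn_approx n c f x : hreg c f -> `|Bn n f x - Bhat rho b chi mu f x| <= apx_err n * c.
Proof.
move=> Hf; have [fc gc _] := Hf.
have c0 : 0 <= c by rewrite (le_trans _ (fc 0)).
have cf := hreg_continuous rho0 Hf.
have Bf : Bb f by split; [exact: continuous_borelf|exists c].
have sL := sfun_intD beta0 mu_C n x.
have iG := integ_truncated x Hf.
have eS (y : V) : (\sum_i y 0 i * grad i f x) * chi y = \sum_i grad i f x * (y 0 i * chi y).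
  by rewrite mulr_suml; apply: eq_bigr => i _; ring.
have BS : Bb (fun y => (\sum_i y 0 i * grad i f x) * chi y).
  rewrite (funext eS); apply: Bb_sum => i; apply: BbZ; exact: coord_chi_Bb.
have BG : Bb (truncated f x).
  by apply: BbB => //; apply: BbB; [exact: Bb_shift|exact: Bb_cst].
have eJ : \int[mu x]_y (indD n y * (f (x + y) - f x)) = jumps n x (truncated f x)
    + \sum_i (jumps n x (fun y => y 0 i * chi y)) * grad i f x.
  transitivity (jumps n x (fun y => truncated f x y + \sum_i grad i f x * (y 0 i * chi y))).
    apply: eq_Rintegral => y _; congr (_ * _); rewrite /truncated.
    by rewrite -eS subrK.
  have Bi i : Bb (fun y : V => grad i f x * (y 0 i * chi y)) by apply: BbZ; exact: coord_chi_Bb.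
  rewrite (sfunD sL BG (Bb_sum _ Bi)) (sfun_sum sL _ Bi); congr (_ + _).
  by apply: eq_bigr => i _; rewrite (sfunZ sL _ (coord_chi_Bb i)) mulrC.
have ed : \sum_i drift n x 0 i * grad i f x = \sum_i b x 0 i * grad i f x
    - \sum_i (jumps n x (fun y => y 0 i * chi y)) * grad i f x.
  rewrite -sumrB; apply: eq_bigr => i _; rewrite mxE -mulrBl.
  by case: (leP rho 1) => // r1; rewrite grad_le1// !mulr0.
have iD : integ (mu x) (fun y => indD n y * truncated f x y).
  by move: BG => [mg [K gK]]; exact: (integ_indD beta0 mu_C n x mg gK).
have hD := drift_err n x Hf.
have hT : `|jumps n x (truncated f x) - \int[mu x]_y truncated f x y|
    <= c * n.+1%:R^-1 `^ (al rho - beta) * C.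
  rewrite -RintB//.
  have ib := integZ (c * n.+1%:R^-1 `^ (al rho - beta)) (mbeta_integ mu_C x).
  have bnd y : `|indD n y * truncated f x y - truncated f x y| <= c * n.+1%:R^-1 `^ (al rho - beta) * mb y.
    have [h|h] := leP n.+1%:R^-1 (enorm y).
      by rewrite indD_mem// mul1r subrr normr0 !mulr_ge0 ?powR_ge0 ?mbeta_ge0.
    rewrite indD_notin// mul0r sub0r normrN; apply: truncated_small => //.
    by rewrite invf_le1// ler1n.
  apply: (le_trans (Rint_le_norm (integ_meas (integB iD iG)) bnd ib)).
  rewrite RintZ; last exact: mbeta_integ mu_C x.
  by apply: ler_wpM2l; [rewrite mulr_ge0 ?powR_ge0|exact: mbeta_int_le].
rewrite (BhatE _ Hf) /Bn eJ.
set s1 := scale n * _ in hD *; set s2 := \sum_i (jumps _ _ _) * _ in ed *.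
rewrite ed in hD.
rewrite [X in `|X|](_ : _ = (s1 - (\sum_i b x 0 i * grad i f x - s2)) +
  (jumps n x (truncated f x) - \int[mu x]_y truncated f x y)); last by ring.
apply: (le_trans (ler_normD _ _)); apply: (le_trans (lerD hD hT)).
by rewrite /apx_err le_eqVlt; apply/orP; left; apply/eqP; ring.
Qed.

Definition levybd : R := d%:R * bb + (2 + 2 * d%:R) * C.

Lemma levybd_ge0 : 0 <= levybd.
Proof. by rewrite addr_ge0 ?mulr_ge0 ?addr_ge0 ?mulr_ge0. Qed.

Lemma Bhat_bnd c f x : hreg c f -> `|Bhat rho b chi mu f x| <= levybd * c.
Proof.
move=> Hf; have [fc gc _] := Hf.
have c0 : 0 <= c by rewrite (le_trans _ (fc 0)).
rewrite (BhatE _ Hf); apply: (le_trans (ler_normD _ _)); rewrite mulrDl; apply: lerD.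
  apply: (le_trans (sum_coord_le (b x) (gc ^~ x))).
  by rewrite -mulrA; apply: ler_wpM2l => //; apply: ler_wpM2r.
have ib := integZ (c * (2 + 2 * d%:R)) (mbeta_integ mu_C x).
apply: (le_trans (Rint_le_norm (integ_meas (integ_truncated x Hf)) (fun y => truncated_le x y Hf) ib)).
rewrite RintZ; last exact: mbeta_integ mu_C x.
rewrite [leRHS](_ : _ = c * (2 + 2 * d%:R) * C); last by ring.
by apply: ler_wpM2l; [rewrite mulr_ge0// addr_ge0// mulr_ge0|exact: mbeta_int_le].
Qed.

(** The term [1 + C] bounds [apx_err]. With it one constant serves [Bhat] and every [Bn], hence one
    contraction constant serves all the Volterra equations. *)
Lemma pertop_Bhat : pertop hreg (levybd + (1 + C)) (Bhat rho b chi mu).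
Proof.
have h1 : 0 <= 1 + C by rewrite addr_ge0.
split=> [c f x Hf|].
  have [fc _ _] := Hf; have c0 : 0 <= c by rewrite (le_trans _ (fc 0)).
  by apply: (le_trans (Bhat_bnd x Hf)); apply: ler_wpM2r => //; rewrite lerDl.
exists Bn, apx_err, (fun n => 2 * (scale n + C * mass n)); split.
- exact: sfun_Bn.
- exact: Bn_borel.
- by move=> n c f x; exact: Bn_approx.
- exact: apx_err_cvg0.
Qed.

Lemma pertop_Bn n : pertop hreg (levybd + (1 + C)) (Bn n).
Proof.
split=> [c f x Hf|].
  have [fc _ _] := Hf; have c0 : 0 <= c by rewrite (le_trans _ (fc 0)).
  rewrite -[Bn n f x](subrK (Bhat rho b chi mu f x)) addrC mulrDl.
  apply: (le_trans (ler_normD _ _)); apply: lerD; first exact: Bhat_bnd.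
  apply: (le_trans (Bn_approx n x Hf)); apply: ler_wpM2r => //.
  by have /andP[] := apx_err_le n.
exists (fun _ => Bn n), (fun=> 0), (fun=> 2 * (scale n + C * mass n)); split.
- by move=> _; exact: sfun_Bn.
- by move=> _; exact: Bn_borel.
- by move=> _ c f x _; rewrite subrr normr0 mul0r.
- exact: cvg_cst.
Qed.

(** A bound for the total rate at which [Bn n] leaves the point [x]: the rate of the drift step plus
    that of the large jumps. *)
Definition killing n := scale n + C * mass n.

Lemma killing_gt0 n : 0 < killing n.
Proof. by rewrite ltr_wpDr ?scale_gt0// (mass_C_ge0 mu_C). Qed.

(** The three terms on the right have nonnegative weights of total mass [killing n], which yields
    both positivity and the norm bound. *)
Lemma Bn_killedE n f x : Bb f -> Bn n f x + killing n * f x =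
  scale n * f (x + (scale n)^-1 *: drift n x) + jumps n x (fun y => f (x + y))
  + (C * mass n - jumps n x (fun=> 1)) * f x.
Proof. by move=> Bf; rewrite /Bn jumpsE// /killing; ring. Qed.

Lemma Bn_killed_ge0 n f x : Bb f -> (forall x, 0 <= f x) -> 0 <= Bn n f x + killing n * f x.
Proof.
move=> Bf f0; rewrite Bn_killedE//; have /andP[j0 j1] := jumps1 n x.
rewrite addr_ge0// ?mulr_ge0 ?subr_ge0// addr_ge0 ?mulr_ge0 ?(ltW (scale_gt0 n))//.
by apply: Rintegral_ge0 => y _; rewrite mulr_ge0 ?indD_ge0.
Qed.

Lemma Bn_killed_le n f a x : Bb f -> (forall x, `|f x| <= a) ->
  `|Bn n f x + killing n * f x| <= killing n * a.
Proof.
move=> Bf fa; rewrite Bn_killedE//; have /andP[j0 j1] := jumps1 n x.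
have sL := sfun_intD beta0 mu_C n x; have k0 := ltW (scale_gt0 n).
have h1 : `|scale n * f (x + (scale n)^-1 *: drift n x)| <= scale n * a.
  by rewrite normrM (ger0_norm k0) ler_wpM2l.
have h2 : `|jumps n x (fun y => f (x + y))| <= a * jumps n x (fun=> 1).
  rewrite -(sfunZ sL a (Bb_cst d 1)); apply: Rint_le_norm.
  - by apply: measurable_funM; [exact: indD_borel|exact: (Bb_shift x Bf).1].
  - by move=> y; rewrite normrM (ger0_norm (indD_ge0 _ _)) mulr1 ler_wpM2l ?indD_ge0.
  - have [m1 [K hK]] := BbZ a (Bb_cst d 1 : Bb (fun _ : V => 1)).
    exact: (integ_indD beta0 mu_C n x m1 hK).
have h3 : `|(C * mass n - jumps n x (fun=> 1)) * f x| <= (C * mass n - jumps n x (fun=> 1)) * a.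
  by rewrite normrM (ger0_norm (_ : 0 <= C * mass n - _)) ?subr_ge0// ler_wpM2l// subr_ge0.
apply: (le_trans (ler_normD _ _)); apply: (le_trans (lerD (ler_normD _ _) h3)).
apply: (le_trans (lerD (lerD h1 h2) (lexx _))).
by rewrite le_eqVlt; apply/orP; left; apply/eqP; rewrite /killing; ring.
Qed.

Lemma Bhat_approximation : exists (Bs : nat -> (V -> R) -> V -> R) (e k : nat -> R),
  [/\ forall n, pertop hreg (levybd + (1 + C)) (Bs n),
      forall n, 0 < k n,
      forall n f x, Bb f -> (forall x, 0 <= f x) -> 0 <= Bs n f x + k n * f x,
      forall n f a x, Bb f -> (forall x, `|f x| <= a) -> `|Bs n f x + k n * f x| <= k n * a
    & (forall n c f x, hreg c f -> `|Bs n f x - Bhat rho b chi mu f x| <= e n * c) /\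
      (forall n, 0 <= e n) /\ e n @[n --> \oo] --> 0].
Proof.
exists Bn, apx_err, killing; split.
- exact: pertop_Bn.
- exact: killing_gt0.
- exact: Bn_killed_ge0.
- exact: Bn_killed_le.
- split; first exact: Bn_approx.
  by split; [move=> n; case/andP: (apx_err_le n)|exact: apx_err_cvg0].
Qed.

Hypothesis mu_tail : forall e : R, 0 < e -> exists R0 : R, forall r, R0 < r -> forall x,
  (mu x [set y | (r < enorm y)%R] <= e%:E)%E.

(** Far out, the drift step and the jumps of length at most [r1] end where [f] is small. Longer
    jumps only see the bound [c] of [f], but tightness makes their mass small uniformly in [x]. *)
Lemma Bn_vanish n f : Bb f -> vanish f -> vanish (Bn n f).
Proof.
move=> [mf [c fc]] vf e e0; have c0 : 0 <= c by rewrite (le_trans _ (fc 0)).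
have k0 := scale_gt0 n; have m0 := mass_C_ge0 mu_C n.
set k := scale n in k0 *; set m := C * mass n in m0 *.
(* The errors add up to [2 * (k + m + c) * del]; the extra 1 makes [D] positive and the final
   inequality strict. *)
pose D := 2 * (k + m + c) + 1; have D0 : 0 < D by rewrite /D; lra.
pose del := e / D; have del0 : 0 < del by rewrite divr_gt0.
have [r0 Hr0] := vf _ del0; have [R0 HR0] := mu_tail del0.
pose r1 := Num.max R0 0 + 1.
have r1R : R0 < r1 by rewrite /r1 ltr_pwDr// le_max lexx.
have r10 : 0 < r1 by rewrite /r1 ltr_pwDr// le_max lexx orbT.
pose s := r1 + k^-1 * driftbd n.
have v0 : 0 <= k^-1 * driftbd n.
  by rewrite mulr_ge0 ?invr_ge0 ?(ltW k0)// (le_trans (enorm_ge0 _) (drift_bnd n 0)).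
exists (d%:R * (r0 + s)) => x xs.
have fs y : enorm y <= s -> `|f (x + y)| <= del.
  by move=> ys; apply/ltW/Hr0; exact: enorm_shift_large ys.
have fx : `|f x| <= del by rewrite -[x]addr0; apply: fs; rewrite enorm0 addr_ge0// ltW.
have fd : `|f (x + k^-1 *: drift n x)| <= del.
  apply: fs; rewrite enormZ (ger0_norm (_ : 0 <= k^-1)); last by rewrite invr_ge0 ltW.
  have h : k^-1 * enorm (drift n x) <= k^-1 * driftbd n.
    by apply: ler_wpM2l (drift_bnd n x); rewrite invr_ge0 ltW.
  by apply: (le_trans h); rewrite lerDr ltW.
pose A : set Vb := [set y | r1 < enorm y].
have mA : measurable A.
  rewrite -[A]setTI (_ : A = (@enorm R d : Vb -> R) @^-1` `]r1, +oo[).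
    by apply: (@enorm_borel R d) => //; exact: measurable_itv.
  by apply/seteqP; split => y /=; rewrite in_itv/= andbT.
have iA : integ (mu x) (\1_A : Vb -> R).
  apply: (integ_dom_m mu_C x (K := tailc beta r1)); first exact: measurable_indic.
  move=> y; rewrite indicE; case: (boolP (y \in A)) => [|_]; rewrite ?normr1 ?normr0.
    by rewrite inE => /ltW ry; exact: mbeta_tail.
  by rewrite mulr_ge0 ?mbeta_ge0// addr_ge0 ?invr_ge0 ?powR_ge0.
have hA : \int[mu x]_y \1_A y <= del.
  rewrite -lee_fin /Rintegral fineK; last exact: (integrable_fin_num measurableT iA).
  by rewrite integral_indic// setIT; exact: HR0.
have i1 : integ (mu x) (indD n).
  apply: (integ_dom_m mu_C x (K := mass n)); first exact: indD_borel.
  by move=> y; rewrite ger0_norm ?indD_ge0//; exact: indD_mbeta.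
have hJ : `|\int[mu x]_y (indD n y * (f (x + y) - f x))| <= 2 * del * m + 2 * c * del.
  have bnd y : `|indD n y * (f (x + y) - f x)| <= 2 * del * indD n y + 2 * c * \1_A y.
    rewrite normrM (ger0_norm (indD_ge0 _ _)) mulrC.
    have h := ler_normB (f (x + y)) (f x).
    have [ys|ys] := leP (enorm y) r1.
      apply: (@le_trans _ _ (2 * del * indD n y)); last by rewrite lerDl !mulr_ge0// indicE ler0n.
      apply: ler_wpM2r; first exact: indD_ge0.
      apply: (le_trans h); rewrite mulr_natl mulr2n; apply: lerD => //.
      by apply: fs; rewrite (le_trans ys)// lerDl.
    rewrite indicE mem_set// mulr1.
    apply: (@le_trans _ _ (2 * c)); last by rewrite lerDr mulr_ge0 ?indD_ge0// mulr_ge0 ?(ltW del0).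
    apply: (@le_trans _ _ `|f (x + y) - f x|); first by rewrite ler_piMr// indD_le1.
    by apply: (le_trans h); rewrite mulr_natl mulr2n; apply: lerD.
  have mD : borelf (fun y => indD n y * (f (x + y) - f x)).
    apply: measurable_funM; first exact: indD_borel.
    by apply: measurable_funB; [exact: shift_borel|exact: measurable_cst].
  apply: (le_trans (Rint_le_norm mD bnd (integD (integZ _ i1) (integZ _ iA)))).
  rewrite (RintD (integZ _ i1) (integZ _ iA)) !RintZ//; apply: lerD; apply: ler_wpM2l => //.
  - by rewrite mulr_ge0// ltW.
  - have /andP[_] := jumps1 n x; rewrite (_ : \int[mu x]_y (indD n y * 1) = \int[mu x]_y indD n y)//.
    by apply: eq_Rintegral => y _; rewrite mulr1.
  - by rewrite mulr_ge0.
have h1 : `|k * (f (x + k^-1 *: drift n x) - f x)| <= k * (del + del).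
  rewrite normrM (gtr0_norm k0); apply: ler_wpM2l; first exact: ltW.
  by apply: (le_trans (ler_normB _ _)); exact: lerD.
apply: (le_lt_trans (ler_normD _ _)); apply: (le_lt_trans (lerD h1 hJ)).
have -> : e = D * del by rewrite /del mulrCA mulfV ?mulr1// gt_eqF.
clearbody del; rewrite [ltRHS](_ : _ = k * (del + del) + (2 * del * m + 2 * c * del) + del).
  by rewrite ltrDl.
by rewrite /D; ring.
Qed.

Lemma Bhat_vanish c f : hreg c f -> vanish f -> vanish (Bhat rho b chi mu f).
Proof.
move=> Hf vf; have [fc _ _] := Hf; have cf := hreg_continuous rho0 Hf.
have Bf : Bb f by split; [exact: continuous_borelf|exists c].
apply: (vanish_unif (fn := Bn ^~ f) (e := fun n => apx_err n * c)).
- by move=> n; exact: Bn_vanish.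
- by move=> n x; exact: Bn_approx.
- by rewrite -[X in _ --> X](mul0r c); apply: cvgMl; exact: apx_err_cvg0.
Qed.

End LevyOperator.

(** * Extension to all times and smoothing bounds *)

Section TimeExtension.
Context (R : realType) (d : nat).
Notation V := (V R d).
Notation Vb := (Vb R d).
Notation leb := (@lebesgue_measure R).
Notation TR := (measurableTypeR R).
Notation fam := (R -> (V -> R) -> V -> R).

Definition zext (T : fam) : fam := fun t f x => if 0 < t then T t f x else 0.

Lemma zextE (T : fam) t f : 0 < t -> zext T t f = T t f.
Proof. by move=> t0; apply/funext => x; rewrite /zext t0. Qed.

Lemma zext0 (T : fam) t f : t <= 0 -> zext T t f = fun=> 0.
Proof. by move=> t0; apply/funext => x; rewrite /zext ltNge t0. Qed.

Lemma sfun_zero (D : R) : 0 <= D -> sfun D (fun _ : V -> R => 0).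
Proof.
move=> D0; split => //.
- by move=> *; rewrite mulr0 addr0.
- by move=> f c _ fc; rewrite normr0 mulr_ge0// (le_trans _ (fc 0)).
- by move=> *; exact: cvg_cst.
Qed.

Section Extension.
Variables (T : fam) (M w : R).
Hypothesis ksg : kernel_sg T M w.
Hypothesis sfT : strong_feller T.

Lemma kernel_sg_M0 : 0 <= M.
Proof.
have [_ [_ [h _]]] := ksg; have B1 : Bb (fun _ : V => 1 : R) := Bb_cst d 1.
have s1 : 1 <= supn (fun _ : V => 1 : R).
  by have := supn_ge B1.2 0; rewrite normr1.
have := le_trans (normr_ge0 _) (h 1 _ ltr01 B1 0).
by rewrite pmulr_lge0 ?(lt_le_trans ltr01)// pmulr_lge0// expR_gt0.
Qed.

Let M0 := kernel_sg_M0.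

Lemma kernel_sg_bnd t f c x : 0 < t -> Bb f -> (forall x, `|f x| <= c) -> `|T t f x| <= M * expR (w * t) * c.
Proof.
move=> t0 Bf fc; have [_ [_ [h _]]] := ksg; apply: (le_trans (h t f t0 Bf x)).
by apply: ler_wpM2l; [rewrite mulr_ge0 ?expR_ge0|exact: supn_le].
Qed.

Lemma opfam_zext lam : w <= lam -> opfam M lam (zext T).
Proof.
move=> wl; have [kT [_ [_ mT]]] := ksg; split.
- move=> t x; have [t0|t0] := ltP 0 t; last first.
    under [X in sfun _ X]eq_fun do rewrite zext0//.
    by apply: sfun_zero; rewrite mulr_ge0 ?expR_ge0.
  under [X in sfun _ X]eq_fun do rewrite zextE//.
  have [K /(_ x) sK] := kernel_op_sfun (kT t t0); apply: (sfun_sharp sK) => f c Bf fc.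
  have c0 : 0 <= c by rewrite (le_trans _ (fc 0)).
  apply: (le_trans (kernel_sg_bnd x t0 Bf fc)); apply: ler_wpM2r => //; apply: ler_wpM2l => //.
  by rewrite ler_expR ler_wpM2r// ltW.
- by move=> t f x t0; rewrite zext0.
- move=> t f Bf; have [t0|t0] := ltP 0 t; first by rewrite zextE//; exact: (sfT t0 Bf).1.
  by rewrite zext0//; exact: cst_continuous.
- move=> f Bf.
  have mD : measurable [set p : TR * Vb | (0 < (p.1 : R))%R].
    rewrite -[X in measurable X]setTI.
    rewrite (_ : [set p : TR * Vb | _] = (fst : TR * Vb -> TR) @^-1` `]0, +oo[).
      by apply: measurable_fst => //; exact: measurable_itv.
    by apply/seteqP; split => p /=; rewrite in_itv/= andbT.
  have h : measurable_fun [set p : TR * Vb | (0 < (p.1 : R))%R] (fun p => T p.1 f p.2) := mT f Bf.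
  move/(measurable_restrictT _ mD) : h; congr measurable_fun.
  apply/funext => p; rewrite patchE /zext.
  case: ifPn; rewrite ?inE ?notin_setE /=; first by move=> ->.
  by move=> /negP/negbTE ->.
Qed.

Lemma zext_sg (t s : R) (f : V -> R) : 0 < t -> 0 < s -> Bb f -> zext T (t + s) f = zext T t (zext T s f).
Proof.
move=> t0 s0 Bf; have [_ [h _]] := ksg.
by rewrite !zextE ?addr_gt0//; exact: h.
Qed.

Lemma zext_0 : Cb_cond T -> forall (f : V -> R) (x : V) (r : nat -> R), Cb f -> (forall n, 0 < r n) ->
  r n @[n --> \oo] --> 0 -> zext T (r n) f x @[n --> \oo] --> f x.
Proof.
move=> [_ cT] f x r Cf r0 cr; have [_ /(_ x)/cvg_at_rightP h] := cT f Cf.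
under eq_fun do rewrite zextE//.
exact: h.
Qed.

(** * A smoothing bound for all positive times *)

Section HolderBound.
Variables (rho : R) (rho0 : 0 < rho).
Hypothesis T_rho : forall t f, 0 < t -> Bb f -> Cbrho rho (T t f).
Variable phi : R -> R.
Hypothesis iphi : leb.-integrable [set s : R | (0 < s < 1)%R] (fun t => (phi t)%:E).
Hypothesis phi_bnd : forall t f, 0 < t < 1 -> Bb f ->
  (forall l : seq 'I_d, (size l <= hord rho)%N -> forall x, `|pd l (T t f) x| <= phi t * supn f) /\
  (forall l : seq 'I_d, size l = hord rho -> forall x y,
    `|pd l (T t f) x - pd l (T t f) y| <= phi t * supn f * (enorm (x - y)) `^ (hexp rho)).

Notation Cd := ((1 + d%:R) ^+ 2 : R).

Definition psi0 (s : R) : R := if 0 < s < 1 then phi s else 0.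

Definition psi_late : R := Cd * phi 2^-1 * M.

(** [phi] controls times below 1. For [s >= 1] the smoothing is done by [T (1 / 2)], applied to
    [T (s - 1 / 2) f], whose growth enters the constant. The factor [Cd] converts [Cbrho] bounds
    into [hreg] bounds. *)
Definition psi (s : R) : R :=
  Cd * psi0 s + (if 1 <= s then psi_late * expR (w * (s - 2^-1)) else 0).

Let phi_ge0 s : 0 < s < 1 -> 0 <= phi s.
Proof.
move=> s01; have B1 : Bb (fun _ : V => 1 : R) := Bb_cst d 1.
have s1 : 1 <= supn (fun _ : V => 1 : R).
  by have := supn_ge B1.2 0; rewrite normr1.
have [/(_ [::] isT 0) h _] := phi_bnd s01 B1.
by have := le_trans (normr_ge0 _) h; rewrite pmulr_lge0 ?(lt_le_trans ltr01).
Qed.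

Let half01 : 0 < (2^-1 : R) < 1.
Proof. by rewrite invr_gt0 ltr0n/= invf_lt1// ltr1n. Qed.

Lemma psi_late_ge0 : 0 <= psi_late.
Proof. by rewrite !mulr_ge0// phi_ge0. Qed.

Lemma psi0_ge0 s : 0 <= psi0 s.
Proof. by rewrite /psi0; case: ifP => // /phi_ge0. Qed.

Lemma psi_nonneg s : 0 <= psi s.
Proof.
rewrite addr_ge0 ?mulr_ge0 ?psi0_ge0//; case: ifP => // _.
by rewrite mulr_ge0 ?expR_ge0 ?psi_late_ge0.
Qed.

Lemma psi_le0 s : s <= 0 -> psi s = 0.
Proof.
move=> s0; rewrite /psi /psi0 ltNge s0/= mulr0 add0r leNgt.
by rewrite (le_lt_trans s0 ltr01).
Qed.

Lemma hreg_T01 (s : R) (f : V -> R) (c : R) : 0 < s < 1 -> Bb f -> (forall x, `|f x| <= c) -> hreg rho (Cd * (phi s * c)) (T s f).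
Proof.
move=> s01 Bf fc; have [h1 h2] := phi_bnd s01 Bf; have /andP[s0 s1] := s01.
have := hreg_of_bounds rho0 (T_rho s0 Bf) h1 h2.
apply: (reg_le (regspace_hreg d rho0)); rewrite ler_wpM2l// ler_wpM2l ?phi_ge0//.
exact: supn_le.
Qed.

Lemma zext_H (s : R) (f : V -> R) (c : R) : Bb f -> (forall x, `|f x| <= c) -> hreg rho (psi s * c) (zext T s f).
Proof.
move=> Bf fc; have c0 : 0 <= c by rewrite (le_trans _ (fc 0)).
have [s0|s0] := leP s 0.
  rewrite zext0// psi_le0// mul0r; exact: (reg0 (regspace_hreg d rho0)).
rewrite zextE// /psi /psi0 s0/=.
have [s1|s1] := ltP s 1.
  by rewrite addr0 -mulrA; apply: hreg_T01; rewrite ?s0.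
rewrite mulr0 add0r.
have h0 : 0 < s - 2^-1 by move/andP: half01 => [_ h]; lra.
have /andP[hh0 _] := half01.
have [_ [sg _]] := ksg.
have -> : T s f = T 2^-1 (T (s - 2^-1) f) by rewrite -sg// addrC subrK.
have BT : Bb (T (s - 2^-1) f) by apply: Cb_Bb; exact: sfT.
have := hreg_T01 half01 BT (fun x => kernel_sg_bnd x h0 Bf fc).
by apply: (reg_le (regspace_hreg d rho0)); rewrite le_eqVlt /psi_late; apply/orP; left; apply/eqP; ring.
Qed.

Lemma psi0_integ : integ leb psi0.
Proof.
have mD : measurable ([set s : R | (0 < s < 1)%R] : set TR).
  rewrite (_ : [set s | _] = `]0, 1[%classic); first exact: measurable_itv.
  by apply/seteqP; split => s /=; rewrite in_itv.
move: iphi => /(integrable_mkcond _ mD); congr (_.-integrable _ _).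
apply/funext => s; rewrite patchE /psi0 /=.
case: ifPn; rewrite ?inE ?notin_setE /=; first by move=> ->.
by move=> /negP/negbTE ->.
Qed.

Lemma psi_integ (lam : R) : 0 <= lam -> w < lam -> integ leb (expweight lam psi).
Proof.
move=> lam0 wl; have wl0 : 0 < lam - w by rewrite subr_gt0.
have [ie _] := exp_halfline wl0.
pose late (s : TR) : R := (1 <= s)%R%:R.
have late_ge0 s : 0 <= late s by exact: ler0n.
have late_le1 s : late s <= 1 by rewrite /late; case: (leP 1 s).
have mlate : measurable_fun setT late.
  rewrite (_ : late = \1_(`[1, +oo[ : set TR)); last first.
    apply/funext => s; rewrite indicE /late; congr (nat_of_bool _)%:R.
    by apply/idP/idP; rewrite inE/= in_itv/= andbT.
  by apply: measurable_indic; exact: measurable_itv.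
rewrite (_ : expweight lam psi = fun s => expR (- (lam * s)) * (Cd * psi0 s) +
   psi_late * expR (- (w / 2)) * (late s * (heav s * expR (- ((lam - w) * s))))); last first.
  apply/funext => s; rewrite /expweight /psi mulrDr /late; congr (_ + _).
  have [s1|s1] := leP 1 s; last by rewrite !(mul0r, mulr0).
  rewrite heav1 ?(lt_le_trans ltr01)//.
  rewrite [RHS](_ : _ = psi_late * (expR (- (w / 2)) * expR (- ((lam - w) * s)))); last by rewrite /=; ring.
  by rewrite mulrCA -!expRD; congr (_ * expR _); lra.
apply: integD.
  have mp := integZ Cd psi0_integ.
  have m1 : measurable_fun setT (fun s : TR => expR (- (lam * s)) * (Cd * psi0 s)).
    by apply: measurable_funM; [exact: meas_expN|exact: integ_meas mp].
  have d1 s : `|expR (- (lam * s)) * (Cd * psi0 s)| <= Cd * psi0 s.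
    have h : 0 <= Cd * psi0 s by rewrite mulr_ge0 ?psi0_ge0.
    rewrite normrM (ger0_norm (expR_ge0 _)) (ger0_norm h).
    have [s0|s0] := leP s 0; first by rewrite /psi0 ltNge s0 !mulr0.
    by rewrite ler_piMl// -expR0 ler_expR oppr_le0 mulr_ge0// ltW.
  exact: (integ_dom m1 d1 mp).
apply: integZ.
have m2 : measurable_fun setT (fun s : TR => late s * (heav s * expR (- ((lam - w) * s)))).
  by apply: measurable_funM => //; exact: integ_meas ie.
have d2 s : `|late s * (heav s * expR (- ((lam - w) * s)))| <= heav s * expR (- ((lam - w) * s)).
  have h : 0 <= heav s * expR (- ((lam - w) * s)) by rewrite mulr_ge0 ?heav_ge0 ?expR_ge0.
  by rewrite normrM (ger0_norm h) ger0_norm// ler_piMl.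
exact: (integ_dom m2 d2 ie).
Qed.

(** Passing from [L] to [L + n] multiplies the weighted function by the [n]-th power of
    [expR (- s)], so it tends to 0 for each [s > 0] and dominated convergence makes the integral
    small. This is where the singularity of [phi] at 0 has to be integrable. *)
Lemma psi_small (K : R) : 0 <= K -> exists lam : R, [/\ 0 <= lam, w < lam, integ leb (expweight lam psi)
  & \int[leb]_s expweight lam (fun s => K * psi s) s < 1].
Proof.
move=> K0; pose L := `|w| + 1; have L0 : 0 <= L by rewrite addr_ge0.
have wL : w < L by rewrite (le_lt_trans (ler_norm w))// ltrDl.
have Ln n : 0 <= L + n%:R /\ w < L + n%:R.
  by split; [rewrite addr_ge0|rewrite (lt_le_trans wL)// lerDl].
have iL := psi_integ L0 wL.
have i_ n := psi_integ (Ln n).1 (Ln n).2.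
have E n s : expweight (L + n%:R) psi s = expweight L psi s * (expR (- s)) ^+ n.
  rewrite /expweight -expRM_natl mulrAC -expRD; congr (expR _ * _).
  by rewrite -mulr_natl; ring.
have pt s : expweight (L + n%:R) psi s @[n --> \oo] --> (0 : R).
  have [s0|s0] := leP s 0.
    by under eq_fun do rewrite E /expweight psi_le0// mulr0 mul0r; exact: cvg_cst.
  under eq_fun do rewrite E.
  by apply: cvg_geo; rewrite expR_ge0 -expR0 ltr_expR oppr_lt0.
have dom n s : `|expweight (L + n%:R) psi s| <= expweight L psi s.
  have h : 0 <= expweight L psi s by rewrite mulr_ge0 ?expR_ge0 ?psi_nonneg.
  have [s0|s0] := leP s 0; first by rewrite /expweight psi_le0// !mulr0 normr0.
  rewrite E normrM (ger0_norm h) ler_piMr// normrX exprn_ile1// ger0_norm ?expR_ge0//.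
  by rewrite -expR0 ler_expR oppr_le0 ltW.
have := Rint_dct (fun n => integ_meas (i_ n)) pt dom iL; rewrite Rint0 => cI.
have K1 : 0 < (K + 1)^-1 by rewrite invr_gt0 ltr_wpDl.
have /cvgrPdist_lt/(_ _ K1)[n _ /(_ n (leqnn n))] := cI; rewrite /= sub0r normrN => hn.
exists (L + n%:R); split; [exact: (Ln n).1|exact: (Ln n).2|exact: i_|].
rewrite (_ : \int[leb]_s _ = K * \int[leb]_s expweight (L + n%:R) psi s); last first.
  by rewrite -RintZ//; apply: eq_Rintegral => s _; rewrite /expweight; ring.
have hn' := le_lt_trans (ler_norm _) hn.
apply: (@le_lt_trans _ _ (K * (K + 1)^-1)); first by rewrite ler_wpM2l// ltW.
by rewrite ltr_pdivrMr ?ltr_wpDl// mul1r ltrDl.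
Qed.

End HolderBound.
End Extension.
End TimeExtension.

(** * Vanishing at infinity *)

Section Transfer.
Context (R : realType) (d : nat).
Notation V := (V R d).
Notation leb := (@lebesgue_measure R).
Notation TR := (measurableTypeR R).
Notation fam := (R -> (V -> R) -> V -> R).

Lemma fullgen_gen (T : fam) (A lam : R) (u g : V -> R) : 0 <= lam -> opfam A lam (zext T) ->
  fullgen T u g <-> gen (zext T) u g.
Proof.
move=> lam0 oT.
have E t x : Bb g -> (\int[leb]_(s in [set s : R | (0 < s < t)%R]) (T s g x)%:E)%E =
    (\int[leb]_s (heav (t - s) * zext T s g x))%:E.
  move=> Bg; rewrite integral_mkcond /Rintegral fineK; last first.
    exact: (integrable_fin_num measurableT (fin_integ oT lam0 t x Bg)).
  apply: eq_integral => s _; rewrite patchE /zext; case: ifPn; rewrite ?inE ?notin_setE /=.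
    by move=> /andP[-> st]; rewrite heav1 ?mul1r// subr_gt0.
  case: (ltP 0 s) => [_ /negP|_ _]; last by rewrite mulr0.
  by rewrite -leNgt => st; rewrite heav0 ?mul0r// subr_le0.
split=> [[Bu [Bg h]]|[Bu Bg h]].
  split=> // t x t0; rewrite zextE//; apply: EFin_inj; rewrite -E//; exact: h.
split=> //; split=> // t t0 x; rewrite E//; congr EFin.
by rewrite -(h t x t0) zextE.
Qed.

Lemma zext_id (S : fam) (A lam : R) : opfam A lam S -> zext S = S.
Proof.
move=> oS; apply/funext => t; apply/funext => f; apply/funext => x.
by rewrite /zext; case: ltP => // t0; rewrite (opfam_le0 oS).
Qed.

Lemma opfam_kernel_sg (S : fam) (A lam : R) : opfam A lam S ->
  (forall t s f, 0 < t -> 0 < s -> Bb f -> S (t + s) f = S t (S s f)) -> kernel_sg S A lam.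
Proof.
move=> oS Ssg; split; [|split; [|split]].
- move=> t _; apply: (@sfun_kernel_op _ _ (A * expR (lam * t))).
    by move=> x; exact: (opfam_sfun oS).
  by move=> f Bf; exact: (opfam_Cb oS t Bf).1.
- exact: Ssg.
- by move=> t f _ Bf x; apply: (opfam_bnd oS) => //; exact: supn_ge Bf.2.
- move=> f Bf; apply: (@measurable_funS _ _ _ _ setT) => //; exact: (opfam_meas oS).
Qed.

Lemma heav_small (lam : R) (psi : R -> R) (r : nat -> R) : integ leb (expweight lam psi) ->
  (forall s, 0 <= psi s) -> (forall s, s <= 0 -> psi s = 0) ->
  r n @[n --> \oo] --> 0 ->
  \int[leb]_s (heav (r n - s) * expweight lam psi s) @[n --> \oo] --> 0.
Proof.
move=> ipsi psi0 psi_le0 cr; rewrite -[X in _ --> X](@Rint0 _ _ _ leb).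
have ew0 s : 0 <= expweight lam psi s by rewrite mulr_ge0 ?expR_ge0.
have mn n : measurable_fun setT (fun s : TR => heav (r n - s) * expweight lam psi s).
  by apply: measurable_funM; [exact: meas_heav_l|exact: integ_meas ipsi].
have dom n s : `|heav (r n - s) * expweight lam psi s| <= expweight lam psi s.
  by rewrite normrM [X in _ * X]ger0_norm// ler_piMl// heav_norm.
have pt s : heav (r n - s) * expweight lam psi s @[n --> \oo] --> (0 : R).
  have [s0|s0] := leP s 0.
    by under eq_fun do rewrite /expweight psi_le0// !mulr0; exact: cvg_cst.
  apply/cvgrPdist_le => e e0; have /cvgrPdist_lt/(_ _ s0) := cr.
  apply: filterS => n; rewrite /= !sub0r !normrN => rs.
  rewrite heav0 ?mul0r ?normr0 ?(ltW e0)// subr_le0 ltW//.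
  exact: le_lt_trans (ler_norm _) rs.
exact: (Rint_dct mn pt dom ipsi).
Qed.

Section VanishingSolution.

Lemma vanish0 : vanish (fun _ : V => 0 : R).
Proof. by move=> e e0; exists 0 => x _; rewrite normr0. Qed.

Lemma vanishD (f g : V -> R) : vanish f -> vanish g -> vanish (fun x => f x + g x).
Proof.
move=> /vanish_seqP vf /vanish_seqP vg; apply/vanish_seqP => u cu.
by rewrite -[X in _ --> X](addr0 0); apply: cvgD; [exact: vf|exact: vg].
Qed.

(** Along a sequence going to infinity the integrand tends to 0 for each [s], under a majorant in
    [s] that is the same for all points. *)
Lemma conv_vanish (C lam : R) (U K : fam) (psi : R -> R) : opfam C lam U -> inputfam psi K ->
  integ leb (expweight lam psi) ->
  (forall t f, Bb f -> vanish f -> vanish (U t f)) ->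
  (forall t f, Bb f -> vanish f -> vanish (K t f)) ->
  forall t f, Bb f -> vanish f -> vanish (conv U K t f).
Proof.
move=> oU iK ipsi vU vK t f Bf vf; apply/vanish_seqP => u cu.
rewrite -[X in _ --> X](@Rint0 _ _ _ leb); have [_ [c fc]] := Bf.
have pt s : U (t - s) (K s f) (u n) @[n --> \oo] --> (0 : R).
  have /vanish_seqP := vU (t - s) (K s f) (input_Bb iK s Bf) (vK s f Bf vf).
  exact.
have ia := integZ (C * expR (lam * t) * c) ipsi.
exact: (Rint_dct (fun n => comp_meas_s oU iK t (u n) Bf) pt
  (fun n s => comp_bnd oU iK t (u n) s Bf fc) ia).
Qed.

Lemma vsol_vanish (M lam : R) (T K : fam) (psi : R -> R) (oT : opfam M lam T) (iK : inputfam psi K) :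
  integ leb (expweight lam psi) -> \int[leb]_s expweight lam psi s < 1 ->
  (forall t f, Bb f -> vanish f -> vanish (T t f)) ->
  (forall t f, Bb f -> vanish f -> vanish (K t f)) ->
  forall t f, Bb f -> vanish f -> vanish (vsol T K t f).
Proof.
move=> ipsi q1 vT vK t f Bf vf; have [_ [c fc]] := Bf.
have vn n : forall t f, Bb f -> vanish f -> vanish (viter T K n t f).
  elim: n => [//|n IH] t' f' Bf' vf' /=; apply: vanishD; first exact: vT.
  exact: (conv_vanish (viter_opfam oT iK ipsi q1 n) iK ipsi IH vK).
have q01 := contraction_const iK q1.
apply: (vanish_unif (fun n => vn n t f Bf vf) (fun n x => vsol_approx oT iK ipsi q1 n t x Bf fc)).
set q := \int[leb]_s _.
have E n : M * q / (1 - q) * q ^+ n * expR (lam * t) * c = M * q / (1 - q) * expR (lam * t) * c * q ^+ n.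
  by ring.
by under eq_fun do rewrite E; exact: cvg_geo.
Qed.

End VanishingSolution.

Lemma Cinf_bnd (f : V -> R) : Cinf f -> bnd f.
Proof.
move=> [cf vf]; have [r Hr] := vf 1 ltr01.
pose K : set V := [set x | enorm x <= r].
have cK : compact K.
  apply: bounded_closed_compact.
    exists r; split; first exact: num_real.
    move=> m rm y /= yr; apply: (le_trans (norm_le_enorm y)).
    by rewrite (le_trans yr)// ltW.
  apply: (@closed_comp _ _ (@enorm R d) [set x | x <= r]); last exact: closed_le.
  by move=> y _; exact: continuous_enorm.
have cfK : compact (f @` K).
  by apply: continuous_compact => //; apply: continuous_subspaceT.
have [B [_ HB]] := compact_bounded cfK.
pose B' := Num.max 1 (`|B| + 1).
exists B' => x; have [xr|xr] := leP (enorm x) r.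
  rewrite /B' le_max; apply/orP; right; apply: HB; last by exists x.
  by rewrite (le_lt_trans (ler_norm _))// ltrDl.
by rewrite /B' le_max (ltW (Hr x xr)).
Qed.

Lemma Cinf_Bb (f : V -> R) : Cinf f -> Bb f.
Proof. by move=> Cf; split; [exact: continuous_borelf Cf.1|exact: Cinf_bnd]. Qed.

(** The iteration applies [T] to functions [K s f] that are merely Borel, so decay must be preserved
    beyond [Cinf]. A decaying Borel [f] satisfies [|f| <= del + h] with [h] in [Cinf], and
    positivity transfers this majorization to [P]. *)
Lemma positive_vanish (P : (V -> R) -> V -> R) (m : R) :
  (forall x, sfun m (fun f => P f x)) ->
  (forall f, Bb f -> (forall x, 0 <= f x) -> forall x, 0 <= P f x) ->
  (forall f, Cinf f -> Cinf (P f)) ->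
  forall f, Bb f -> vanish f -> vanish (P f).
Proof.
move=> sP pP cP f Bf vf e e0; have [_ [c fc]] := Bf.
have c0 : 0 <= c by rewrite (le_trans _ (fc 0)).
have m0 := sfun_C0 (sP 0); pose del := e / 2 / (m + 1).
have m1 : 0 < m + 1 by rewrite ltr_wpDl.
have del0 : 0 < del by rewrite divr_gt0// divr_gt0.
have [r Hr] := vf _ del0.
pose h (x : V) := c * clamp (r + 1 - enorm x).
have h0 x : 0 <= h x by rewrite mulr_ge0 ?clamp_ge0.
have Ch : Cinf h.
  split=> [x|z z0].
    have c1 : {for x, continuous (fun x : V => r + 1 - enorm x)}.
      exact: (continuousB (@cst_continuous _ _ (r + 1) x) (@continuous_enorm R d x)).
    have c2 := continuous_comp c1 (@continuous_clamp R (r + 1 - enorm x)).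
    exact: (continuousM (@cst_continuous _ _ c x) c2).
  by exists (r + 1) => x rx; rewrite /h clamp0 ?mulr0 ?normr0// subr_le0 ltW.
have Bh := Cinf_Bb Ch.
have fh x : `|f x| <= del + h x.
  have [xr|xr] := leP (enorm x) r; last first.
    by rewrite (le_trans (ltW (Hr x xr)))// lerDl.
  rewrite /h clamp1 ?mulr1; last by lra.
  by rewrite (le_trans (fc x))// lerDr ltW.
have Bd := Bb_cst d del.
have Pb x : `|P f x| <= del * m + P h x.
  have Pd : P (fun=> del) x <= del * m.
    rewrite mulrC; apply: (le_trans (ler_norm _)); apply: (sfun_bnd (sP x)) => // y.
    by rewrite gtr0_norm.
  have Bg := BbD Bd Bh.
  have p1 y : 0 <= del + h y - f y by rewrite subr_ge0 (le_trans (ler_norm _)).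
  have p2 y : 0 <= del + h y + f y by have := fh y; rewrite ler_norml => /andP[+ _]; lra.
  have := pP _ (BbB Bg Bf) p1 x; have := pP _ (BbD Bg Bf) p2 x.
  rewrite (sfunB (sP x) Bg Bf) (sfunD (sP x) Bg Bf) (sfunD (sP x) Bd Bh) => g2 g1.
  by rewrite ler_norml; apply/andP; split; lra.
have [_ vh] := cP h Ch; have [r' Hr'] := vh _ (divr_gt0 e0 (ltr0Sn R 1)).
exists r' => x /Hr' hx; apply: (le_lt_trans (Pb x)).
rewrite [e]splitr; apply: ler_ltD; last exact: le_lt_trans (ler_norm _) hx.
by rewrite /del -mulrA ler_piMr// ?divr_ge0 ?(ltW e0)// mulrC ler_pdivrMr// mul1r lerDl.
Qed.

End Transfer.

(** * The perturbed semigroup *)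

Section PerturbedSemigroup.
Context (R : realType) (d : nat).
Notation V := (V R d).
Notation Vb := (Vb R d).
Notation leb := (@lebesgue_measure R).
Notation fam := (R -> (V -> R) -> V -> R).
Variables (H : R -> (V -> R) -> Prop) (rH : regspace H).
Variables (CB : R) (B : (V -> R) -> V -> R) (pB : pertop H CB B) (CB0 : 0 <= CB).
Variables (T : fam) (M w lam : R).
Hypothesis ksg : kernel_sg T M w.
Hypothesis sfT : strong_feller T.
Hypothesis cT : Cb_cond T.
Hypothesis lam0 : 0 <= lam.
Hypothesis wl : w <= lam.
Variable psi : R -> R.
Hypothesis psi_nneg : forall s, 0 <= psi s.
Hypothesis psi_le0 : forall s, s <= 0 -> psi s = 0.
Hypothesis T_H : forall (s : R) (f : V -> R) (c : R),
  Bb f -> (forall x, `|f x| <= c) -> H (psi s * c) (zext T s f).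
Hypothesis ipsi : integ leb (expweight lam psi).
Hypothesis q1 : \int[leb]_s expweight lam (fun s => CB * psi s) s < 1.

Let oT : opfam M lam (zext T) := opfam_zext ksg sfT wl.
Let T_sg := zext_sg ksg.
Let T_0 := zext_0 cT.

Lemma perturbation_input : inputfam (fun s => CB * psi s) (Kfam B (zext T)).
Proof. exact: (Kfam_input rH pB oT T_sg T_0 T_H). Qed.

Let iK := perturbation_input.

Let ipK := ipsiK CB ipsi.

Notation S := (vsol (zext T) (Kfam B (zext T))).
Notation A := (M / (1 - \int[leb]_s expweight lam (fun s => CB * psi s) s)).

Lemma perturbed_opfam : opfam A lam S.
Proof. exact: (vsol_opfam oT iK ipK q1). Qed.

Let oS := perturbed_opfam.

Lemma perturbed_kernel_sg : kernel_sg S A lam.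
Proof.
apply: (opfam_kernel_sg oS) => t s f t0 s0 Bf.
apply: (vsol_sg oT iK ipK q1 T_sg) => // s' r' f' s0' r0' Bf'.
exact: (Kfam_T rH pB oT T_sg).
Qed.

Lemma perturbed_strong_feller : strong_feller S.
Proof. by move=> t f _ Bf; exact: (opfam_Cb oS). Qed.

(** The bound is uniform in [x], so it serves both pointwise continuity at time 0 on [Cb] and norm
    continuity on [Cinf]. *)
Lemma perturbed_close f c : Bb f -> (forall x, `|f x| <= c) ->
  forall (r : nat -> R), (forall n, 0 < r n) -> r n @[n --> \oo] --> 0 ->
  exists2 e : nat -> R, e n @[n --> \oo] --> 0 & forall n x, `|S (r n) f x - T (r n) f x| <= e n.
Proof.
move=> Bf fc r r0 cr; have c0 : 0 <= c by rewrite (le_trans _ (fc 0)).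
exists (fun n => A * expR (lam * r n) * c *
   \int[leb]_s (heav (r n - s) * expweight lam (fun s => CB * psi s) s)).
  rewrite -[X in _ --> X](mulr0 (A * expR (lam * 0) * c)); apply: cvgM.
    apply: cvgMl; apply: cvgMr; apply: (cvg_comp _ _ (cvgMr (a := lam) cr)).
    exact: continuous_expR.
  apply: heav_small => //; first by move=> s; rewrite mulr_ge0.
  by move=> s s0; rewrite psi_le0// mulr0.
move=> n x; rewrite -(zextE T f (r0 n)).
exact: (vsol_T_bnd oT iK ipK q1 _ _ Bf fc).
Qed.

Lemma perturbed_Cb_sg : Cb_sg S.
Proof.
exists A, lam; split; first exact: perturbed_kernel_sg.
split=> [t f _ Cf|f Cf]; first exact: (opfam_Cb oS _ (Cb_Bb Cf)).
have Bf := Cb_Bb Cf; have fc := supn_ge Bf.2; split.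
  exists 1, (A * expR lam * supn f); split => // t /andP[t0 t1] x.
  apply: (le_trans (opfam_bnd oS t x Bf fc)); apply: ler_wpM2r; first exact: supn_ge0 Bf.2.
  apply: ler_wpM2l; first exact: opfam_C0 oS.
  by rewrite ler_expR ler_piMr// ltW.
move=> x; apply/cvg_at_rightP => r [r0 cr].
have [e ce He] := perturbed_close Bf fc r0 cr.
have [_ /(_ x)/cvg_at_rightP h] := cT.2 f Cf; have {}h := h r (conj r0 cr).
rewrite -[f x]add0r (_ : (fun n => S (r n) f x) =
    (fun n => (S (r n) f x - T (r n) f x) + T (r n) f x)); last by apply/funext => n; rewrite subrK.
apply: cvgD => //; apply: (cvg_seq0_le (v := e)) => // n.
by rewrite subr0; exact: He.
Qed.

Lemma perturbed_fullgen u g : fullgen S u g <->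
  exists f, fullgen T u f /\ g = (fun x => f x + B u x).
Proof.
have oS' : opfam A lam (zext S) by rewrite (zext_id oS).
rewrite (fullgen_gen _ _ lam0 oS') (zext_id oS).
rewrite (perturbed_gen rH pB oT lam0 T_sg T_0 T_H ipsi CB0 q1); split.
  by move=> [f gf ->]; exists f; split=> //; apply/(fullgen_gen _ _ lam0 oT).
by move=> [f [/(fullgen_gen _ _ lam0 oT) gf ->]]; exists f.
Qed.

Lemma perturbed_submarkov (c : R) : subMarkov_sg T -> 0 < c ->
  (forall f x, Bb f -> (forall x, 0 <= f x) -> 0 <= B f x + c * f x) ->
  (forall f a x, Bb f -> (forall x, `|f x| <= a) -> `|B f x + c * f x| <= c * a) ->
  forall t f a x, 0 < t -> Bb f -> (forall x, `|f x| <= a) ->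
  `|S t f x| <= a /\ ((forall x, 0 <= f x) -> 0 <= S t f x).
Proof.
move=> [Tpos Tc] c0 Bpos Bc t f a x t0 Bf fa.
apply: (vsol_submarkov oT lam0 iK ipK q1 T_sg _ _ _ c0) => //.
- by move=> s r g s0 r0 Bg; exact: (Kfam_T rH pB oT T_sg).
- move=> s g y Bg g0; have [s0|s0] := ltP 0 s; last by rewrite zext0.
  by rewrite zextE//; exact: Tpos.
- move=> s g b y Bg gb; have [s0|s0] := ltP 0 s.
    by rewrite zextE// (le_trans (Tc s g s0 Bg y))// supn_le.
  by rewrite zext0// normr0 (le_trans _ (gb 0)).
- move=> s g y s0 Bg g0; rewrite /Kfam s0; apply: Bpos; first exact: (opfam_Bb oT).
  by move=> z; rewrite zextE//; exact: Tpos.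
- move=> s g b y s0 Bg gb; rewrite /Kfam s0; apply: Bc; first exact: (opfam_Bb oT).
  by move=> z; rewrite zextE// (le_trans (Tc s g s0 Bg z))// supn_le.
Qed.

Lemma perturbed_vanish : (forall t f, Bb f -> vanish f -> vanish (zext T t f)) ->
  (forall c f, H c f -> vanish f -> vanish (B f)) ->
  forall t f, Bb f -> vanish f -> vanish (S t f).
Proof.
move=> vT vB; apply: (vsol_vanish oT iK ipK q1 vT) => s f Bf vf.
have [s0|s0] := ltP 0 s; last first.
  rewrite (_ : Kfam _ _ _ _ = fun=> 0); first exact: vanish0.
  by apply/funext => x; rewrite (input_le0 iK).
have [_ [c fc]] := Bf.
rewrite (_ : Kfam _ _ _ _ = B (zext T s f)); last by apply/funext => x; rewrite /Kfam s0.
exact: vB (T_H s Bf fc) (vT s f Bf vf).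
Qed.

Lemma perturbed_Cinf_sg : Cinf_sg T -> (forall t f, Bb f -> vanish f -> vanish (zext T t f)) ->
  (forall c f, H c f -> vanish f -> vanish (B f)) -> Cinf_sg S.
Proof.
move=> [_ [_ cinf]] vT vB; split; [by exists A, lam; exact: perturbed_kernel_sg|split].
  move=> t f _ Cf; split; first exact: (opfam_Cb oS t (Cinf_Bb Cf)).1.
  exact: perturbed_vanish (Cinf_Bb Cf) Cf.2.
move=> f Cf; have Bf := Cinf_Bb Cf; have fc := supn_ge Bf.2.
apply/cvg_at_rightP => r [r0 cr]; have [e ce He] := perturbed_close Bf fc r0 cr.
have /cvg_at_rightP h := cinf f Cf; have {}h := h r (conj r0 cr).
have bT n : bnd (fun x => T (r n) f x - f x).
  by apply: (BbB _ Bf).2; apply: Cb_Bb; exact: sfT.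
apply: (cvg_seq0_le (v := fun n => e n + supn (fun x => T (r n) f x - f x))); last first.
  by rewrite -[X in _ --> X](addr0 0); exact: cvgD.
move=> n; rewrite subr0.
have hS x : `|S (r n) f x - f x| <= e n + supn (fun x => T (r n) f x - f x).
  have -> : S (r n) f x - f x = (S (r n) f x - T (r n) f x) + (T (r n) f x - f x) by rewrite addrA subrK.
  by apply: (le_trans (ler_normD _ _)); apply: lerD; [exact: He|exact: (supn_ge (bT n))].
rewrite ger0_norm; first exact: supn_le.
by apply: supn_ge0; exists (e n + supn (fun x => T (r n) f x - f x)).
Qed.

End PerturbedSemigroup.

(** Each approximating semigroup is sub-Markovian by the shifted equation with its own constant
    [k n]. These constants may diverge: passing to the limit uses only stability, where [CB] and
    [psi] do not depend on [n]. *)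
Lemma perturbed_submarkov_lim (R : realType) (d : nat) (H : R -> (V R d -> R) -> Prop) (CB : R)
  (B : (V R d -> R) -> V R d -> R) (T : R -> (V R d -> R) -> V R d -> R) (M w lam : R) (psi : R -> R)
  (Bs : nat -> (V R d -> R) -> V R d -> R) (e k : nat -> R) :
  regspace H -> pertop H CB B -> kernel_sg T M w -> strong_feller T -> Cb_cond T ->
  0 <= lam -> w <= lam -> (forall s, 0 <= psi s) ->
  (forall (s : R) (f : V R d -> R) (c : R),
    Bb f -> (forall x, `|f x| <= c) -> H (psi s * c) (zext T s f)) ->
  integ (@lebesgue_measure R) (expweight lam psi) ->
  \int[@lebesgue_measure R]_s expweight lam (fun s => CB * psi s) s < 1 ->
  (forall n, pertop H CB (Bs n)) -> (forall n, 0 < k n) ->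
  (forall n f x, Bb f -> (forall x, 0 <= f x) -> 0 <= Bs n f x + k n * f x) ->
  (forall n f a x, Bb f -> (forall x, `|f x| <= a) -> `|Bs n f x + k n * f x| <= k n * a) ->
  (forall n c f x, H c f -> `|Bs n f x - B f x| <= e n * c) -> (forall n, 0 <= e n) ->
  e n @[n --> \oo] --> 0 ->
  subMarkov_sg T -> subMarkov_sg (vsol (zext T) (Kfam B (zext T))).
Proof.
move=> rH pB ksg sfT cT lam0 wl psi0 T_H ipsi q1 pBs k0 Bpos Bc eB e0 ce subT.
have oT := opfam_zext ksg sfT wl.
have iK := perturbation_input rH pB ksg sfT cT wl T_H.
have iKn n := perturbation_input rH (pBs n) ksg sfT cT wl T_H.
have ipK := ipsiK CB ipsi.
have K12 n s f c x : Bb f -> (forall x, `|f x| <= c) ->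
    `|Kfam (Bs n) (zext T) s f x - Kfam B (zext T) s f x| <= e n * psi s * c.
  move=> Bf fc; rewrite /Kfam; case: ifP => s0; first by rewrite -mulrA; exact: eB (T_H s f c Bf fc).
  by rewrite subrr normr0 !mulr_ge0// (le_trans _ (fc 0)).
have lim t f x : Bb f -> vsol (zext T) (Kfam (Bs n) (zext T)) t f x @[n --> \oo]
    --> vsol (zext T) (Kfam B (zext T)) t f x.
  move=> Bf; have fc := supn_ge Bf.2.
  have bd n := vsol_stable oT (iKn n) iK ipK ipK q1 q1 ipsi (e0 n) psi0 (K12 n) t x Bf fc.
  move: bd; set a := _ / _; set z := _ * supn f => bd.
  have cz : e n * a * z @[n --> \oo] --> 0.
    by rewrite -[X in _ --> X](mul0r z) -[X in _ --> X * z](mul0r a); apply: cvgMl; exact: cvgMl.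
  exact: (cvg_seq0_le bd cz).
have sub n t f a x : 0 < t -> Bb f -> (forall x, `|f x| <= a) ->
  `|vsol (zext T) (Kfam (Bs n) (zext T)) t f x| <= a /\
  ((forall x, 0 <= f x) -> 0 <= vsol (zext T) (Kfam (Bs n) (zext T)) t f x).
  exact: (perturbed_submarkov rH (pBs n) ksg sfT cT lam0 wl T_H ipsi q1 subT (k0 n) (Bpos n) (Bc n)).
split=> [t f t0 Bf f0 x|t f t0 Bf x].
  apply: (cvg_ge_cst _ (lim t f x Bf)) => n.
  exact: (sub n t f _ x t0 Bf (supn_ge Bf.2)).2.
apply: (cvg_le_cst _ (cvg_norm (lim t f x Bf))) => n.
exact: (sub n t f _ x t0 Bf (supn_ge Bf.2)).1.
Qed.

Theorem theorem6p4 (R : realType) (d : nat)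
  (T : R -> (V R d -> R) -> (V R d -> R)) (M w rho beta : R)
  (chi : V R d -> R) (b : V R d -> V R d)
  (mu : V R d -> {measure set Vb R d -> \bar R}) :
  kernel_sg T M w -> Cb_cond T -> strong_feller T ->
  0 < rho ->
  (forall t f, 0 < t -> Bb f -> Cbrho rho (T t f)) ->
  holder_bound T rho ->
  borelf chi ->
  (forall y, \1_[set z | enorm z < 1] y <= chi y <= \1_[set z | enorm z < 2] y) ->
  (forall i, borelf (fun x => b x 0 i)) ->
  bnd (fun x => enorm (b x)) ->
  (forall x, mu x [set 0] = 0%E) ->
  (forall f, Cc0 f ->
     measurable_fun (setT : set (Vb R d)) (fun x => (\int[mu x]_y (f y)%:E)%E)) ->
  0 < beta < 2 -> beta < rho ->
  (exists C : R, forall x,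
     (\int[mu x]_y (Num.min ((enorm y) `^ beta) 1)%:E <= C%:E)%E) ->
  (rho <= 1 -> forall x i,
     b x 0 i - Rintegral (mu x) (~` [set 0]) (fun y => y 0 i * chi y) = 0) ->
  exists S : R -> (V R d -> R) -> (V R d -> R),
    (* (a) *)
    Cb_sg S /\ strong_feller S /\
    (forall u g, fullgen S u g <->
       exists f, fullgen T u f /\ g = (fun x => f x + Bhat rho b chi mu u x)) /\
    (* (b) *)
    (subMarkov_sg T -> subMarkov_sg S) /\
    (* (c) *)
    ((forall e : R, 0 < e -> exists R0 : R, forall r, R0 < r -> forall x,
        (mu x [set y | (r < enorm y)%R] <= e%:E)%E) ->
     positive_sg T -> Cinf_sg T -> Ccinf_core T ->
     Cinf_sg S).
Proof.
move=> ksg cT sfT rho0 T_rho [phi [iphi phib]] chi_b chi_bnd b_b [bb bbP] _ mu_Cc0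
  /andP[beta0 beta2] beta_rho [C mu_C] _.
have b_bnd x : enorm (b x) <= bb by exact: le_trans (ler_norm _) (bbP x).
have beta_al : beta < al rho by rewrite lt_min beta_rho.
have C0 : 0 <= C := C_ge0 mu_C.
have rH := regspace_hreg d rho0.
have pB := pertop_Bhat mu_Cc0 beta0 mu_C rho0 beta_al chi_b chi_bnd b_b b_bnd.
set CB := _ + _ in pB; have CB0 : 0 <= CB.
  by rewrite addr_ge0 ?(levybd_ge0 mu_C b_bnd)// addr_ge0.
have T_H := zext_H ksg sfT rho0 T_rho phib.
(* [lam] is fixed here once and for all; [CB] being common to [Bhat] and its approximations, it
   works for all of them. *)
have [lam [lam0 /ltW wl ipsi q1]] := psi_small ksg iphi phib CB0.
have psi0 := psi_nonneg ksg phib.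
have pz := @psi_le0 R d M w phi.
exists (vsol (zext T) (Kfam (Bhat rho b chi mu) (zext T))).
split; [|split; [|split; [|split]]].
- exact: (perturbed_Cb_sg rH pB CB0 ksg sfT cT lam0 wl psi0 pz T_H ipsi q1).
- exact: (perturbed_strong_feller rH pB ksg sfT cT wl T_H ipsi q1).
- exact: (perturbed_fullgen rH pB CB0 ksg sfT cT lam0 wl T_H ipsi q1).
- have [Bs [e [k [pBs k0 Bpos Bc [eB [e0 ce]]]]]] :=
    Bhat_approximation mu_Cc0 beta0 mu_C rho0 beta_al chi_b chi_bnd b_b b_bnd.
  exact: (perturbed_submarkov_lim rH pB ksg sfT cT lam0 wl psi0 T_H ipsi q1 pBs k0 Bpos Bc eB e0 ce).
- move=> tail Tpos Tinf _.
  apply: (perturbed_Cinf_sg rH pB CB0 ksg sfT cT wl psi0 pz T_H ipsi q1 Tinf) => [s f Bf vf|c f Hf vf].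
  + have [s0|s0] := leP s 0; first by rewrite zext0//; exact: vanish0.
    have sT x := opfam_sfun (opfam_zext ksg sfT wl) s x.
    apply: (positive_vanish sT) => //.
      by move=> g Bg g0 x; rewrite zextE//; exact: Tpos.
    by move=> g Cg; rewrite zextE//; exact: Tinf.2.1.
  + exact: (Bhat_vanish beta0 mu_C rho0 beta_al chi_b chi_bnd b_bnd tail Hf vf).
Qed.
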